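(* Let $O$ be a compact, connected, oriented hyperbolic $2$-orbifold with non-empty boundary, let $g$ be its genus and $r$ the total number of its boundary components and singular (cone) points, and assume $(g,r)\ne(0,3)$. Let $\Gamma$ be a finite index subgroup of $\mathrm{Map}^{or}(O)$ and $\alpha_0\in\mathcal A_m(O)$ a weighted multiarc. Then for any function $F$ on $\mathcal A_m(O)$ which extends to a positive function on currents we have $$\lim_{L\to\infty}\frac{\#\{\alpha\in\Gamma\cdot\alpha_0\mid F(\alpha)\le L\}}{L^{6g-6+2r}}=\mathfrak c^\Gamma_{g,r}(\alpha_0)\cdot\mathfrak m^O_{Thu}(\{\lambda\in\mathcal{ML}(O)\mid F(\lambda)\le1\}),$$ where $\mathfrak c^\Gamma_{g,r}(\alpha_0)$ is the constant (not depending on $F$) such that the measures $\frac1{L^{6g-6+2r}}\sum_{\alpha\in\Gamma\cdot\alpha_0}\delta_{\frac1L\widehat\alpha}$ on $\mathcal C^{or}(DO)$ converge in the weak* topology to $\mathfrak c^\Gamma_{g,r}(\alpha_0)\cdot\widehat{\mathfrak m}^O_{Thu}$ as $L\to\infty$.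
   Context: $O$ carries a fixed hyperbolic structure with geodesic boundary and isolated cone points; its orbifold universal cover $\widetilde O$ is a convex subset of $\mathbb H^2$ bounded by geodesics, on which $\pi_1^{orb}(O)$ acts. $\mathrm{Map}^{or}(O)$ is the group of isotopy classes of orientation-preserving orbifold homeomorphisms of $O$ (preserving the set of cone points and their orders; the boundary need not be fixed pointwise). Currents: $\mathcal C^{or}(O)$ is the space of $\pi_1^{orb}(O)$-invariant Radon measures on the set of bi-infinite unoriented geodesics of $\widetilde O$, with the weak* topology; similarly for $DO$. A closed curve, i.e. the conjugacy class (up to inversion) of an infinite order element $h$ of the orbifold fundamental group $\pi$, gives the current $\sum_{x\langle h\rangle\in\pi/\langle h\rangle}\delta_{x\cdot\mathrm{axis}(h)}$; this extends linearly to weighted multicurves. Arcs: an arc of $O$ is an orbifold free homotopy class of unoriented segments with endpoints on $\partial O$ that is not homotopic into $\partial O$; equivalently, a $\pi_1^{orb}(O)$-orbit of unordered pairs $\{A,B\}$ of distinct boundary geodesics of $\widetilde O$. Weighted multiarcs are formal sums $\sum_{j=1}^k a_j\alpha_j$ ($k\ge1$) of arcs with positive weights; $\mathcal A_m(O)$ is the set of these, and $\mathrm{Map}^{or}(O)$ acts on it. Doubling: $DO$ is the closed hyperbolic orbifold obtained by gluing two copies of $O$ along the boundary by the identity, with embeddings $i^\pm:O\to DO$, which induce $i^\pm:\mathcal C^{or}(O)\to\mathcal C^{or}(DO)$. For $\mu\in\mathcal C^{or}(O)$ set $\widehat\mu=i^+(\mu)+i^-(\mu)$. For an arc $\alpha$,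 $\widehat\alpha\in\mathcal C^{or}(DO)$ is the current of the closed curve $i^+(\alpha)\cup i^-(\alpha)$. Concretely, if $\alpha$ is given by $\{A,B\}$ with $\widetilde O\subset\mathbb H^2=\widetilde{DO}$ and $R_A,R_B$ are the reflections in $A,B$, it is the current of the class of $R_BR_A\in\pi_1^{orb}(DO)$. This is extended linearly to weighted multiarcs. Thurston measure: $\mathcal{ML}(O)\subset\mathcal C^{or}(O)$ is the space of measured laminations (no boundary component as leaf). Let $\Sigma_O$ be the compact surface of genus $g$ with $r$ boundary components obtained from $O$ by removing small open disc neighbourhoods of the cone points. Its Thurston measure is $\mathfrak m^{\Sigma_O}_{Thu}=\lim_{L\to\infty}\frac1{L^{6g-6+2r}}\sum_{\gamma\in\mathcal{ML}_{\mathbb Z}(\Sigma_O)}\delta_{\frac1L\gamma}$ on $\mathcal{ML}(\Sigma_O)$, where $\mathcal{ML}_{\mathbb Z}$ denotes integrally weighted simple multicurves with non-peripheral components. $\mathfrak m^O_{Thu}$ is the pushforward of $\mathfrak m^{\Sigma_O}_{Thu}$ under the natural continuous map $\mathcal{ML}(\Sigma_O)\to\mathcal{ML}(O)$ extending homogeneously the map which sends a simple curve of $\Sigma_O$ to the current of the curve it represents in $O$. $\widehat{\mathfrak m}^O_{Thu}$ is the pushforward of $\mathfrak m^O_{Thu}$ under $\lambda\mapsto\widehat\lambda$. Extension: a function $F$ on $\mathcal A_m(O)$ extends to currents if there is a continuous and homogeneous ($F(t\mu)=tF(\mu)$ for $t>0$) function on $\mathcal C^{or}(DO)$, also denoted $F$,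 such that $F(\widehat\alpha)=2F(\alpha)$ for every $\alpha\in\mathcal A_m(O)$. $F$ is then also regarded as a function on $\mathcal C^{or}(O)$, normalised by $F(\widehat\mu)=2F(\mu)$. The extension is called positive if $F(\mu)>0$ for every nonzero $\mu\in\mathcal C^{or}(O)$. *)

(* Defs.v *)
From HB Require Import structures.
From mathcomp Require Import all_boot all_order all_algebra.
From mathcomp Require Import all_classical all_reals all_analysis.

Set Implicit Arguments.
Unset Strict Implicit.
Unset Printing Implicit Defensive.
Import Order.TTheory GRing.Theory Num.Theory.
Import numFieldNormedType.Exports.
Local Open Scope classical_set_scope.
Local Open Scope ring_scope.

(* The hyperbolic plane is the upper sheet of the hyperboloid in R^{2,1};
   isometries are the matrices in O(2,1) preserving the sheet, and the
   orientation preserving ones are those of determinant 1. *)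
Section HyperbolicPlane.
Variable R : realType.
Implicit Types (u v x y z : 'cV[R]_3) (w A B : 'M[R]_3) (X : set 'cV[R]_3).

Definition minkowski : 'M[R]_3 := \matrix_(i, j)
  (if i == j then (if i == ord_max then -1 else 1) else 0).

Definition mdot u v : R := (u^T *m minkowski *m v) 0 0.

Definition hyp : set 'cV[R]_3 :=
  [set v | mdot v v = -1 /\ 0 < v ord_max 0].

Definition isometry w : Prop :=
  w^T *m minkowski *m w = minkowski /\ 0 < w ord_max ord_max.

(* A geodesic is encoded by the reflection in it, so that the topology of the
   space of unoriented geodesics is the one induced from 'M[R]_3. *)
Definition reflection u : 'M[R]_3 := 1 - 2 *: (u *m u^T *m minkowski).

Definition geodesic : set 'M[R]_3 :=
  [set A | exists2 u, mdot u u = 1 & A = reflection u].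

Definition points A : set 'cV[R]_3 := [set v | hyp v /\ A *m v = v].

Definition act w A : 'M[R]_3 := w * A * w^-1.

Definition cross A B : Prop := A <> B /\ points A `&` points B !=set0.

Definition hyp_convex X : Prop := forall x y z (a b : R), X x -> X y -> hyp z ->
  0 <= a -> 0 <= b -> z = a *: x + b *: y -> X z.

(* interior of X relative to the hyperbolic plane *)
Definition inner X : set 'cV[R]_3 :=
  [set x | X x /\ \forall y \near x, hyp y -> X y].

Definition geodesics_in X : set 'M[R]_3 :=
  [set A | geodesic A /\ points A `<=` X].

Definition subgroup (G : set 'M[R]_3) : Prop :=
  [/\ G 1, forall a b, G a -> G b -> G (a * b) & forall a, G a -> G a^-1].

Definition lcoset a (K : set 'M[R]_3) : set 'M[R]_3 := [set a * k | k in K].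

Definition lcosets (S K : set 'M[R]_3) : set (set 'M[R]_3) :=
  [set lcoset a K | a in S].

Definition repr (c : set 'M[R]_3) : 'M[R]_3 := xget 1 c.

Definition cyclic_group h : set 'M[R]_3 := [set h ^ n | n in [set: int]].

Definition axis h : 'M[R]_3 :=
  xget 1 [set A | geodesic A /\ h * A = A * h].

End HyperbolicPlane.

(* The universal cover X of a compact connected oriented hyperbolic orbifold
   with geodesic boundary, with the action of its orbifold fundamental group. *)
Record orbifold (R : realType) := Orbifold {
  grp : set 'M[R]_3 ;
  cover : set 'cV[R]_3 ;
  grp_subgroup : subgroup grp ;
  grp_isometry : forall w, grp w -> isometry w /\ \det w = 1 ;
  grp_discrete : forall C : R,
    finite_set [set w | grp w /\ forall i j, `|w i j| <= C] ;
  cover_hyp : cover `<=` @hyp R ;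
  cover_closed : closed cover ;
  cover_convex : hyp_convex cover ;
  cover_inner : inner cover !=set0 ;
  cover_invariant : forall w x, grp w -> cover x -> cover (w *m x) ;
  cover_frontier : forall x, cover x -> ~ inner cover x ->
    exists A, [/\ geodesic A, points A x &
                  points A `<=` cover `\` inner cover] ;
  cover_cocompact : exists K, [/\ compact K, K `<=` cover &
    forall x, cover x -> exists2 w, grp w & K (w *m x)] }.

Section Orbifolds.
Variable R : realType.
Implicit Types (O : orbifold R) (x y p : 'cV[R]_3) (w A B : 'M[R]_3).

Definition boundary_geodesic O : set 'M[R]_3 :=
  [set A | geodesic A /\ points A `<=` cover O `\` inner (cover O)].

Definition cone_point O : set 'cV[R]_3 :=
  [set p | cover O p /\ exists w, [/\ grp O w, w != 1 & w *m p = p]].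

Definition same_point O x y : Prop := exists2 w, grp O w & x = w *m y.

Definition boundary_components O : set (set 'M[R]_3) :=
  [set [set act w A | w in grp O] | A in boundary_geodesic O].

Definition cone_points O : set (set 'cV[R]_3) :=
  [set [set w *m p | w in grp O] | p in cone_point O].

Definition boundary_and_cone_number O (r : nat) : Prop := exists b k : nat,
  [/\ (boundary_components O #= `I_b)%card, (cone_points O #= `I_k)%card &
      r = (b + k)%N].

(* n disjoint simple closed curves in the interior of the surface underlying O,
   given by lifts to the universal cover, whose complement is connected. *)
Definition nonseparating O (n : nat) (c : 'I_n -> R -> 'cV[R]_3) : Prop :=
  [/\ forall i, {within `[0, 1], continuous (c i)},
      forall i t, 0 <= t <= 1 -> inner (cover O) (c i t),
      forall i, same_point O (c i 1) (c i 0),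
      forall i j s t, 0 <= s < 1 -> 0 <= t < 1 ->
        same_point O (c i s) (c j t) -> i = j /\ s = t &
      let Y := [set x | cover O x /\
        forall i t, 0 <= t <= 1 -> ~ same_point O x (c i t)] in
      forall x y, Y x -> Y y -> exists (q : R -> 'cV[R]_3),
        [/\ {within `[0, 1], continuous q}, forall t, 0 <= t <= 1 -> Y (q t),
            q 0 = x & same_point O (q 1) y]].

Definition genus O (g : nat) : Prop :=
  (exists c : 'I_g -> R -> 'cV[R]_3, nonseparating O c) /\
  ~ (exists c : 'I_g.+1 -> R -> 'cV[R]_3, nonseparating O c).

End Orbifolds.

Section Measures.
Variable R : realType.

Definition borel (T : ptopologicalType) := g_sigma_algebraType (@open T).

Definition compactly_supported (T : topologicalType) (f : T -> R) : Prop :=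
  continuous f /\ exists2 K, compact K & forall x, f x != 0 -> K x.

Definition borel_measure (T : ptopologicalType) : Type :=
  {measure set (borel T) -> \bar R}.

HB.instance Definition _ T := gen_eqMixin (borel_measure T).
HB.instance Definition _ T := gen_choiceMixin (borel_measure T).

(* the Borel measure with the values of m on Borel sets (zero if there is none,
   that is, if m is not sigma-additive on Borel sets) *)
Definition as_measure (T : ptopologicalType) (m : set (borel T) -> \bar R) :
    borel_measure T :=
  xget (mzero : borel_measure T) [set nu | forall E, measurable E -> nu E = m E].

(* weak* convergence of measures, tested on compactly supported functions *)
Definition weak_star_cvg (T : ptopologicalType)
    (m_ : R -> set (borel T) -> \bar R) (m : set (borel T) -> \bar R) : Prop :=
  forall f : T -> R, compactly_supported f ->
    (\int[as_measure (m_ L)]_x (f x)%:E)%E @[L --> +oo] -->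
    (\int[as_measure m]_x (f x)%:E)%E.

Definition gmeasure := borel_measure 'M[R]_3.

(* Two measures may coincide on all Borel sets and yet differ as functions; the
   vanishing on the other sets makes measures equal when they agree on Borel
   sets. *)
Definition radon (mu : gmeasure) : Prop :=
  (forall K : set 'M[R]_3, compact K -> (mu K < +oo)%E) /\
  (forall E : set (borel 'M[R]_3), ~ measurable E -> mu E = 0%E).

Record mclass := MClass {
  minclass : set gmeasure ;
  minclass0 : minclass (mzero : gmeasure) }.

Definition mtype (P : mclass) := {mu : gmeasure | minclass P mu}.

HB.instance Definition _ P := gen_eqMixin (mtype P).
HB.instance Definition _ P := gen_choiceMixin (mtype P).
HB.instance Definition _ P :=
  isPointed.Build (mtype P) (exist (minclass P) (mzero : gmeasure) (minclass0 P)).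

Definition test_function := {f : 'M[R]_3 -> R | compactly_supported f}.

Definition evaluation (P : mclass) (mu : mtype P) : {ptws test_function -> R} :=
  fun f => \int[sval mu]_A (sval f A).

(* measures in the class P, with the weak* topology *)
Definition mspace (P : mclass) := initial_topology (@evaluation P).

HB.instance Definition _ P := PointedTopological.on (mspace P).

Definition mval (P : mclass) (mu : mspace P) : gmeasure := sval mu.

(* the measure of class P whose values on the Borel sets are those of m (and
   the zero measure if there is none) *)
Definition the_measure (P : mclass) (m : set (borel 'M[R]_3) -> \bar R) :
    mspace P :=
  xget point [set nu | forall E, measurable E -> mval nu E = m E].

Definition scale (P : mclass) (t : R) (mu : mspace P) : mspace P :=
  the_measure P (fun E => t%:E * mval mu E)%E.

(* sum over a in D of the Dirac masses at x a, scaled by 1 / L ^ d *)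
Definition counting_measure (I : choiceType) (T : ptopologicalType)
    (D : set I) (x : R -> I -> T) (d : int) (L : R) (E : set (borel T)) :
    \bar R :=
  ((L ^ d)^-1)%:E * (\esum_(a in D) \d_(x L a : borel T) E)%E.

End Measures.

Section Currents.
Variable R : realType.
Implicit Types (G : set 'M[R]_3) (X : set 'cV[R]_3) (O : orbifold R).
Implicit Types (h w A B : 'M[R]_3).

(* The set of geodesics contained in X being closed in 'M[R]_3 when X is closed,
   its Radon measures are those of 'M[R]_3 carried by it. *)
Definition is_current G X (mu : gmeasure R) : Prop :=
  [/\ radon mu, mu (~` geodesics_in X) = 0%E &
      forall w (E : set (borel 'M[R]_3)), G w -> measurable E ->
        mu (act w @^-1` E) = mu E].

Lemma is_current0 G X : is_current G X mzero.
Proof. by split => //; split => // K _; rewrite /mzero ltry. Qed.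

Definition current_class G X := MClass (@is_current0 G X).

Definition currents O := mspace (current_class (grp O) (cover O)).

Definition support (mu : gmeasure R) : set 'M[R]_3 :=
  [set A | forall U : set 'M[R]_3, open U -> U A -> (0 < mu U)%E].

Definition is_lamination O (mu : gmeasure R) : Prop :=
  [/\ is_current (grp O) (cover O) mu,
      forall A B, support mu A -> support mu B -> ~ cross A B &
      forall A, support mu A -> ~ boundary_geodesic O A].

Lemma is_lamination0 O : is_lamination O mzero.
Proof.
have supp0 A : ~ support mzero A.
  by move=> /(_ setT openT I); rewrite /mzero ltxx.
by split=> [|A B /supp0 //|A /supp0 //]; exact: is_current0.
Qed.

Definition lamination_class O := MClass (@is_lamination0 O).

Definition ML O := mspace (lamination_class O).

(* the current of the conjugacy class of h in G *)
Definition curve G h (E : set (borel 'M[R]_3)) : \bar R :=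
  (\esum_(c in lcosets G (cyclic_group h)) \d_(act (repr c) (axis h) : borel 'M[R]_3) E)%E.

(* The translates of the cover of O by the group generated by grp O and the
   reflections in the boundary geodesics tile the hyperbolic plane. This is
   the universal cover of the double DO, whose fundamental group consists of
   the orientation preserving elements. *)
Definition reflection_group O : set 'M[R]_3 :=
  [set w | forall S, subgroup S -> grp O `<=` S ->
             boundary_geodesic O `<=` S -> S w].

Definition dgrp O : set 'M[R]_3 :=
  [set w | reflection_group O w /\ \det w = 1].

Definition dcurrent_class O := current_class (dgrp O) (@hyp R).

Definition dcurrents O := mspace (dcurrent_class O).

Definition translates O (S : set 'M[R]_3) (mu : gmeasure R)
    (E : set (borel 'M[R]_3)) : \bar R :=
  (\esum_(c in lcosets S (grp O)) mu (act (repr c) @^-1` E))%E.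

(* The tiles w (cover O) with w in dgrp O are the lifts of the copy i^+(O) of O
   in DO, and the other tiles are the lifts of the reflected copy i^-(O). *)
Definition iplus O (mu : gmeasure R) := translates O (dgrp O) mu.

Definition iminus O (mu : gmeasure R) :=
  translates O (reflection_group O `\` dgrp O) mu.

Definition hat O (mu : gmeasure R) : dcurrents O :=
  the_measure (dcurrent_class O) (fun E => iplus O mu E + iminus O mu E)%E.

End Currents.

Section Arcs.
Variable R : realType.
Implicit Types (O : orbifold R) (A B : 'M[R]_3).

(* an orbit of unordered pairs of boundary geodesics, these being given by
   their sets of points *)
Definition arc_type : Type := set (set (set 'cV[R]_3)).

Definition arc_of O A B : arc_type :=
  [set [set points (act w A); points (act w B)] | w in grp O].

Definition arc_ends O (a : arc_type) : set ('M[R]_3 * 'M[R]_3) :=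
  [set e | [/\ boundary_geodesic O e.1, boundary_geodesic O e.2, e.1 <> e.2 &
               a = arc_of O e.1 e.2]].

Definition arc O : set arc_type := [set a | arc_ends O a !=set0].

(* the weights of a formal sum of arcs *)
Definition weights : Type := arc_type -> R.

Definition multiarc O : set weights :=
  [set m | [/\ forall a, 0 <= m a, forall a, m a != 0 -> arc O a,
               finite_set [set a | m a != 0] & exists a, m a != 0]].

Definition double_of_arc O (a : arc_type) : 'M[R]_3 :=
  let e := xget (1, 1) (arc_ends O a) in e.2 * e.1.

Definition hat_multiarc O (m : weights) : dcurrents O :=
  the_measure (dcurrent_class O) (fun E =>
    \sum_(a \in arc O) (m a)%:E * curve (dgrp O) (double_of_arc O a) E)%E.

End Arcs.

Section MappingClassGroup.
Variables (R : realType) (O : orbifold R).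
Implicit Types (f : 'cV[R]_3 -> 'cV[R]_3) (x y : 'cV[R]_3).
Let X := cover O.

(* vertical projection of the hyperboloid to the plane, and its inverse *)
Definition chart x : R * R := (x 0 0, x 1 0).

Definition unchart (a b : R) : 'cV[R]_3 := \col_i
  (if i == 0 then a else if i == 1 then b else Num.sqrt (1 + a ^+ 2 + b ^+ 2)).

(* The images by f of the small circles around an interior point x have winding
   number 1 around f x; phi is a continuous choice of the argument. *)
Definition orientation_preserving f : Prop := forall x, inner X x ->
  let circle e t :=
    unchart ((chart x).1 + e * cos t) ((chart x).2 + e * sin t) in
  \forall e \near 0^'+, exists (rho phi : R -> R),
    [/\ continuous phi, forall t, 0 < rho t,
        forall t, phi (t + 2 * pi) = phi t + 2 * pi &
        forall t, X (circle e t) /\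
          chart (f (circle e t)) = ((chart (f x)).1 + rho t * cos (phi t),
                                    (chart (f x)).2 + rho t * sin (phi t))].

(* lifts to the universal cover of the orientation preserving orbifold
   homeomorphisms; only the values of f on the cover matter *)
Definition homeo f : Prop :=
  [/\ {within X, continuous f},
      exists2 f', {within X, continuous f'} & forall x, X x ->
        [/\ X (f x), X (f' x), f' (f x) = x & f (f' x) = x],
      forall w, grp O w -> exists2 w', grp O w' &
        forall x, X x -> f (w *m x) = w' *m f x,
      forall w', grp O w' -> exists2 w, grp O w &
        forall x, X x -> f (w *m x) = w' *m f x &
      orientation_preserving f].

(* f and f' are lifts of isotopic homeomorphisms of O *)
Definition isotopic f f' : Prop :=
  exists2 w, grp O w & exists H : R -> 'cV[R]_3 -> 'cV[R]_3,
    [/\ forall t, 0 <= t <= 1 -> homeo (H t),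
        {within [set z : R * 'cV[R]_3 | 0 <= z.1 <= 1 /\ X z.2],
          continuous (fun z => H z.1 z.2)},
        forall x, X x -> H 0 x = f x &
        forall x, X x -> H 1 x = w *m f' x].

(* Finite index subgroups of Map^or(O), given by their preimages in the group
   of all lifts. *)
Definition finite_index_subgroup (Gam : set ('cV[R]_3 -> 'cV[R]_3)) : Prop :=
  [/\ Gam `<=` homeo /\ Gam id,
      forall f f', Gam f -> Gam f' -> Gam (f \o f'),
      forall f f', Gam f -> homeo f' -> (forall x, X x -> f' (f x) = x) -> Gam f',
      forall f f', Gam f -> homeo f' -> isotopic f f' -> Gam f' &
      exists n (s : 'I_n -> 'cV[R]_3 -> 'cV[R]_3), (forall i, homeo (s i)) /\
        forall f, homeo f -> exists i f', Gam f' /\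
          forall x, X x -> f x = s i (f' x)].

Definition arc_image f (a : arc_type R) : arc_type R :=
  [set [set f @` A | A in e] | e in a].

Definition multiarc_orbit (Gam : set ('cV[R]_3 -> 'cV[R]_3)) (m : weights R) :
    set (weights R) :=
  [set m' | multiarc O m' /\
    exists2 f, Gam f & forall a, arc O a -> m' (arc_image f a) = m a].

End MappingClassGroup.

Section Thurston.
Variable R : realType.
Implicit Types (O S : orbifold R) (h : 'M[R]_3).

(* J is a lift to universal covers of a homeomorphism from the hyperbolic
   surface S onto the complement Sigma_O in O of the images of the open balls
   {x | cosh d(x, p) < delta} around the cone points p, and rho is the induced
   homomorphism of orbifold fundamental groups. *)
Record surface_of O S (J : 'cV[R]_3 -> 'cV[R]_3) (rho : 'M[R]_3 -> 'M[R]_3)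
    (delta : R) : Prop := SurfaceOf {
  surface_smooth : cone_point S = set0 ;
  surface_delta : 1 < delta ;
  surface_discs : forall p x, cone_point O p -> hyp x ->
    - mdot x p <= delta -> inner (cover O) x ;
  surface_disjoint : forall p q x, cone_point O p -> cone_point O q -> hyp x ->
    - mdot x p <= delta -> - mdot x q <= delta -> p = q ;
  surface_continuous : {within cover S, continuous J} ;
  surface_image : J @` cover S =
    [set x | cover O x /\ forall p, cone_point O p -> delta <= - mdot x p] ;
  surface_morphism : forall a b, grp S a -> grp S b ->
    rho (a * b) = rho a * rho b ;
  surface_equivariant : forall a x, grp S a -> cover S x ->
    grp O (rho a) /\ J (a *m x) = rho a *m J x ;
  surface_injective : forall x y, cover S x -> cover S y ->
    same_point O (J x) (J y) -> same_point S x y }.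

(* primitive elements whose axis projects to a simple non-peripheral geodesic *)
Definition simple_curve S h : Prop :=
  [/\ grp S h, forall a n, grp S a -> a ^+ n = h -> n = 1%N,
      ~ boundary_geodesic S (axis h) &
      forall a, grp S a -> ~ cross (axis h) (act a (axis h))].

Definition curve_ML S h : ML S := the_measure (lamination_class S) (curve (grp S) h).

(* That the components are pairwise disjoint is expressed by the membership
   in ML S. *)
Definition ML_int S : set (ML S) :=
  [set lam | exists k (h : 'I_k.+1 -> 'M[R]_3) (n : 'I_k.+1 -> nat),
    (forall i, simple_curve S (h i) /\ (0 < n i)%N) /\
    forall E, measurable E ->
      mval lam E = (\sum_(i < k.+1) (n i)%:R%:E * curve (grp S) (h i) E)%E].

Definition growth (g r : nat) : int := (6 * g)%N%:Z - 6 + (2 * r)%N%:Z.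

Definition thurston_measure S (d : int)
    (m : {measure set (borel (ML S)) -> \bar R}) : Prop :=
  (forall K : set (ML S), compact K -> (m K < +oo)%E) /\
  weak_star_cvg
    (counting_measure (@ML_int S) (fun L lam => scale L^-1 lam) d) m.

Definition natural_map O S (rho : 'M[R]_3 -> 'M[R]_3) (Phi : ML S -> ML O) :
    Prop :=
  [/\ continuous Phi,
      forall t lam, 0 < t -> Phi (scale t lam) = scale t (Phi lam) &
      forall h, simple_curve S h ->
        Phi (curve_ML S h) =
          the_measure (lamination_class O) (curve (grp O) (rho h))].

Definition thurston_orbifold O S (m : set (borel (ML S)) -> \bar R)
    (Phi : ML S -> ML O) : set (borel (ML O)) -> \bar R :=
  pushforward m (Phi : borel (ML S) -> borel (ML O)).

Definition hat_thurston O S (m : set (borel (ML S)) -> \bar R)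
    (Phi : ML S -> ML O) : set (borel (dcurrents O)) -> \bar R :=
  pushforward (thurston_orbifold m Phi)
    ((fun lam => hat O (mval lam)) : borel (ML O) -> borel (dcurrents O)).

Definition counting_constant O S (m : set (borel (ML S)) -> \bar R)
    (Phi : ML S -> ML O) (Gam : set ('cV[R]_3 -> 'cV[R]_3)) (m0 : weights R)
    (d : int) (c : R) : Prop :=
  0 <= c /\
  weak_star_cvg
    (counting_measure (multiarc_orbit O Gam m0)
       (fun L a => scale L^-1 (hat_multiarc O a)) d)
    (fun E => c%:E * hat_thurston m Phi E)%E.

(* Fbar, a function on the currents of DO, extends F. *)
Definition extends O (F : weights R -> R) (Fbar : dcurrents O -> R) : Prop :=
  [/\ continuous Fbar,
      forall t nu, 0 < t -> Fbar (scale t nu) = t * Fbar nu &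
      forall a, multiarc O a -> Fbar (hat_multiarc O a) = 2 * F a].

(* the function on currents of O induced by Fbar *)
Definition on_currents O (Fbar : dcurrents O -> R) (mu : gmeasure R) : R :=
  Fbar (hat O mu) / 2.

(* point is the zero current *)
Definition positive_extension O (Fbar : dcurrents O -> R) : Prop :=
  forall mu : currents O, mu <> point -> 0 < on_currents Fbar (mval mu).

End Thurston.

(* Main.v *)
From HB Require Import structures.
From mathcomp Require Import all_boot all_order all_algebra.
From mathcomp Require Import all_classical all_reals all_analysis.
From mathcomp Require Import finmap ring lra measurable_realfun.
Require Import Defs.
Set Implicit Arguments.
Unset Strict Implicit.
Unset Printing Implicit Defensive.
Import Order.TTheory GRing.Theory Num.Theory.
Import numFieldNormedType.Exports.
Local Open Scope classical_set_scope.
Local Open Scope ring_scope.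

(** Positivity is assumed only on currents of [O], while the doubles of multiarcs are general
    currents of [DO], where [Fbar] may vanish or be negative. Its sublevel sets need not be compact
    there, so coercivity has to be proved along the orbit. The uniform bound on crossings is
    geometric: the axis of [R_B R_A] is the common perpendicular of [A] and [B], and it meets walls
    only at translates of its two feet, orthogonally. A crossing point is therefore the point of the
    axis nearest to any given point of the wall, which bounds the number of crossings in a ball
    independently of the arc. Reflection invariance of the doubles holds because conjugation by
    [R_A] inverts [R_B R_A], although [curve] sums over orientation preserving elements only. Limits
    of currents come from Tychonoff's theorem and the Riesz representation theorem; the latter also
    produces the current of [O] whose double is [nu], as [nu] weighted by the inverse of the number
    of tiles that contain a geodesic. In the final squeeze the counting function is rescaled, where
    homogeneity is exact, so that jumps or infinite values of the limit volume do no harm. *)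

(* Testing the given weak* convergence on functions that approximate the
   indicator of {Fbar <= s}, and using homogeneity to squeeze as s tends to 2,
   gives the asymptotics; these functions have compact support as soon as no
   mass escapes, that is, if Fbar >= e * length, up to a constant, on the
   doubles of the multiarcs in the orbit and of the currents of O.  Otherwise,
   normalised doubles of length going to infinity accumulate at a current nu of
   DO of length 1 with Fbar nu <= 0.  The walls are the translates of the
   boundary geodesics.  The double of an arc meets a wall exactly where it
   meets the boundary of O, and its total weight is constant along the orbit,
   so that the mass of geodesics crossing a given wall in a compact set stays
   bounded, and vanishes for nu.  Hence nu, which is invariant under the
   reflections, is the double of a nonzero current of O, where Fbar is positive.

   Positivity of Fbar on the doubles also shows that the doubles are not
   defined by their default value; applied to the counting measure on the
   boundary geodesics, this makes the reflection group discrete. *)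

(** * The hyperboloid model *)

Section Hyperboloid.
Variable R : realType.
Implicit Types (u v x y z : 'cV[R]_3) (w A B : 'M[R]_3).

Lemma sum3 (V : nmodType) (f : 'I_3 -> V) : \sum_i f i = f 0 + f 1 + f ord_max.
Proof.
rewrite !big_ord_recr big_ord0 /= add0r; congr (f _ + f _ + f _); exact: val_inj.
Qed.

Lemma ord3P (P : 'I_3 -> Prop) : P 0 -> P 1 -> P ord_max -> forall i, P i.
Proof.
move=> P0 P1 P2 [[|[|[|//]]]] p; [have -> // : Ordinal p = 0|
  have -> // : Ordinal p = 1|have -> // : Ordinal p = ord_max]; exact: val_inj.
Qed.

Lemma cv3P u v : u 0 0 = v 0 0 -> u 1 0 = v 1 0 ->
  u ord_max 0 = v ord_max 0 -> u = v.
Proof.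
move=> e0 e1 e2; apply/matrixP => i j; rewrite (ord1 j); move: i.
exact: ord3P.
Qed.

Lemma mulmx3E m n (A : 'M[R]_(m, 3)) (B : 'M[R]_(3, n)) i j :
  (A *m B) i j = A i 0 * B 0 j + A i 1 * B 1 j + A i ord_max * B ord_max j.
Proof. by rewrite mxE sum3. Qed.

Lemma minkowskiE :
  ((minkowski R 0 0 = 1) * (minkowski R 1 1 = 1) *
   (minkowski R ord_max ord_max = -1) * (minkowski R 0 1 = 0) *
   (minkowski R 1 0 = 0) * (minkowski R 0 ord_max = 0) *
   (minkowski R ord_max 0 = 0) * (minkowski R 1 ord_max = 0) *
   (minkowski R ord_max 1 = 0))%type.
Proof. by rewrite !mxE. Qed.

Lemma mdotE u v :
  mdot u v = u 0 0 * v 0 0 + u 1 0 * v 1 0 - u ord_max 0 * v ord_max 0.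
Proof.
rewrite /mdot !mulmx3E !minkowskiE; rewrite ![u^T _ _]mxE; ring.
Qed.

Lemma mdotC u v : mdot u v = mdot v u.
Proof. by rewrite !mdotE; ring. Qed.

Lemma mdotDl u v x : mdot (u + v) x = mdot u x + mdot v x.
Proof. by rewrite !mdotE !mxE; ring. Qed.
Lemma mdotZl (a : R) u x : mdot (a *: u) x = a * mdot u x.
Proof. by rewrite !mdotE !mxE; ring. Qed.
Lemma mdotNl u x : mdot (- u) x = - mdot u x.
Proof. by rewrite !mdotE !mxE; ring. Qed.
Lemma mdotBl u v x : mdot (u - v) x = mdot u x - mdot v x.
Proof. by rewrite mdotDl mdotNl. Qed.
Lemma mdotDr u v x : mdot x (u + v) = mdot x u + mdot x v.
Proof. by rewrite !(mdotC x) mdotDl. Qed.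
Lemma mdotZr (a : R) u x : mdot x (a *: u) = a * mdot x u.
Proof. by rewrite !(mdotC x) mdotZl. Qed.
Lemma mdotNr u x : mdot x (- u) = - mdot x u.
Proof. by rewrite !(mdotC x) mdotNl. Qed.
Lemma mdotBr u v x : mdot x (u - v) = mdot x u - mdot x v.
Proof. by rewrite mdotDr mdotNr. Qed.

Definition mdotlin := (mdotDl, mdotBl, mdotZl, mdotNl, mdotDr, mdotBr, mdotZr, mdotNr).

Definition base : 'cV[R]_3 := delta_mx ord_max 0.

Lemma mdot_base x : mdot base x = - x ord_max 0.
Proof. by rewrite mdotE !mxE /=; ring. Qed.

Lemma hyp_base : hyp base.
Proof. by split; rewrite ?mdot_base mxE //= ltr01. Qed.

Lemma minkowskiK : minkowski R *m minkowski R = 1.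
Proof.
apply/matrixP; apply: ord3P; apply: ord3P; rewrite mulmx3E !minkowskiE !mxE /=; ring.
Qed.

Lemma isometry_mdot w u v : isometry w -> mdot (w *m u) (w *m v) = mdot u v.
Proof.
case=> wM _; rewrite /mdot trmx_mul -!mulmxA; congr (_ 0 0); congr (_ *m _).
by rewrite 2!mulmxA wM.
Qed.

Lemma hyp_sqr x : hyp x -> x ord_max 0 ^+ 2 = 1 + x 0 0 ^+ 2 + x 1 0 ^+ 2.
Proof. case; rewrite mdotE; lra. Qed.

(** Reversed Cauchy-Schwarz inequality: [- mdot x z] is the hyperbolic cosine of the distance
    between [x] and [z], and the distance estimates below are phrased in terms of it. *)
Lemma hyp_mdot_le x z : hyp x -> hyp z -> mdot x z <= -1.
Proof.
move=> hx hz; have := hyp_sqr hx; have := hyp_sqr hz.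
case: hx => _ x0; case: hz => _ z0; rewrite mdotE.
set a := x 0 0; set b := x 1 0; set c := x ord_max 0; rewrite -/c in x0.
set a' := z 0 0; set b' := z 1 0; set c' := z ord_max 0; rewrite -/c' in z0.
move=> e e'; suff : 1 + a * a' + b * b' <= c * c' by lra.
have cc : 0 <= c * c' by apply: mulr_ge0; lra.
apply: le_trans (ler_norm _) _; rewrite -[leRHS]ger0_norm // -ler_sqr ?nnegrE //.
rewrite -!normrX !ger0_norm ?sqr_ge0 // exprMn e e'.
have := sqr_ge0 (a - a'); have := sqr_ge0 (b - b'); have := sqr_ge0 (a * b' - b * a'); lra.
Qed.

Lemma hyp_mdot_gt0 x z : hyp x -> hyp z -> 0 < - mdot x z.
Proof. by move=> hx hz; have := hyp_mdot_le hx hz; lra. Qed.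

(** By Cauchy-Schwarz in the first two coordinates, a vector of the closed past cone has a
    nonnegative product with every point of the upper sheet. *)
Lemma future v y : mdot v v <= 0 -> hyp y -> mdot v y < 0 -> 0 < v ord_max 0.
Proof.
move=> vv hy; have := hyp_sqr hy; case: hy => _ y0.
move: vv; rewrite !mdotE.
set a := v 0 0; set b := v 1 0; set c := v ord_max 0.
set a' := y 0 0; set b' := y 1 0; set c' := y ord_max 0; rewrite -/c' in y0.
move=> vv e h; rewrite ltNge; apply/negP => c0.
suff : - (a * a' + b * b') <= - c * c' by nra.
have cc : 0 <= - c * c' by nra.
apply: le_trans (ler_norm _) _; rewrite -[leRHS]ger0_norm // -ler_sqr ?nnegrE //.
rewrite -!normrX !ger0_norm ?sqr_ge0 // exprMn e sqrrN.
apply: (@le_trans _ _ ((a ^+ 2 + b ^+ 2) * (a' ^+ 2 + b' ^+ 2))).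
  by have := sqr_ge0 (a * b' - b * a'); lra.
have q0 := sqr_ge0 a; have q1 := sqr_ge0 b; have q2 := sqr_ge0 a'; have q3 := sqr_ge0 b'; apply: ler_pM; nra.
Qed.

Definition normalize v : 'cV[R]_3 := (Num.sqrt (- mdot v v))^-1 *: v.

Lemma normalize_scale v : mdot v v < 0 ->
  0 < Num.sqrt (- mdot v v) /\ v = Num.sqrt (- mdot v v) *: normalize v.
Proof.
move=> v0; have s0 : 0 < Num.sqrt (- mdot v v) by rewrite sqrtr_gt0; lra.
by split=> //; rewrite scalerA divff ?scale1r // gt_eqF.
Qed.

Lemma hyp_normalize v : mdot v v < 0 -> 0 < v ord_max 0 -> hyp (normalize v).
Proof.
move=> v0 v2; have [s0 _] := normalize_scale v0; split.
  rewrite mdotZl mdotZr mulrA -invfM -expr2 sqr_sqrtr; last by lra.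
  by field; apply/eqP; lra.
by rewrite mxE mulr_gt0 // invr_gt0.
Qed.

Lemma hyp_sum x y (a b : R) : hyp x -> hyp y -> 0 <= a -> 0 <= b -> 0 < a + b ->
  mdot (a *: x + b *: y) (a *: x + b *: y) < 0 /\
  0 < (a *: x + b *: y) ord_max 0.
Proof.
move=> hx hy a0 b0 ab; rewrite !mdotlin (mdotC y x).
have := hyp_mdot_le hx hy; case: hx hy => -> x0 [-> y0] xy; rewrite !mxE.
have := mulr_ge0 a0 b0; split; first by nra.
by have [a1|a1] := ltP 0 a; [apply: ltr_pwDl; nra|apply: ltr_wpDl; nra].
Qed.

(** Substitute for the triangle inequality, modelled on [cosh (a + b) <= 2 * cosh a * cosh b]. The
    vector [x'] is the image of [x] under the point reflection in [y], and the claim follows from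
    [mdot x' z <= -1]. *)
Lemma cosh_triangle x y z : hyp x -> hyp y -> hyp z ->
  - mdot x z <= 2 * mdot x y * mdot y z.
Proof.
move=> hx hy hz; set k := - mdot x y.
have k1 : 1 <= k by have := hyp_mdot_le hx hy; rewrite /k; lra.
pose x' := (2 * k) *: y - x.
have h' : hyp x'.
  have e : mdot x' x' = -1.
    rewrite /x' !mdotlin (mdotC y x); case: hx => ->; case: hy => -> _ _.
    by rewrite -[mdot x y]opprK -/k; ring.
  split=> //; apply: (@future _ y) => //; first by rewrite e; lra.
  by rewrite /x' !mdotlin; case: hy => -> _; rewrite -[mdot x y]opprK -/k; lra.
have := hyp_mdot_le h' hz; rewrite /x' !mdotlin /k; lra.
Qed.

End Hyperboloid.

(** * Isometries and reflections *)

Section Isometries.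
Variable R : realType.
Implicit Types (u v x y z : 'cV[R]_3) (w A B : 'M[R]_3).
Notation M := (minkowski R).
Notation base := (base R).

Lemma mul_mxM A B x : (A * B) *m x = A *m (B *m x).
Proof. by rewrite mulmxA. Qed.

Definition adj w : 'M[R]_3 := M *m w^T *m M.

Lemma isometry_adj w : isometry w -> adj w * w = 1.
Proof.
case=> e _; rewrite /adj -[LHS]/((M *m w^T *m M) *m w).
by rewrite -!mulmxA [w^T *m _]mulmxA e minkowskiK.
Qed.

Lemma isometry_unit w : isometry w -> w \is a GRing.unit.
Proof. by move=> /isometry_adj e; apply/unitrP; exists (adj w); split=> //; exact: mulmx1C. Qed.

Lemma isometryVE w : isometry w -> w^-1 = adj w.
Proof. by move=> iw; apply: (mulIr (isometry_unit iw)); rewrite isometry_adj // mulVr // isometry_unit. Qed.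

Lemma adj33 w : adj w ord_max ord_max = w ord_max ord_max.
Proof. by rewrite /adj !mulmx3E !minkowskiE !mxE; ring. Qed.

Lemma isometryV33 w : isometry w -> w^-1 ord_max ord_max = w ord_max ord_max.
Proof. by move=> iw; rewrite isometryVE // adj33. Qed.

Lemma mul_base w i : (w *m base) i 0 = w i ord_max.
Proof. by rewrite mulmx3E !mxE /=; ring. Qed.

(** The last diagonal entry is the hyperbolic cosine of the distance by which an isometry moves
    [base]; it serves as the size of the isometry in the finiteness statements below. *)
Lemma mdot_base33 w : w ord_max ord_max = - mdot base (w *m base).
Proof. by rewrite mdot_base mul_base opprK. Qed.

Lemma hyp_isometry_base w : isometry w -> hyp (w *m base).
Proof.
move=> iw; split; last by rewrite mul_base; case: iw.
by rewrite isometry_mdot //; case: (hyp_base R).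
Qed.

Lemma isometry_preV w : isometry w -> isometry w^-1.
Proof.
move=> iw; split; last by rewrite isometryV33 //; case: iw.
have u := isometry_unit iw; case: (iw) => e _; rewrite -[in LHS]e !mulmxE !mulrA.
rewrite -[(w^-1)^T * w^T]trmx_mul mulmxE divrr // trmx1 mul1r.
by rewrite -mulrA divrr // mulr1.
Qed.
Notation isometryV := isometry_preV.

Lemma hyp_isometry w x : isometry w -> hyp x -> hyp (w *m x).
Proof.
move=> iw hx; split; first by rewrite isometry_mdot //; case: hx.
have iv := isometryV iw; rewrite -[X in 0 < X]opprK -mdot_base.
rewrite -(isometry_mdot _ _ iv) -mul_mxM mulVr ?isometry_unit // mul1mx.
exact: (hyp_mdot_gt0 (hyp_isometry_base iv) hx).
Qed.

Lemma isometryM w1 w2 : isometry w1 -> isometry w2 -> isometry (w1 * w2).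
Proof.
move=> i1 i2; split.
  case: i1 => e _; case: i2 => e' _; rewrite trmx_mul mulmxA -!(mulmxA w2^T).
  by rewrite e mulmxA.
have := hyp_isometry i1 (hyp_isometry_base i2).
by rewrite -mul_mxM => -[_]; rewrite mul_base.
Qed.

Lemma isometry1 : isometry (1 : 'M[R]_3).
Proof.
split; first by rewrite trmx1 mul1mx mulmx1.
by rewrite !mxE.
Qed.

Lemma isometry_mdotV w x y : isometry w -> mdot (w^-1 *m x) y = mdot x (w *m y).
Proof.
move=> iw; rewrite -(isometry_mdot _ _ iw) -mul_mxM divrr ?isometry_unit //.
by rewrite mul1mx.
Qed.

Lemma isometry_ge1 w : isometry w -> 1 <= w ord_max ord_max.
Proof.
move=> iw; rewrite mdot_base33.
have := hyp_mdot_le (hyp_base R) (hyp_isometry_base iw); lra.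
Qed.

Lemma isometryM33 w1 w2 : isometry w1 -> isometry w2 ->
  (w1 * w2) ord_max ord_max <= 2 * w1 ord_max ord_max * w2 ord_max ord_max.
Proof.
move=> i1 i2; rewrite [leLHS]mdot_base33 mul_mxM.
apply: le_trans (cosh_triangle (hyp_base R) (hyp_isometry_base i1) _) _.
  by apply: hyp_isometry => //; exact: hyp_isometry_base.
by rewrite isometry_mdot // (mdot_base33 w1) (mdot_base33 w2) le_eqVlt; apply/orP; left; apply/eqP; ring.
Qed.

Lemma isometry_move w x y : isometry w -> hyp x -> hyp y ->
  w ord_max ord_max <= 4 * x ord_max 0 * - mdot (w *m x) y * y ord_max 0.
Proof.
move=> iw hx hy; rewrite mdot_base33 mdotC.
have hb := hyp_base R.
apply: le_trans (cosh_triangle (hyp_isometry_base iw) (hyp_isometry iw hx) hb) _.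
rewrite isometry_mdot // mdot_base.
have := cosh_triangle (hyp_isometry iw hx) hy hb; rewrite !(mdotC _ base) !mdot_base.
case: hx => _ x0 h; rewrite opprK in h.
by have := ler_wpM2l (ltW x0) h; lra.
Qed.

Lemma isometry_move33 w x : isometry w -> hyp x ->
  (w *m x) ord_max 0 <= 2 * w ord_max ord_max * x ord_max 0.
Proof.
move=> iw hx; have := cosh_triangle (hyp_base R) (hyp_isometry_base iw) (hyp_isometry iw hx).
by rewrite isometry_mdot // !mdot_base mul_base opprK; lra.
Qed.

(** The defining relation controls each column by its last entry, and the same relation for the
    inverse controls the last row: the squares of its first two entries add up to the square of the
    third minus 1. *)
Lemma isometry_entries w i j : isometry w -> `|w i j| <= w ord_max ord_max.
Proof.
move=> iw; have w1 := isometry_ge1 iw.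
have w0 : 0 <= w ord_max ord_max by lra.
rewrite -[leRHS]ger0_norm // -ler_sqr ?nnegrE // -!normrX !ger0_norm ?sqr_ge0 //.
have iv := isometryV iw.
have row k l : (w^T *m M *m w) k l = w 0 k * w 0 l + w 1 k * w 1 l - w ord_max k * w ord_max l.
  by rewrite !mulmx3E !minkowskiE !mxE; ring.
have rowV : w ord_max 0 ^+ 2 + w ord_max 1 ^+ 2 = w ord_max ord_max ^+ 2 - 1.
  have := hyp_sqr (hyp_isometry_base iv).
  by rewrite !mul_base isometryVE // adj33 /adj !mulmx3E !minkowskiE !mxE; lra.
have {}row := row _ _; case: iw => e _; rewrite e in row.
have r0 := row 0 0; have r1 := row 1 1; have r2 := row ord_max ord_max.
rewrite !minkowskiE in r0 r1 r2.
have q k l : 0 <= w k l ^+ 2 by exact: sqr_ge0.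
move: i j; apply: ord3P; apply: ord3P; have := (q 0 0, q 0 1, q 0 ord_max, (q 1 0, q 1 1, q 1 ord_max, (q ord_max 0, q ord_max 1))) => -[[[? ?] ?] [[[? ?] ?] [? ?]]]; lra.
Qed.

Lemma sqr_det_isometry w : isometry w -> \det w = 1 \/ \det w = -1.
Proof.
case=> e _; have : \det w ^+ 2 = 1.
  have d : \det M != 0.
    apply/eqP => d; have := congr1 determinant (minkowskiK R).
    by rewrite det_mulmx d mul0r det1 => /eqP; rewrite eq_sym oner_eq0.
  apply: (mulfI d); have := congr1 determinant e; rewrite !det_mulmx det_tr.
  by move=> h; rewrite mulr1 -[RHS]h; ring.
by move=> /eqP; rewrite sqrf_eq1 => /orP[/eqP|/eqP]; [left|right].
Qed.

End Isometries.
Notation isometryV := isometry_preV.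

Section Reflections.
Variable R : realType.
Implicit Types (u v x y z : 'cV[R]_3) (w A B : 'M[R]_3).
Notation M := (minkowski R).

Lemma reflectionE u x : reflection u *m x = x - (2 * mdot u x) *: u.
Proof.
rewrite /reflection mulmxBl mul1mx -scalemxAl -!mulmxA; congr (_ - _).
rewrite -scalerA; congr (_ *: _); rewrite [u^T *m _]mx11_scalar -mul_scalar_mx.
by rewrite mul_mx_scalar mul_scalar_mx /mdot -mulmxA.
Qed.

Lemma mx3P A B : (forall x, A *m x = B *m x) -> A = B.
Proof.
move=> e; apply/matrixP => i j; have := congr1 (fun v : 'cV[R]_3 => v i 0) (e (delta_mx j 0)).
by rewrite -!colE !mxE.
Qed.

Lemma reflectionN u : reflection (- u) = reflection u.
Proof. by apply: mx3P => x; rewrite !reflectionE mdotNl scalerN mulrN scaleNr opprK. Qed.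

Section Unit.
Variable u : 'cV[R]_3.
Hypothesis uu : mdot u u = 1.

Lemma mdot_reflection x y : mdot (reflection u *m x) (reflection u *m y) = mdot x y.
Proof. by rewrite !reflectionE !mdotlin uu (mdotC x u); ring. Qed.

Lemma reflectionK : reflection u * reflection u = 1.
Proof.
apply: mx3P => x; rewrite mul_mxM !reflectionE mul1mx !mdotlin uu.
by rewrite -addrA -opprD -scalerDl mulrBr mulr1; apply: cv3P; rewrite !mxE; ring.
Qed.

Lemma reflection33 : reflection u ord_max ord_max = 1 + 2 * u ord_max 0 ^+ 2.
Proof. by rewrite -mul_base reflectionE mdotC mdot_base !mxE /=; ring. Qed.

Lemma isometry_reflection : isometry (reflection u).
Proof.
split; last by rewrite reflection33; have := sqr_ge0 (u ord_max 0); lra.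
apply/matrixP => i j.
have e (A : 'M[R]_3) : A i j = ((delta_mx i 0 : 'cV_3)^T *m A *m (delta_mx j 0 : 'cV_3)) 0 0.
  by rewrite trmx_delta -rowE -colE !mxE.
rewrite [LHS]e [RHS]e; have := mdot_reflection (delta_mx i 0) (delta_mx j 0).
by rewrite /mdot trmx_mul !mulmxA.
Qed.

Lemma reflection_self : reflection u *m u = - u.
Proof. by rewrite reflectionE uu; apply: cv3P; rewrite !mxE; ring. Qed.

Lemma reflectionVE : (reflection u)^-1 = reflection u.
Proof.
have iu := isometry_unit isometry_reflection.
by apply: (mulIr iu); rewrite mulVr // reflectionK.
Qed.

Lemma points_reflection x : points (reflection u) x <-> hyp x /\ mdot u x = 0.
Proof.
split=> -[hx e]; split=> //.
  move: e; rewrite reflectionE => /(congr1 (fun y => mdot u (x - y))).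
  by rewrite !mdotlin uu; lra.
by rewrite reflectionE e mulr0 scale0r subr0.
Qed.

Lemma det_reflection : \det (reflection u) = -1.
Proof.
have [d|//] := sqr_det_isometry isometry_reflection.
have : \det (reflection u) = 1 - 2 * mdot u u.
  rewrite (expand_det_row _ 0) sum3 /cofactor.
  have e2 (B : 'M[R]_2) : \det B = B 0 0 * B 1 1 - B 0 1 * B 1 0.
    rewrite (expand_det_row _ 0) !big_ord_recl big_ord0 /cofactor !det_mx11 !mxE /=.
    rewrite (_ : lift 0 0 = 1 :> 'I_2); last exact: val_inj.
    rewrite (_ : lift 1 0 = 0 :> 'I_2); last exact: val_inj.
    ring.
  have l00 : lift 0 0 = 1 :> 'I_3 by exact: val_inj.
  have l01 : lift 0 1 = ord_max :> 'I_3 by exact: val_inj.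
  have l10 : lift 1 0 = 0 :> 'I_3 by exact: val_inj.
  have l11 : lift 1 1 = ord_max :> 'I_3 by exact: val_inj.
  have l20 : lift ord_max 0 = 0 :> 'I_3 by exact: val_inj.
  have l21 : lift ord_max 1 = 1 :> 'I_3 by exact: val_inj.
  have rE i j : reflection u i j = (i == j)%:R - 2 * mdot u (delta_mx j 0) * u i 0.
    have -> : reflection u i j = (reflection u *m (delta_mx j 0 : 'cV_3)) i 0.
      by rewrite -colE [RHS]mxE.
    by rewrite reflectionE !mxE eqxx andbT.
  have rcE k l (B : 'M[R]_3) i j : row' k (col' l B) i j = B (lift k i) (lift l j).
    by rewrite !mxE.
  rewrite !e2 !rcE !l00 !l01 !l10 !l11 !l20 !l21.
  rewrite !rE !mdotE !mxE /=; ring.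
by rewrite d uu; lra.
Qed.

End Unit.

Lemma reflection_inj u v : mdot u u = 1 -> mdot v v = 1 ->
  reflection u = reflection v -> u = v \/ u = - v.
Proof.
move=> uu vv e; have := reflection_self uu; rewrite e reflectionE => h.
have {}h : u = mdot v u *: v.
  by have := congr1 (fun y => 2^-1 *: (y + u)) h; move=> h'; apply: cv3P;
    have := congr1 (fun y : 'cV[R]_3 => y 0 0) h; have := congr1 (fun y : 'cV[R]_3 => y 1 0) h;
    have := congr1 (fun y : 'cV[R]_3 => y ord_max 0) h; rewrite !mxE; lra.
have : mdot v u ^+ 2 = 1 by rewrite -[RHS]uu [in RHS]h !mdotlin vv; ring.
move=> /eqP; rewrite sqrf_eq1 => /orP[/eqP k|/eqP k].
  by left; rewrite h k scale1r.
by right; rewrite h k scaleN1r.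
Qed.

Lemma geodesic_isometry A : geodesic A -> isometry A.
Proof. by case=> u uu ->; exact: isometry_reflection. Qed.

Lemma geodesicK A : geodesic A -> A * A = 1.
Proof. by case=> u uu ->; exact: reflectionK. Qed.

Lemma geodesicV A : geodesic A -> A^-1 = A.
Proof. by case=> u uu ->; exact: reflectionVE. Qed.

Lemma act_reflection w u : isometry w -> act w (reflection u) = reflection (w *m u).
Proof.
move=> iw; apply: mx3P => x; rewrite /act !mul_mxM !reflectionE mulmxBr -mul_mxM.
rewrite divrr ?isometry_unit // mul1mx -scalemxAr; congr (_ - (2 * _) *: _).
by rewrite mdotC isometry_mdotV // mdotC.
Qed.

Lemma act_geodesic w A : isometry w -> geodesic A -> geodesic (act w A).
Proof.
by move=> iw [u uu ->]; rewrite act_reflection //; exists (w *m u); rewrite ?isometry_mdot.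
Qed.

Lemma act1 A : act 1 A = A.
Proof. by rewrite /act mul1r invr1 mulr1. Qed.

Lemma actM w1 w2 A : isometry w1 -> isometry w2 -> act (w1 * w2) A = act w1 (act w2 A).
Proof. by move=> i1 i2; rewrite /act invrM ?isometry_unit // !mulrA. Qed.

Lemma actK w A : isometry w -> act w^-1 (act w A) = A.
Proof. by move=> iw; rewrite -actM ?mulVr ?act1 ?isometry_unit //; exact: isometryV. Qed.

Lemma actVK w A : isometry w -> act w (act w^-1 A) = A.
Proof. by move=> iw; rewrite -actM ?divrr ?act1 ?isometry_unit //; exact: isometryV. Qed.

Lemma points_act w A x : isometry w -> points (act w A) (w *m x) <-> points A x.
Proof.
move=> iw; have iu := isometry_unit iw; split=> -[hx e]; split.
- have := hyp_isometry (isometryV iw) hx.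
  by rewrite -mul_mxM mulVr // mul1mx.
- have := congr1 (mulmx w^-1) e; rewrite /act -!mul_mxM !mulrA mulVr // mul1r.
  by rewrite -mulrA mulVr // mulr1 mul1mx.
- exact: hyp_isometry.
- by rewrite /act -mul_mxM -!mulrA mulVr // mulr1 mul_mxM e.
Qed.

Lemma isometryKV w x : isometry w -> w *m (w^-1 *m x) = x.
Proof. by move=> iw; rewrite -mul_mxM divrr ?mul1mx ?isometry_unit. Qed.

Lemma isometryK w x : isometry w -> w^-1 *m (w *m x) = x.
Proof. by move=> iw; rewrite -mul_mxM mulVr ?mul1mx ?isometry_unit. Qed.

Lemma points_actV w A x : isometry w -> points (act w A) x <-> points A (w^-1 *m x).
Proof. by move=> iw; rewrite -{1}(isometryKV x iw); exact: points_act. Qed.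

(** The point is the foot of the perpendicular from [base]. The reflection moves [base] by twice its
    distance [d] to the geodesic, and the formula is [cosh (2 d) = 2 (cosh d)^2 - 1]. *)
Lemma geodesic_foot A : geodesic A ->
  exists x, points A x /\ x ord_max 0 ^+ 2 = (1 + A ord_max ord_max) / 2.
Proof.
case=> u uu ->; rewrite reflection33 //.
pose y := base R + u ord_max 0 *: u.
have q := sqr_ge0 (u ord_max 0).
have yy : mdot y y = - (1 + u ord_max 0 ^+ 2).
  by rewrite /y !mdotlin uu (mdotC u) !mdot_base mxE /=; ring.
have y2 : y ord_max 0 = 1 + u ord_max 0 ^+ 2 by rewrite !mxE /=; ring.
exists (normalize y); split.
  apply/(points_reflection uu); split.
    by apply: hyp_normalize; rewrite ?yy ?y2; lra.
  have uy : mdot u y = 0 by rewrite /y mdotDr mdotZr uu mdotC mdot_base; lra.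
  by rewrite mdotZr uy mulr0.
rewrite mxE exprMn exprVn sqr_sqrtr yy ?y2; last by lra.
by field; apply/eqP; lra.
Qed.

Lemma points33 A x : geodesic A -> points A x ->
  A ord_max ord_max <= 2 * x ord_max 0 ^+ 2 - 1.
Proof.
case=> u uu -> /(points_reflection uu)[hx]; rewrite reflection33 // mdotE => e.
have h := hyp_sqr hx; rewrite mdotE in uu.
set a := u 0 0 in uu e *; set b := u 1 0 in uu e *; set c := u ord_max 0 in uu e *.
set a' := x 0 0 in h e *; set b' := x 1 0 in h e *; set c' := x ord_max 0 in h e *.
have e2 : (c * c') ^+ 2 = (a * a' + b * b') ^+ 2 by congr (_ ^+ 2); lra.
have s := sqr_ge0 (a * b' - b * a').
suff : c ^+ 2 * c' ^+ 2 <= (1 + c ^+ 2) * (c' ^+ 2 - 1) by lra.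
have -> : 1 + c ^+ 2 = a ^+ 2 + b ^+ 2 by lra.
have -> : c' ^+ 2 - 1 = a' ^+ 2 + b' ^+ 2 by lra.
by rewrite -exprMn e2; lra.
Qed.

Lemma act33 w A : isometry w -> geodesic A ->
  (act w A) ord_max ord_max <= 4 * w ord_max ord_max ^+ 2 * A ord_max ord_max.
Proof.
move=> iw gA; have iA := geodesic_isometry gA.
apply: le_trans (isometryM33 (isometryM iw iA) (isometryV iw)) _.
rewrite isometryV33 //; have := isometryM33 iw iA; have := isometry_ge1 iw; nra.
Qed.

Lemma orthonormal_basis u v a : mdot u u = 1 -> mdot v v = 1 -> mdot a a = -1 ->
  mdot u v = 0 -> mdot u a = 0 -> mdot v a = 0 ->
  forall x, x = mdot u x *: u + mdot v x *: v - mdot a x *: a.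
Proof.
move=> uu vv aa uv ua va x.
pose P : 'M[R]_3 := \matrix_(i, j) (if j == 0 then u i 0 else if j == 1 then v i 0 else a i 0).
have PP : (M *m P^T *m M) *m P = 1.
  have e : P^T *m M *m P = M.
    have h k l : (P^T *m M *m P) k l = P 0 k * P 0 l + P 1 k * P 1 l - P ord_max k * P ord_max l.
      by rewrite !mulmx3E !minkowskiE !mxE; ring.
    move: uu vv aa uv ua va; rewrite !mdotE => uu vv aa uv ua va.
    by apply/matrixP; apply: ord3P; apply: ord3P; rewrite h !minkowskiE !mxE /=; lra.
  by rewrite -!mulmxA [P^T *m _]mulmxA e minkowskiK.
have {}PP := mulmx1C PP.
have {}PP : P *m (M *m P^T *m M) *m x = x by rewrite PP mul1mx.
rewrite -[LHS]PP !mdotE -mulmxA.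
by apply: cv3P; rewrite !mulmx3E !minkowskiE !mxE /=; ring.
Qed.

Lemma tangent v a : mdot v v = 1 -> mdot a a = -1 -> mdot v a = 0 ->
  exists e, [/\ mdot e e = 1, mdot e a = 0 & mdot e v = 0].
Proof.
move=> vv aa va.
(* This is the Minkowski cross product of [a] and [v]. *)
exists (\col_i (if i == 0 then a 1 0 * v ord_max 0 - a ord_max 0 * v 1 0
  else if i == 1 then a ord_max 0 * v 0 0 - a 0 0 * v ord_max 0
  else - (a 0 0 * v 1 0 - a 1 0 * v 0 0))).
split; rewrite mdotE !mxE /=; [|ring|ring].
transitivity (mdot v a ^+ 2 - mdot a a * mdot v v); rewrite ?mdotE; first ring.
by rewrite -!mdotE va aa vv; ring.
Qed.

(** [s] is the hyperbolic sine of the signed distance from [a], which parametrises the whole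
    geodesic algebraically; it is recovered as the product with [e]. *)
Definition line a e (s : R) : 'cV[R]_3 := Num.sqrt (1 + s ^+ 2) *: a + s *: e.

Lemma mdot_line a e (s : R) u : mdot u (line a e s) =
  Num.sqrt (1 + s ^+ 2) * mdot u a + s * mdot u e.
Proof. by rewrite /line !mdotlin. Qed.

Lemma hyp_line a e s : hyp a -> mdot e e = 1 -> mdot e a = 0 -> hyp (line a e s).
Proof.
move=> ha ee ea; have q := sqr_ge0 s.
have aa : mdot a a = -1 by case: ha.
have e1 : mdot (line a e s) (line a e s) = -1.
  rewrite mdot_line ![mdot (line _ _ _) _]mdotC !mdot_line aa ee ea (mdotC a e) ea.
  rewrite mulr0 addr0 mulr0 [0 + _]add0r mulr1 -expr2 mulrA -expr2 sqr_sqrtr; lra.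
split=> //; apply: (@future _ _ a) => //; first by rewrite e1; lra.
rewrite mdotC mdot_line aa (mdotC a e) ea.
by have : 0 < Num.sqrt (1 + s ^+ 2) by [rewrite sqrtr_gt0; lra]; lra.
Qed.

Lemma lineP u a e x : mdot u u = 1 -> hyp a -> mdot u a = 0 -> mdot e e = 1 ->
  mdot e a = 0 -> mdot e u = 0 -> hyp x -> mdot u x = 0 -> x = line a e (mdot e x).
Proof.
move=> uu ha ua ee ea eu hx ux.
have aa : mdot a a = -1 by case: ha.
have xE : x = mdot u x *: u + mdot e x *: e - mdot a x *: a.
  by apply: orthonormal_basis => //; rewrite mdotC.
rewrite ux scale0r add0r in xE.
rewrite /line {1}xE addrC -scaleNr; congr (_ *: _ + _).
have k0 : 0 <= - mdot a x by have := hyp_mdot_le ha hx; lra.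
rewrite -[LHS]ger0_norm // -sqrtr_sqr; congr Num.sqrt.
case: hx => xx _; move: xx; rewrite {1 2}xE !mdotlin ee ea (mdotC a e) ea aa; lra.
Qed.

(** [e] is tangent at [a] to the geodesic of [v]. If it were orthogonal to [u], then [u] would be a
    multiple of [v]; otherwise its sign can be chosen. *)
Lemma crossing_tangent u v a : hyp a -> mdot u u = 1 -> mdot v v = 1 ->
  mdot u a = 0 -> mdot v a = 0 -> reflection u <> reflection v ->
  exists e, [/\ mdot e e = 1, mdot e a = 0, mdot e v = 0 & 0 < mdot u e].
Proof.
move=> [aa _] uu vv ua va ne; have [e [ee ea ev]] := tangent vv aa va.
have [p|n|z] := ltgtP 0 (mdot u e).
- by exists e.
- by exists (- e); rewrite !mdotlin ee ea ev; split; lra.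
- case: ne; have uE : u = mdot v u *: v + mdot e u *: e - mdot a u *: a.
    by apply: orthonormal_basis => //; rewrite mdotC.
  move: uE; rewrite (mdotC e) -z (mdotC a) ua !scale0r subr0 addr0 => uE.
  have : mdot v u ^+ 2 = 1 by rewrite -[RHS]uu [in RHS]uE !mdotlin vv; ring.
  move=> /eqP; rewrite sqrf_eq1 => /orP[/eqP k|/eqP k].
    by rewrite uE k scale1r.
  by rewrite uE k scaleN1r reflectionN.
Qed.

Lemma points_inj A B : geodesic A -> geodesic B -> points A `<=` points B -> A = B.
Proof.
move=> gA gB AB; have [a [Aa _]] := geodesic_foot gA; move: gA gB AB Aa.
move=> [u uu ->] [v vv ->] AB Aa; have Ba := AB _ Aa; apply: contrapT => ne.
have [ha ua] := (points_reflection uu a).1 Aa.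
have [_ va] := (points_reflection vv a).1 Ba.
have ne' : reflection v <> reflection u by move=> e; apply: ne.
have [e [ee ea eu ve]] := crossing_tangent ha vv uu va ua ne'.
have : points (reflection u) (line a e 1).
  apply/(points_reflection uu); split; first exact: hyp_line.
  by rewrite mdot_line ua mdotC eu; lra.
move=> /AB/(points_reflection vv)[_]; rewrite mdot_line va; lra.
Qed.

End Reflections.

(** * The frontier of the universal cover *)

Lemma continuous_comp_closed (T U : topologicalType) (f : T -> U) (D : set U) :
  continuous f -> closed D -> closed (f @^-1` D).
Proof. by move=> cf cD; apply: closed_comp => // x _; exact: cf. Qed.

Lemma compact_nbhs_cover (T : ptopologicalType) (K : set T) (U : T -> set T) :
  compact K -> (forall x, K x -> nbhs x (U x)) ->
  exists2 D : {fset T}, (forall x, x \in D -> K x) & K `<=` \bigcup_(x in [set` D]) U x.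
Proof.
rewrite compact_cover => cK nU.
have [|x Kx|D DK KD] := cK _ K (fun x => interior (U x)).
- by move=> x _; exact: open_interior.
- by exists x => //; exact: nU.
- exists D => [x /DK/set_mem //|x /KD].
  by move=> [y Dy Uy]; exists y => //; exact: interior_subset.
Qed.

Section MatrixTopology.
Variable R : realType.

Lemma mx_cvg (T : Type) {F : set_system T} {FF : Filter F} m n
    (f : T -> 'M[R]_(m, n)) (l : 'M[R]_(m, n)) :
  (forall i j, f x i j @[x --> F] --> l i j) -> f x @[x --> F] --> l.
Proof.
move=> cf A [P Pl sPA]; rewrite /fmap /=.
have : F [set x | forall i j, P i j (f x i j)].
  apply: filter_forall => i; apply: filter_forall => j; exact: (cf i j _ (Pl i j)).
move=> h; exact: (@filterS _ F FF _ (fun x => A (f x)) (fun x hx => sPA _ hx) h).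
Qed.

Lemma mx_cvg_coord (T : Type) {F : set_system T} {FF : Filter F} m n
    (f : T -> 'M[R]_(m, n)) (l : 'M[R]_(m, n)) :
  f x @[x --> F] --> l -> forall i j, f x i j @[x --> F] --> l i j.
Proof.
move=> cf i j; exact: (cvg_comp _ _ cf (@coord_continuous R m n i j l)).
Qed.

Lemma compact_mx m n (c : R) :
  compact [set A : 'M[R]_(m, n) | forall i j, `|A i j| <= c].
Proof.
pose K := [set f : prod_topology (fun _ : 'I_m * 'I_n => R) |
  forall i, `[- c, c]%classic (f i)].
have cK : compact K.
  exact: (@tychonoff _ (fun _ => R) (fun _ => `[- c, c]%classic) (fun _ => @segment_compact R _ _)).
pose g (f : prod_topology (fun _ : 'I_m * 'I_n => R)) : 'M[R]_(m, n) := \matrix_(i, j) f (i, j).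
have cg : continuous g.
  move=> f; apply: (mx_cvg (F := nbhs f)) => i j.
  have -> : (fun x => g x i j) = (fun x => x (i, j)) by apply/funext => x; rewrite mxE.
  rewrite mxE; exact: (@proj_continuous _ (fun _ => R) (i, j) f).
have -> : [set A : 'M[R]_(m, n) | forall i j, `|A i j| <= c] = g @` K.
  apply/seteqP; split=> [A bA|_ [f Kf <-] i j].
    exists (fun ij => A ij.1 ij.2); last by apply/matrixP => i j; rewrite mxE.
    by move=> [i j] /=; rewrite in_itv /= -ler_norml.
  by have := Kf (i, j); rewrite mxE /= in_itv /= -ler_norml.
apply: continuous_compact => //; exact: continuous_subspaceT.
Qed.

Lemma cvg_mulmx (T : Type) {F : set_system T} {FF : Filter F} m n
    (f : T -> 'M[R]_(m, 3)) (g : T -> 'M[R]_(3, n)) (a : 'M[R]_(m, 3)) (b : 'M[R]_(3, n)) :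
  f x @[x --> F] --> a -> g x @[x --> F] --> b -> f x *m g x @[x --> F] --> a *m b.
Proof.
move=> ca cb; apply: mx_cvg => i j.
rewrite (_ : (fun x => (f x *m g x) i j) = (fun x => f x i 0 * g x 0 j + f x i 1 * g x 1 j
  + f x i ord_max * g x ord_max j)); last by apply/funext => x; rewrite mulmx3E.
rewrite mulmx3E; apply: cvgD; [apply: cvgD|]; apply: cvgM; exact: mx_cvg_coord.
Qed.

Lemma cvg_mdot (T : Type) {F : set_system T} {FF : Filter F}
    (f g : T -> 'cV[R]_3) (a b : 'cV[R]_3) :
  f x @[x --> F] --> a -> g x @[x --> F] --> b -> mdot (f x) (g x) @[x --> F] --> mdot a b.
Proof.
move=> ca cb; rewrite mdotE.
rewrite (_ : (fun x => mdot (f x) (g x)) = (fun x => f x 0 0 * g x 0 0 + f x 1 0 * g x 1 0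
  - f x ord_max 0 * g x ord_max 0)); last by apply/funext => x; rewrite mdotE.
apply: cvgB; [apply: cvgD|]; apply: cvgM; exact: mx_cvg_coord.
Qed.

Lemma continuous_mulmxl (w : 'M[R]_3) n : continuous (fun x : 'M[R]_(3, n) => w *m x).
Proof. by move=> x; apply: (cvg_mulmx (F := nbhs x)); [exact: cvg_cst|exact: cvg_id]. Qed.

Lemma continuous_mulmxr m n (x : 'M[R]_(3, n)) : continuous (fun w : 'M[R]_(m, 3) => w *m x).
Proof. by move=> w; apply: (cvg_mulmx (F := nbhs w)); [exact: cvg_id|exact: cvg_cst]. Qed.

Lemma continuous_act (w : 'M[R]_3) : continuous (act w).
Proof.
move=> A; apply: (cvg_mulmx (F := nbhs A)); last exact: cvg_cst.
by apply: (cvg_mulmx (F := nbhs A)); [exact: cvg_cst|exact: cvg_id].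
Qed.

Lemma continuous_mdot (u : 'cV[R]_3) : continuous (mdot u).
Proof. by move=> x; apply: (cvg_mdot (F := nbhs x)); [exact: cvg_cst|exact: cvg_id]. Qed.

Lemma cvg_sqrt (T : Type) {F : set_system T} {FF : Filter F} (f : T -> R) (a : R) :
  f x @[x --> F] --> a -> Num.sqrt (f x) @[x --> F] --> Num.sqrt a.
Proof. by move=> cf; apply: (cvg_comp _ _ cf); exact: sqrt_continuous. Qed.

Lemma cvg_normalize (T : Type) {F : set_system T} {FF : Filter F}
    (f : T -> 'cV[R]_3) (a : 'cV[R]_3) : mdot a a < 0 ->
  f x @[x --> F] --> a -> normalize (f x) @[x --> F] --> normalize a.
Proof.
move=> a0 cf; apply: mx_cvg => i j; rewrite mxE.
rewrite (_ : (fun x => normalize (f x) i j) =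
  (fun x => (Num.sqrt (- mdot (f x) (f x)))^-1 * f x i j)); last by apply/funext => x; rewrite mxE.
apply: cvgM; last exact: mx_cvg_coord.
apply: cvgV; first by rewrite gt_eqF // sqrtr_gt0; lra.
apply: cvg_sqrt.
by apply: cvgN; exact: cvg_mdot.
Qed.

End MatrixTopology.

Section Frontier.
Variables (R : realType) (O : orbifold R).
Implicit Types (u v x y z p b : 'cV[R]_3) (w A B C : 'M[R]_3).
Let X := cover O.
Notation bdry := (boundary_geodesic O).

Lemma inner_cover x : inner X x -> X x. Proof. by case. Qed.

Lemma grp_isometry_of w : grp O w -> isometry w.
Proof. by move=> /grp_isometry[]. Qed.

Lemma inner_near x : inner X x -> \forall y \near x, hyp y -> inner X y.
Proof.
move=> [Xx nx]; have := nbhs_interior nx; apply: filterS => y ny hy; split=> //.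
exact: (nbhs_singleton ny).
Qed.

(** The map [q] solves [y = s *: q y + t *: x] and sends [b] to the interior point [p]. Hence every
    point near [b] lies on a segment from [x] to a point of the cover near [p]. *)
Lemma inner_segment p x b (s t : R) : inner X p -> X x -> hyp b ->
  0 < s -> 0 <= t -> b = s *: p + t *: x -> inner X b.
Proof.
move=> ip Xx hb s0 t0 bE; have [Xp np] := ip; have hp := cover_hyp Xp.
have sn : s != 0 by rewrite gt_eqF.
split; first by apply: (cover_convex Xp Xx hb (ltW s0) t0 bE).
pose q y : 'cV[R]_3 := s^-1 *: (y - t *: x).
have qb : q b = p by rewrite /q bE addrK scalerA mulVf // scale1r.
have cq : q y @[y --> b] --> p.
  rewrite -[X in _ --> X]qb; apply: (mx_cvg (F := nbhs b)) => i j; rewrite /q.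
  under eq_fun do rewrite !mxE; rewrite !mxE.
  by apply: cvgM; [exact: cvg_cst|apply: cvgB; [exact: coord_continuous|exact: cvg_cst]].
have pp : mdot p p < 0 by case: hp => ->; lra.
have pE : normalize p = p.
  by rewrite /normalize; case: hp => -> _; rewrite opprK sqrtr1 invr1 scale1r.
have n1 : \forall y \near b, mdot (q y) (q y) < 0.
  have c1 : mdot (q y) (q y) @[y --> b] --> mdot p p by exact: (cvg_mdot (F := nbhs b)).
  exact: (cvgr_lt _ c1 _ pp).
have n2 : \forall y \near b, 0 < q y ord_max 0.
  have c1 : q y ord_max 0 @[y --> b] --> p ord_max 0 by exact: (mx_cvg_coord (F := nbhs b)).
  by case: hp => _; exact: (cvgr_gt _ c1).
have n3 : \forall y \near b, hyp (normalize (q y)) -> X (normalize (q y)).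
  have c1 : normalize (q y) @[y --> b] --> normalize p by exact: (cvg_normalize (F := nbhs b)).
  by rewrite pE in c1; exact: (c1 _ np).
near=> y => hy.
have y1 : mdot (q y) (q y) < 0 by near: y.
have y2 : 0 < q y ord_max 0 by near: y.
have hn := hyp_normalize y1 y2.
have Xn : X (normalize (q y)) by move: hn; near: y.
have [r0 qE] := normalize_scale y1.
apply: (@cover_convex _ O _ _ y (s * Num.sqrt (- mdot (q y) (q y))) t Xn Xx hy _ t0).
  by apply: mulr_ge0; exact: ltW.
by rewrite -scalerA -qE /q scalerA divff // scale1r subrK.
Unshelve. all: by end_near. Qed.

Definition innerpt : 'cV[R]_3 := xget 0 (inner X).
Lemma innerptP : inner X innerpt.
Proof. by have [p] := cover_inner O; exact: xgetI. Qed.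

(** The sign of [u] is fixed by an interior point [p]. If the cover had a point beyond [C], the
    segment joining it to [p] would meet [C] in an interior point of the cover. *)
Lemma boundary_normal C : bdry C -> exists u, [/\ mdot u u = 1, C = reflection u,
  forall x, X x -> mdot u x <= 0 & forall x, inner X x -> mdot u x < 0].
Proof.
move=> [gC pC]; have ip := innerptP; set p := innerpt in ip.
have hp := cover_hyp (inner_cover ip).
have [u [uu CE up]] : exists u, [/\ mdot u u = 1, C = reflection u & mdot u p < 0].
  case: gC => u uu CE; have [up|up|up] := ltgtP (mdot u p) 0.
  - by exists u.
  - by exists (- u); rewrite !mdotlin reflectionN; split=> //; lra.
  - have : points C p by rewrite CE; apply/(points_reflection uu).
    by move=> /pC[_].
have Xu x : X x -> mdot u x <= 0.
  move=> Xx; rewrite leNgt; apply/negP => xu; have hx := cover_hyp Xx.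
  pose y := mdot u x *: p + (- mdot u p) *: x.
  have [|||y0 y1] := @hyp_sum _ p x (mdot u x) (- mdot u p) hp hx; [lra|lra|lra|].
  have [r0 yE] := normalize_scale y0; have hy := hyp_normalize y0 y1.
  rewrite -/y in r0 yE hy.
  have Cy : points C (normalize y).
    rewrite CE; apply/(points_reflection uu); split=> //.
    have : mdot u y = 0 by rewrite /y !mdotlin; lra.
    by rewrite mdotZr => ->; rewrite mulr0.
  have [_] := pC _ Cy; apply.
  set r := Num.sqrt _ in r0 yE hy.
  apply: (@inner_segment p x _ (r^-1 * mdot u x) (r^-1 * - mdot u p)) => //.
  - by rewrite mulr_gt0 // invr_gt0.
  - by rewrite mulr_ge0 // ?invr_ge0; lra.
  - by rewrite /normalize -/r -!scalerA -scalerDr.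
exists u; split=> // x ix; rewrite lt_neqAle Xu ?andbT; last exact: inner_cover.
apply/eqP => ux; have : points C x.
  by rewrite CE; apply/(points_reflection uu); split=> //; exact/cover_hyp/inner_cover.
by move=> /pC[].
Qed.

Lemma boundary_geod C : bdry C -> geodesic C. Proof. by case. Qed.

Lemma boundary_tangent A C x : geodesic A -> points A `<=` X -> bdry C ->
  points A x -> points C x -> A = C.
Proof.
move=> [v vv ->] AX bC; have [u [uu -> uX _]] := boundary_normal bC.
move=> /(points_reflection vv)[hx vx] /(points_reflection uu)[_ ux].
apply: contrapT => ne; have ne' : reflection u <> reflection v by move=> e; apply: ne.
have [e [ee ea ev ue]] := crossing_tangent hx uu vv ux vx ne'.
have : X (line x e 1).
  apply: AX; apply/(points_reflection vv); split; first exact: hyp_line.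
  by rewrite mdot_line vx (mdotC v) ev; lra.
by move=> /uX; rewrite mdot_line ux; lra.
Qed.

Lemma boundary_disjoint A C x : bdry A -> bdry C -> points A x -> points C x -> A = C.
Proof.
by move=> [gA AX] bC; apply: boundary_tangent => // y /AX[].
Qed.

(** Up to normalisation, [z y] is the projection of [y] from the interior point [p] onto the
    geodesic. It belongs to the cover, and [y] lies between it and [p] as soon as [y] is on the
    inner side. *)
Lemma boundary_local u b : bdry (reflection u) -> mdot u u = 1 ->
  (forall x, X x -> mdot u x <= 0) ->
  points (reflection u) b -> \forall y \near b, hyp y -> mdot u y < 0 -> inner X y.
Proof.
move=> bC uu uX Cb; have ip := innerptP; set p := innerpt in ip.
have hp := cover_hyp (inner_cover ip).
have up : mdot u p < 0.
  rewrite lt_neqAle uX ?andbT; last exact: inner_cover.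
  apply/eqP => up; have : points (reflection u) p by apply/(points_reflection uu).
  by move=> /(proj2 bC)[_].
have [hb ub] := (points_reflection uu b).1 Cb.
pose a y := mdot u y / mdot u p.
pose z y : 'cV[R]_3 := y - a y *: p.
have ab : a b = 0 by rewrite /a ub mul0r.
have zb : z b = b by rewrite /z ab scale0r subr0.
have cz : z y @[y --> b] --> b.
  rewrite -[X in _ --> X]zb; apply: (mx_cvg (F := nbhs b)) => i j; rewrite /z.
  under eq_fun do rewrite !mxE; rewrite !mxE.
  apply: cvgB; first exact: coord_continuous.
  apply: cvgM; last exact: cvg_cst.
  by apply: cvgM; [exact: continuous_mdot|exact: cvg_cst].
have bb : mdot b b < 0 by case: hb => ->; lra.
have n1 : \forall y \near b, mdot (z y) (z y) < 0.
  have c1 : mdot (z y) (z y) @[y --> b] --> mdot b b by exact: (cvg_mdot (F := nbhs b)).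
  exact: (cvgr_lt _ c1 _ bb).
have n2 : \forall y \near b, 0 < z y ord_max 0.
  have c1 : z y ord_max 0 @[y --> b] --> b ord_max 0 by exact: (mx_cvg_coord (F := nbhs b)).
  by case: hb => _; exact: (cvgr_gt _ c1).
near=> y => hy uy.
have y1 : mdot (z y) (z y) < 0 by near: y.
have y2 : 0 < z y ord_max 0 by near: y.
have hn := hyp_normalize y1 y2.
have [r0 zE] := normalize_scale y1.
have Xz : X (normalize (z y)).
  suff /(proj2 bC)[] : points (reflection u) (normalize (z y)) by [].
  apply/(points_reflection uu); split=> //.
  have uz : mdot u (z y) = 0.
    by rewrite /z mdotBr mdotZr /a -mulrA mulVf ?mulr1 ?subrr // lt_eqF.
  by rewrite mdotZr uz mulr0.
apply: (@inner_segment p (normalize (z y)) y (a y) (Num.sqrt (- mdot (z y) (z y)))) => //.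
- by rewrite /a nmulr_rgt0 // invr_lt0.
- by rewrite -zE /z addrCA subrr addr0.
Unshelve. all: by end_near. Qed.

(** At a frontier point the cover fills a whole neighbourhood on the inner side of a boundary
    geodesic, which leaves no room for a second one. Compactness of balls turns this into the
    finiteness of the boundary geodesics of bounded size. *)
Lemma boundary_near b : hyp b -> exists B0, \forall y \near b, forall B,
  bdry B -> points B y -> B = B0.
Proof.
move=> hb; have [Xb|Xb] := pselect (X b); last first.
  exists 1; have /open_nbhs_nbhs : open_nbhs b (~` X) by split=> //; exact/closed_openC/cover_closed.
  by apply: filterS => y Xy B [_ BX] /BX[].
have [ib|ib] := pselect (inner X b).
  exists 1; have := inner_near ib; apply: filterS => y iy B [_ BX] By.
  by have [_] := BX _ By; case; apply: iy; case: By.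
have [C [gC Cb CX]] := cover_frontier Xb ib.
have bC : bdry C by [].
have [u [uu CE uX _]] := boundary_normal bC.
exists C; rewrite CE in bC Cb *; have := boundary_local bC uu uX Cb.
apply: filterS => y ny B bB By; have hy : hyp y by case: By.
have [Xy iy] := proj2 bB _ By.
apply: (boundary_disjoint bB bC By); apply/(points_reflection uu); split=> //.
apply/eqP; rewrite eq_le uX // andTb leNgt; apply/negP => uy; apply: iy; exact: ny.
Qed.

Lemma closed_hyp : closed (@hyp R).
Proof.
have -> : @hyp R = [set v | mdot v v = -1] `&` [set v | 0 <= v ord_max 0].
  apply/seteqP; split=> v [vv v0]; split=> //; first exact: ltW.
  move: v0; rewrite /= le_eqVlt => /orP[/eqP v0|//].
  move: vv; rewrite /= mdotE -v0; have := sqr_ge0 (v 0 0); have := sqr_ge0 (v 1 0); nra.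
apply: closedI.
  apply: (@continuous_comp_closed _ _ (fun v => mdot v v) [set (-1 : R)]); last exact: closed_eq.
  by move=> v; apply: (cvg_mdot (F := nbhs v)); exact: cvg_id.
apply: (@closed_comp _ _ (fun v : 'cV[R]_3 => v ord_max 0) [set x : R | 0 <= x]); last exact: closed_ge.
by move=> v _; exact: coord_continuous.
Qed.

Lemma hyp_entries x i : hyp x -> `|x i 0| <= x ord_max 0.
Proof.
move=> hx; have e := hyp_sqr hx; case: hx => _ x0; have := ltW x0 => {}x0.
rewrite -[leRHS]ger0_norm // -ler_sqr ?nnegrE // -!normrX !ger0_norm ?sqr_ge0 // e.
have q0 := sqr_ge0 (x 0 0); have q1 := sqr_ge0 (x 1 0).
by move: i; apply: ord3P; rewrite ?e; lra.
Qed.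

Lemma compact_hyp_ball (c : R) : compact [set x | hyp x /\ x ord_max 0 <= c].
Proof.
apply: (@subclosed_compact _ _ [set x : 'cV[R]_3 | forall i j, `|x i j| <= c]).
- apply: closedI; first exact: closed_hyp.
  apply: (@closed_comp _ _ (fun v : 'cV[R]_3 => v ord_max 0) [set x : R | x <= c]); last exact: closed_le.
  by move=> v _; exact: coord_continuous.
- exact: compact_mx.
- by move=> x [hx xc] i j; rewrite (ord1 j); apply: le_trans xc; exact: hyp_entries.
Qed.

Lemma foot_ball A (c : R) : geodesic A -> A ord_max ord_max <= c ->
  exists2 x, points A x & x ord_max 0 <= (1 + c) / 2.
Proof.
move=> gA Ac; have [x [Ax xE]] := geodesic_foot gA; exists x => //.
have hx : hyp x by case: Ax.
have x1 : 1 <= x ord_max 0.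
  by have := hyp_mdot_le (hyp_base R) hx; rewrite mdot_base; lra.
have : x ord_max 0 <= x ord_max 0 ^+ 2 by nra.
lra.
Qed.

Lemma boundary_finite (c : R) :
  finite_set [set B | bdry B /\ B ord_max ord_max <= c].
Proof.
pose U b := [set y | forall B, bdry B -> points B y ->
   B = xget 1 [set B0 | \forall y \near b, forall B, bdry B -> points B y -> B = B0]].
have [|D DK KD] := @compact_nbhs_cover 'cV[R]_3 _ U (@compact_hyp_ball ((1 + c) / 2)).
  move=> b [/boundary_near[B0 hB0] _].
  rewrite /U; case: xgetP => [B1 _ //|/(_ B0)]; exact.
pose g b : 'M[R]_3 := xget 1 [set B0 | \forall y \near b, forall B, bdry B -> points B y -> B = B0].
apply: (@sub_finite_set _ _ (g @` [set` D])); last exact/finite_image/finite_fset.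
move=> B [bB Bc]; have [x Bx xc] := foot_ball (boundary_geod bB) Bc.
have [|b Db Ub] := KD x; first by split=> //; case: Bx.
by exists b => //; rewrite /g (Ub B bB Bx).
Qed.

(** On geodesics this is the midpoint of [x] and its mirror image [A *m x], that is, the foot of the
    perpendicular from [x]. There [- mdot (x + A *m x) (x + A *m x)] is at least 4; the absolute
    value keeps the radicand positive at every other matrix, so that the map is continuous
    everywhere. *)
Definition unit_geod (x : 'cV[R]_3) A : 'cV[R]_3 :=
  (Num.sqrt (4 + `|- mdot (x + A *m x) (x + A *m x) - 4|))^-1 *: (x + A *m x).

Lemma geodesic_proj A x : geodesic A -> hyp x ->
  - mdot (x + A *m x) (x + A *m x) >= 4 /\ points A (normalize (x + A *m x)).
Proof.
move=> gA hx; have iA := geodesic_isometry gA; have hAx := hyp_isometry iA hx.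
have xx : mdot x x = -1 by case: hx.
have h : mdot (x + A *m x) (x + A *m x) <= - 4.
  rewrite !mdotlin isometry_mdot // xx (mdotC (A *m x)).
  by have := hyp_mdot_le hx hAx; lra.
split; first by lra.
split.
  apply: hyp_normalize; first lra.
  by rewrite mxE; case: hAx => _; case: hx => _; lra.
by rewrite -scalemxAr mulmxDr -mul_mxM geodesicK // mul1mx addrC.
Qed.

Lemma unit_geodE A x : geodesic A -> hyp x -> unit_geod x A = normalize (x + A *m x).
Proof.
move=> gA hx; have [h _] := geodesic_proj gA hx; rewrite /unit_geod.
by rewrite ger0_norm; [congr (_^-1 *: _); congr Num.sqrt; lra|lra].
Qed.

Lemma continuous_unit_geod x : continuous (unit_geod x).
Proof.
move=> A; have c1 : (fun B => x + B *m x) B @[B --> A] --> x + A *m x.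
  apply: (mx_cvg (F := nbhs A)) => i j; under eq_fun do rewrite mxE; rewrite mxE.
  apply: cvgD; first exact: cvg_cst.
  apply: (mx_cvg_coord (F := nbhs A)); exact: continuous_mulmxr.
apply: (mx_cvg (F := nbhs A)) => i j; rewrite /unit_geod; under eq_fun do rewrite [_ i j]mxE.
rewrite [_ i j]mxE; apply: cvgM; last exact: (mx_cvg_coord (F := nbhs A)).
apply: cvgV; first by rewrite gt_eqF // sqrtr_gt0 ltr_pwDl.
apply: cvg_sqrt.
apply: cvgD; first exact: cvg_cst.
apply: cvg_norm; apply: cvgB; last exact: cvg_cst.
by apply: cvgN; apply: (cvg_mdot (F := nbhs A)).
Qed.

(** For [A = reflection u] this is the entry [u i 0 * u j 0]. It depends continuously on [A],
    whereas [u] is determined only up to sign. *)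
Definition normal_gram A i j : R := ((1 - A) *m minkowski R) i j / 2.

Lemma normal_gramE u i j : normal_gram (reflection u) i j = u i 0 * u j 0.
Proof.
rewrite /normal_gram /reflection opprB addrC subrK -scalemxAl -!mulmxA minkowskiK mulmx1.
by rewrite !mxE big_ord1 mxE; field.
Qed.

(** The conditions express a symmetric matrix with vanishing 2 by 2 minors, nonnegative diagonal and
    Minkowski trace 1, and each of them is closed. Conversely, [u] is a column divided by the square
    root of a positive diagonal entry. *)
Lemma normal_gramP A : geodesic A <-> [/\ forall i j k l,
  normal_gram A i j * normal_gram A k l = normal_gram A i l * normal_gram A k j,
  forall i j, normal_gram A i j = normal_gram A j i,
  forall i, 0 <= normal_gram A i i &
  normal_gram A 0 0 + normal_gram A 1 1 - normal_gram A ord_max ord_max = 1].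
Proof.
split=> [[u uu ->]|[q s p t]].
  split=> *; rewrite !normal_gramE; [ring|ring|exact: sqr_ge0|by rewrite -uu mdotE].
have [k k0] : exists k, 0 < normal_gram A k k.
  have [h|h] := ltP 0 (normal_gram A 0 0); first by exists 0.
  by exists 1; have := p 1; have := p ord_max; lra.
have r0 : 0 < Num.sqrt (normal_gram A k k) by rewrite sqrtr_gt0.
have r2 : Num.sqrt (normal_gram A k k) ^+ 2 = normal_gram A k k by rewrite sqr_sqrtr // ltW.
set r := Num.sqrt _ in r0 r2.
pose u : 'cV[R]_3 := \col_i (normal_gram A i k / r).
have uE i j : u i 0 * u j 0 = normal_gram A i j.
  rewrite !mxE; have := q i j k k; rewrite -r2 (s k j) => h.
  apply: (mulIf (_ : r ^+ 2 != 0)); first by rewrite expf_neq0 // gt_eqF.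
  by rewrite h; field; rewrite gt_eqF.
have uu : mdot u u = 1 by rewrite mdotE !uE.
exists u => //.
have mK (P Q : 'M[R]_3) : P *m minkowski R = Q *m minkowski R -> P = Q.
  by move=> /(congr1 (mulmx^~ (minkowski R))); rewrite -!mulmxA minkowskiK !mulmx1.
apply: oppr_inj; apply: (addrI 1); apply: mK; apply/matrixP => i j.
have h2 : normal_gram A i j = normal_gram (reflection u) i j by rewrite normal_gramE uE.
by have := congr1 (fun z : R => z * 2) h2; rewrite /normal_gram !divfK.
Qed.

Lemma continuous_normal_gram i j : continuous (fun A => normal_gram A i j).
Proof.
move=> A; apply: (cvgM (F := nbhs A)); last exact: cvg_cst.
apply: (mx_cvg_coord (F := nbhs A)); apply: cvg_mulmx; last exact: cvg_cst.
apply: (mx_cvg (F := nbhs A)) => k l; under eq_fun do rewrite !mxE; rewrite !mxE.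
by apply: cvgB; [exact: cvg_cst|exact: coord_continuous].
Qed.

Lemma closed_geodesic : closed (@geodesic R).
Proof.
have -> : @geodesic R = \bigcap_(s : 'I_3 * 'I_3 * 'I_3 * 'I_3)
   [set A | normal_gram A s.1.1.1 s.1.1.2 * normal_gram A s.1.2 s.2 -
      normal_gram A s.1.1.1 s.2 * normal_gram A s.1.2 s.1.1.2 = 0] `&`
   (\bigcap_(s : 'I_3 * 'I_3) [set A | normal_gram A s.1 s.2 - normal_gram A s.2 s.1 = 0]) `&`
   (\bigcap_(i : 'I_3) [set A | 0 <= normal_gram A i i]) `&`
   [set A | normal_gram A 0 0 + normal_gram A 1 1 - normal_gram A ord_max ord_max = 1].
  apply/seteqP; split=> A; rewrite normal_gramP.
    move=> [q s p t]; split=> //; split; [split|] => [[[[i j] k] l] _|[i j] _|i _] //=.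
    - by rewrite q subrr.
    - by rewrite s subrr.
  move=> [[[q s] p] t]; split=> // [i j k l|i j|i].
  - by apply/eqP; rewrite -subr_eq0; apply/eqP; exact: (q (i, j, k, l)).
  - by apply/eqP; rewrite -subr_eq0; apply/eqP; exact: (s (i, j)).
  - exact: p.
have cg i j A : (fun A => normal_gram A i j) @ A --> normal_gram A i j by exact: continuous_normal_gram.
apply: closedI; [apply: closedI; [apply: closedI|]|].
- apply: closed_bigI => s _; apply: (continuous_comp_closed (D := [set 0 : R])); last exact: closed_eq.
  by move=> A; apply: (cvgB (F := nbhs A)); apply: cvgM; exact: cg.
- apply: closed_bigI => s _; apply: (continuous_comp_closed (D := [set 0 : R])); last exact: closed_eq.
  by move=> A; apply: (cvgB (F := nbhs A)); exact: cg.
- apply: closed_bigI => i _; apply: (continuous_comp_closed (D := [set x : R | 0 <= x])); last exact: closed_ge.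
  by move=> A; exact: cg.
- apply: (continuous_comp_closed (D := [set 1 : R])); last exact: closed_eq.
  by move=> A; apply: (cvgB (F := nbhs A)); [apply: cvgD|]; exact: cg.
Qed.

Lemma closed_geodesics_in (Y : set 'cV[R]_3) : closed Y -> closed (geodesics_in Y).
Proof.
(* Containment in [Y] is tested on the feet of the perpendiculars from all points of the plane,
   which turns it into an intersection of closed conditions on [A]. *)
move=> cY; have -> : geodesics_in Y = @geodesic R `&`
    \bigcap_(x in @hyp R) (unit_geod x @^-1` Y).
  apply/seteqP; split=> A [gA AY]; split=> // x hx /=.
    by rewrite unit_geodE //; apply: AY; have [] := geodesic_proj gA hx.
  have h := AY x (proj1 hx); rewrite /= unit_geodE in h => //; last by case: hx.
  suff <- : normalize (x + A *m x) = x by [].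
  case: hx => -[xx x0] Ax; rewrite Ax /normalize !mdotlin xx.
  rewrite (_ : - (_ : R) = 2 ^+ 2); last by ring.
  by rewrite sqrtr_sqr ger0_norm //; apply: cv3P; rewrite !mxE; field.
apply: closedI; first exact: closed_geodesic.
apply: closed_bigI => x _; apply: continuous_comp_closed => //; exact: continuous_unit_geod.
Qed.

End Frontier.

(** * The reflection group *)

Section ReflectionGroup.
Variables (R : realType) (O : orbifold R).
Implicit Types (u v x y z p : 'cV[R]_3) (w A B C : 'M[R]_3).
Let X := cover O.
Notation bdry := (boundary_geodesic O).
Notation W := (reflection_group O).

Lemma grp1 : grp O 1. Proof. by have [] := grp_subgroup O. Qed.
Lemma grpM a b : grp O a -> grp O b -> grp O (a * b).
Proof. by have [_ h _] := grp_subgroup O; exact: h. Qed.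
Lemma grpV a : grp O a -> grp O a^-1.
Proof. by have [_ _ h] := grp_subgroup O; exact: h. Qed.

Lemma reflection_group_subgroup : subgroup W.
Proof.
split=> [|a b Wa Wb|a Wa] S sS GS BS; have [s1 sM sV] := sS.
- exact: s1.
- by apply: sM; [exact: Wa|exact: Wb].
- by apply: sV; exact: Wa.
Qed.

Lemma refl1 : W 1. Proof. by have [] := reflection_group_subgroup. Qed.
Lemma reflM a b : W a -> W b -> W (a * b).
Proof. by have [_ h _] := reflection_group_subgroup; exact: h. Qed.
Lemma reflV a : W a -> W a^-1.
Proof. by have [_ _ h] := reflection_group_subgroup; exact: h. Qed.
Lemma grp_refl w : grp O w -> W w. Proof. by move=> Gw S _ GS _; exact: GS. Qed.
Lemma boundary_refl B : bdry B -> W B. Proof. by move=> bB S _ _; exact. Qed.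

Lemma refl_isometry w : W w -> isometry w.
Proof.
apply.
- split; [exact: isometry1|exact: isometryM|exact: isometryV].
- by move=> a /grp_isometry_of.
- by move=> B [gB _]; exact: geodesic_isometry.
Qed.

Lemma inner_grp w x : grp O w -> inner X x -> inner X (w *m x).
Proof.
move=> Gw [Xx nx]; have iw := grp_isometry_of Gw; split; first exact: cover_invariant.
have c : (w^-1 *m y) @[y --> w *m x] --> x.
  by rewrite -[X in _ --> X](isometryK x iw); exact: continuous_mulmxl.
have : \forall y \near w *m x, hyp (w^-1 *m y) -> X (w^-1 *m y) by exact: (c _ nx).
apply: filterS => y ny hy.
rewrite -(isometryKV y iw); apply: cover_invariant => //; apply: ny.
by apply: hyp_isometry => //; exact: isometryV.
Qed.

Lemma boundary_act w B : grp O w -> bdry B -> bdry (act w B).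
Proof.
move=> Gw [gB BX]; have iw := grp_isometry_of Gw; split; first exact: act_geodesic.
move=> x /points_actV => /(_ iw)/BX[Xx ix]; split.
  by rewrite -(isometryKV x iw); exact: cover_invariant.
by move=> ixx; apply: ix; apply: inner_grp => //; exact: grpV.
Qed.

Definition outward u C :=
  [/\ mdot u u = 1, C = reflection u, forall x, X x -> mdot u x <= 0 &
      forall x, inner X x -> mdot u x < 0].

(** If [z] lay beyond both geodesics, the segment from [p] to [z] would meet [C] in [y1] and [C'] in
    [y2], both in the cover. The numbers [r1 * mdot u' y1] and [r2 * mdot u y2] are opposite and
    both nonpositive, so [y2] lies on both geodesics, which are disjoint. *)
Lemma halfplanes_disjoint C C' u u' z : bdry C -> bdry C' -> outward u C -> outward u' C' ->
  C <> C' -> hyp z -> 0 <= mdot u' z -> mdot u z <= 0.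
Proof.
move=> bC bC' [uu CE uX ui] [uu' CE' uX' ui'] ne hz z' ; rewrite leNgt; apply/negP => z0.
have ip := innerptP O; set p := innerpt O in ip; have hp := cover_hyp (inner_cover ip).
have up := ui _ ip; have up' := ui' _ ip.
have key v (s : R) : mdot v v = 1 -> 0 <= s -> mdot v p < 0 -> s = mdot v z ->
    exists y r, [/\ points (reflection v) y, 0 < r &
      s *: p + (- mdot v p) *: z = r *: y].
  move=> vv s0 vp sE.
  have [|||y0 y1] := @hyp_sum _ p z s (- mdot v p) hp hz; [lra|lra|lra|].
  have [r0 yE] := normalize_scale y0; eexists; eexists; split; [|exact: r0|exact: yE].
  apply/(points_reflection vv); split; first exact: hyp_normalize.
  by rewrite mdotZr !mdotlin -sE; apply/eqP; rewrite mulf_eq0; apply/orP; right; apply/eqP; ring.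
have [|y1 [r1 [P1 r10 e1]]] := key u (mdot u z) uu _ up erefl; first exact: ltW.
have [y2 [r2 [P2 r20 e2]]] := key u' (mdot u' z) uu' z' up' erefl.
have X1 : X y1 by apply: (proj1 ((proj2 bC) _ _)); rewrite CE.
have X2 : X y2 by apply: (proj1 ((proj2 bC') _ _)); rewrite CE'.
have := congr1 (mdot u') e1; rewrite !mdotlin => h1.
have := congr1 (mdot u) e2; rewrite !mdotlin => h2.
have a1 := uX' _ X1; have a2 := uX _ X2.
have u0 : mdot u y2 = 0.
  apply: le_anti; rewrite a2 /= -(pmulr_rge0 _ r20) -h2.
  by have : r1 * mdot u' y1 <= 0 by [rewrite pmulr_rle0]; rewrite -h1; lra.
apply: ne; apply: (boundary_disjoint bC bC' (x := y2)); last by rewrite CE'.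
by rewrite CE; apply/(points_reflection uu); split=> //; exact: cover_hyp X2.
Qed.

(* The index is the first reflection of the word, None if there is none. *)
Inductive reduced : option 'M[R]_3 -> 'M[R]_3 -> Prop :=
| reduced_grp g : grp O g -> reduced None g
| reduced_cons C h w : bdry C -> reduced h w -> h <> Some C -> reduced (Some C) (C * w).

Lemma reduced_isometry h w : reduced h w -> isometry w.
Proof.
elim=> [g|C h' w' [gC _] _ iw _]; first exact: grp_isometry_of.
exact: (isometryM (geodesic_isometry gC)).
Qed.

Lemma reduced_mul_boundary C h w : bdry C -> reduced h w -> exists h', reduced h' (C * w).
Proof.
move=> bC rw; have [hC|hC] := pselect (h = Some C); last by exists (Some C); exact: reduced_cons rw hC.
case: rw hC => // C' h' w' bC' rw' _ [->].
by exists h'; rewrite mulrA geodesicK ?mul1r //; case: bC.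
Qed.

Lemma reduced_mul_grp g h w : grp O g -> reduced h w -> reduced (omap (act g) h) (g * w).
Proof.
move=> Gg; have ig := grp_isometry_of Gg; elim=> [g' Gg'|C h' w' bC rw IH ne] /=.
  by apply: reduced_grp; exact: grpM.
have -> : g * (C * w') = act g C * (g * w').
  by rewrite /act -!mulrA [g^-1 * _]mulrA mulVr ?mul1r // isometry_unit.
apply: (reduced_cons _ IH); first exact: boundary_act.
case: h' {rw IH} ne => //= C' ne [e]; apply: ne; congr Some.
by rewrite -(actK C ig) -e actK.
Qed.

Lemma refl_reduced w : W w -> exists h, reduced h w.
Proof.
(* The reflection group is the smallest subgroup containing its generators, so induction on words is
   done through a subgroup: the elements such that left multiplication by them and by their inverses
   preserves reduced words. *)
move=> Ww; pose S := [set a | isometry a /\ forall h s, reduced h s ->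
  (exists h', reduced h' (a * s)) /\ (exists h', reduced h' (a^-1 * s))].
have : S w.
  apply: Ww.
  - split=> [|a b [ia ha] [ib hb]|a [ia ha]].
    + by split; [exact: isometry1|move=> h s rs; rewrite invr1 mul1r; split; exists h].
    + split; first exact: isometryM.
      move=> h s rs; rewrite invrM ?isometry_unit // -!mulrA; split.
        have [[h1 r1] _] := hb _ _ rs; exact: (proj1 (ha _ _ r1)).
      have [_ [h1 r1]] := ha _ _ rs; exact: (proj2 (hb _ _ r1)).
    + by split; [exact: isometryV|move=> h s /ha[? ?]; rewrite invrK].
  - move=> g Gg; split; first exact: (grp_isometry_of Gg).
    by move=> h s rs; split; eexists; apply: reduced_mul_grp rs => //; exact: grpV.
  - move=> B bB; split; first by apply: geodesic_isometry; case: bB.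
    by move=> h s rs; rewrite geodesicV; [split; exact: (reduced_mul_boundary bB rs)|case: bB].
by move=> [_ /(_ _ _ (reduced_grp grp1))[]]; rewrite mulr1.
Qed.

(* Ping-pong: the half-planes beyond the boundary geodesics are disjoint. *)
Lemma reduced_halfplane h w : reduced h w -> forall C u, h = Some C -> outward u C ->
  forall y, X y -> 0 <= mdot u (w *m y).
Proof.
elim=> [//|C h' w' bC rw IH ne] _ u [<-] ou y Xy; have [uu CE uX ui] := ou.
have hy : hyp (w' *m y) by apply: hyp_isometry (reduced_isometry rw) (cover_hyp Xy).
rewrite mul_mxM CE reflectionE mdotBr mdotZr uu.
suff : mdot u (w' *m y) <= 0 by lra.
case: h' ne rw IH => [C' ne rw IH|_ rw _].
  have bC' : bdry C' by case: {-2}_ / (rw) => //; inversion rw.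
  have [u' ou'] := boundary_normal bC'.
  apply: (halfplanes_disjoint bC bC' ou ou') => //; last exact: (IH C').
  by move=> e; apply: ne; rewrite e.
by inversion rw; apply: uX; exact: cover_invariant.
Qed.

(** Distinct tiles overlap at most along their frontiers, since a reduced word that starts with a
    reflection sends the cover beyond a boundary geodesic. *)
Lemma tile_inner w y : W w -> X y -> inner X (w *m y) -> grp O w.
Proof.
move=> /refl_reduced[[C|] rw] Xy iy; last by inversion rw.
have bC : bdry C by inversion rw.
have [u ou] := boundary_normal bC; have [_ _ _ ui] := ou.
by have := reduced_halfplane rw erefl ou Xy; rewrite leNgt ui.
Qed.

Lemma det_geodesic A : geodesic A -> \det A = -1.
Proof. by case=> u uu ->; exact: det_reflection. Qed.

Definition wall V := exists w B, [/\ W w, bdry B & V = act w B].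

Lemma wall_geodesic V : wall V -> geodesic V.
Proof. by case=> w [B [Ww [gB _] ->]]; apply: act_geodesic => //; exact: refl_isometry. Qed.

Lemma wall_refl V : wall V -> W V.
Proof.
by case=> w [B [Ww bB ->]]; apply: reflM; [apply: reflM => //; exact: boundary_refl|exact: reflV].
Qed.

Lemma wall_act w V : W w -> wall V -> wall (act w V).
Proof.
move=> Ww [w' [B [Ww' bB ->]]]; exists (w * w'), B; split=> //; first exact: reflM.
by rewrite actM //; exact: refl_isometry.
Qed.

Lemma boundary_wall B : bdry B -> wall B.
Proof. by move=> bB; exists 1, B; split=> //; [exact: refl1|rewrite act1]. Qed.

(** The reflection in the wall fixes [x]; at an interior point this would put it into [grp O], whose
    elements have determinant 1. *)
Lemma wall_inner V x : wall V -> points V x -> ~ inner X x.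
Proof.
move=> wV [hx Vx] ix; have := tile_inner (wall_refl wV) (inner_cover ix).
rewrite Vx => /(_ ix)/grp_isometry[_]; rewrite det_geodesic; last exact: wall_geodesic.
lra.
Qed.

(** The last point of the segment from [p] to [y] that belongs to the cover is a frontier point, and
    the boundary geodesic through it separates [p] from [y]. *)
Lemma exit_boundary p y : inner X p -> hyp y -> ~ X y ->
  exists C u, [/\ bdry C, outward u C & 0 < mdot u y].
Proof.
move=> ip hy Xy; have hp := cover_hyp (inner_cover ip).
pose q (t : R) : 'cV[R]_3 := (1 - t) *: p + t *: y.
have q0 t : 0 <= t <= 1 -> mdot (q t) (q t) < 0 /\ 0 < q t ord_max 0.
  by move=> t01; apply: hyp_sum => //; lra.
have cq : continuous q.
  move=> t; apply: (mx_cvg (F := nbhs t)) => i j; rewrite /q.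
  under eq_fun do rewrite !mxE; rewrite !mxE.
  by apply: cvgD; apply: cvgM; (try exact: cvg_cst); [apply: cvgB; [exact: cvg_cst|exact: cvg_id]|exact: cvg_id].
pose E := [set t : R | 0 <= t <= 1 /\ X (normalize (q t))].
have norm1 x : hyp x -> normalize x = x.
  by case=> xx _; rewrite /normalize xx opprK sqrtr1 invr1 scale1r.
have E0 : E 0.
  split; first by lra.
  rewrite /q subr0 scale1r scale0r addr0 norm1 //; exact: inner_cover.
have E1 t : E t -> t < 1.
  move=> [t01 Xt]; rewrite lt_neqAle; apply/andP; split; last by lra.
  apply/eqP => t1; apply: Xy; move: Xt; rewrite t1 /q subrr scale0r add0r scale1r norm1 //.
have hs : has_sup E by split; [exists 0|exists 1 => t /E1/ltW].
have s0 : 0 <= sup E by apply: ub_le_sup => //; case: hs.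
have s1 : sup E <= 1 by apply: ge_sup; [exists 0|move=> t /E1/ltW].
have s01 : 0 <= sup E <= 1 by rewrite s0 s1.
have [m0 m1] := q0 _ s01.
have cn : normalize (q t) @[t --> sup E] --> normalize (q (sup E)).
  by apply: cvg_normalize => //; exact: cq.
have Es : E (sup E).
  split=> //; have cX : closed X by exact: cover_closed.
  apply: cX => U nU; have := cn _ nU => /nbhs_ballP[e /= e0 he].
  have [t Et st] := sup_adherent e0 hs; have [_ Xt] := Et.
  exists (normalize (q t)); split=> //; apply: (he t).
  rewrite /ball /= ltr_distlC; have := ub_le_sup (proj2 hs) Et; rewrite st; lra.
have sl := E1 _ Es; case: (Es) => _ Xs.
have fr : ~ inner X (normalize (q (sup E))).
  move=> /inner_near ni; have := cn _ ni => /nbhs_ballP[e /= e0 he].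
  pose t := sup E + Num.min (e / 2) ((1 - sup E)).
  have m : 0 < Num.min (e / 2) (1 - sup E) by rewrite lt_min; lra.
  have m2 : Num.min (e / 2) (1 - sup E) <= e / 2 by rewrite ge_min lexx.
  have m3 : Num.min (e / 2) (1 - sup E) <= 1 - sup E by rewrite ge_min lexx orbT.
  have t01 : 0 <= t <= 1 by rewrite /t; lra.
  have Et : E t.
    split=> //; apply: inner_cover; apply: (he t); last by case: (q0 _ t01) => *; apply: hyp_normalize.
    by rewrite /ball /= ltr_distlC /t; lra.
  by have := ub_le_sup (proj2 hs) Et; rewrite /t; lra.
have [C [gC Cx CX]] := cover_frontier Xs fr.
have bC : bdry C by [].
have [u ou] := boundary_normal bC; exists C, u; split=> //.
have [uu CE uX ui] := ou; move: Cx; rewrite CE => /(points_reflection uu)[_].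
have [r0 qE] := normalize_scale m0.
have : mdot u (q (sup E)) = Num.sqrt (- mdot (q (sup E)) (q (sup E))) * mdot u (normalize (q (sup E))).
  by rewrite {1}qE mdotZr.
move=> + un0; rewrite un0 mulr0 /q !mdotlin; have := ui _ ip.
have s0' : 0 < sup E.
  rewrite lt_neqAle s0 andbT; apply/eqP => s00; apply: fr.
  by rewrite -s00 /q subr0 scale1r scale0r addr0 norm1.
nra.
Qed.

Lemma finite_set_min (T : choiceType) (A : set T) (f : T -> R) : finite_set A ->
  A !=set0 -> exists2 a, A a & forall b, A b -> f a <= f b.
Proof.
move=> /finite_seqP[s ->] [a0 sa0].
have [i /= _ h] := @Order.TotalTheory.arg_minP _ _ (seq_sub s) (SeqSub sa0) xpredT (fun i => f (val i)) isT.
exists (val i); first exact: valP.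
by move=> b sb; exact: (h (SeqSub sb)).
Qed.

Section Discrete.
Hypothesis Wfin : forall c, finite_set [set w | W w /\ w ord_max ord_max <= c].

Lemma minimize p x (S : set 'M[R]_3) : hyp p -> hyp x -> S `<=` W -> S !=set0 ->
  exists2 w, S w & forall w', S w' -> - mdot p (w *m x) <= - mdot p (w' *m x).
Proof.
move=> hp hx SW [w0 Sw0].
pose S' := [set w | S w /\ - mdot p (w *m x) <= - mdot p (w0 *m x)].
have fS : finite_set S'.
  apply: sub_finite_set (Wfin (4 * x ord_max 0 * - mdot p (w0 *m x) * p ord_max 0)).
  move=> w [Sw h]; split; first exact: SW.
  apply: le_trans (isometry_move (refl_isometry (SW _ Sw)) hx hp) _.
  rewrite (mdotC _ p); case: hp => _ p0; case: hx => _ x0.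
  by rewrite ler_pM2r // ler_pM2l // mulr_gt0.
have [|w [Sw h] hmin] := finite_set_min (fun w => - mdot p (w *m x)) fS; first by exists w0; split.
exists w => // w' Sw'; have [h'|h'] := leP (- mdot p (w' *m x)) (- mdot p (w0 *m x)).
  exact: hmin.
by apply: le_trans h (ltW h').
Qed.

(** Dirichlet's argument: a translate of [x] nearest to an interior point [p] lies in the cover,
    because reflecting it in a boundary geodesic that separates it from [p] would bring it closer.
    The discreteness [Wfin], which makes the minimum exist, is supplied by [refl_finite]. *)
Lemma tile_cover x : hyp x -> exists2 w, W w & X (w *m x).
Proof.
move=> hx; have ip := innerptP O; have hp := cover_hyp (inner_cover ip).
have [||w Ww hmin] := minimize hp hx (S := W) => //; first by exists 1; exact: refl1.
exists w => //; apply: contrapT => Xw.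
have hw := hyp_isometry (refl_isometry Ww) hx.
have [C [u [bC [uu CE _ ui] uy]]] := exit_boundary ip hw Xw.
have := hmin (C * w) (reflM (boundary_refl bC) Ww).
rewrite mul_mxM CE reflectionE mdotBr mdotZr (mdotC _ u).
by have := ui _ ip; nra.
Qed.

End Discrete.

Lemma dgrp_refl w : dgrp O w -> W w. Proof. by case. Qed.

Lemma dgrp_subgroup : subgroup (dgrp O).
Proof.
split=> [|a b [Wa da] [Wb db]|a [Wa da]]; split; rewrite ?det1 //.
- exact: refl1.
- exact: reflM.
- by rewrite det_mulmx da db mulr1.
- exact: reflV.
- by rewrite det_inv da invr1.
Qed.

Lemma grp_dgrp w : grp O w -> dgrp O w.
Proof. by move=> Gw; split; [exact: grp_refl|case: (grp_isometry Gw)]. Qed.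

Lemma dgrp_or_boundary B w : bdry B -> W w -> dgrp O w \/ dgrp O (B * w).
Proof.
move=> bB Ww; have [d|d] := sqr_det_isometry (refl_isometry Ww); first by left.
right; split; first by apply: reflM => //; exact: boundary_refl.
by rewrite det_mulmx d det_geodesic; [ring|case: bB].
Qed.

Lemma boundaryM_dgrp A B : bdry A -> bdry B -> dgrp O (B * A).
Proof.
move=> bA bB; split; first by apply: reflM; exact: boundary_refl.
by rewrite det_mulmx !det_geodesic; [ring|case: bA|case: bB].
Qed.

End ReflectionGroup.

(** * Test functions and Borel measures on matrices *)

Section RealFunctions.
Variables (R : realType) (S : topologicalType).
Implicit Types f g : S -> R.

Lemma continuousDR f g : continuous f -> continuous g -> continuous (fun x => f x + g x).
Proof. by move=> cf cg x; apply: cvgD; [exact: cf|exact: cg]. Qed.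

Lemma continuousBR f g : continuous f -> continuous g -> continuous (fun x => f x - g x).
Proof. by move=> cf cg x; apply: cvgB; [exact: cf|exact: cg]. Qed.

Lemma continuousMR f g : continuous f -> continuous g -> continuous (fun x => f x * g x).
Proof. by move=> cf cg x; apply: cvgM; [exact: cf|exact: cg]. Qed.

Lemma continuous_normR f : continuous f -> continuous (fun x => `|f x|).
Proof. by move=> cf x; apply: cvg_norm; exact: cf. Qed.

Lemma continuous_cstR (a : R) : continuous (fun _ : S => a).
Proof. exact: cst_continuous. Qed.

Lemma continuous_minR f g :
  continuous f -> continuous g -> continuous (fun A => Num.min (f A) (g A)).
Proof. by move=> cf cg A; exact: (continuous_min (cf A) (cg A)). Qed.

Lemma continuous_maxR f g :
  continuous f -> continuous g -> continuous (fun A => Num.max (f A) (g A)).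
Proof. by move=> cf cg A; exact: (continuous_max (cf A) (cg A)). Qed.

End RealFunctions.

Section TestFunctions.
Variable R : realType.
Notation T := 'M[R]_3.
Notation cs := (@compactly_supported R T).
Implicit Types (f g : T -> R) (k : R).

Definition nball k : set T := [set A | `|A| <= k].

Lemma mx_entry_norm (A : T) i j : `|A i j| <= `|A|.
Proof.
rewrite [leRHS]/Num.norm /= mx_normrE; apply/bigmax_geP; right => /=.
by exists (i, j).
Qed.

Lemma mx_norm_le (A : T) k : 0 <= k -> (forall i j, `|A i j| <= k) -> `|A| <= k.
Proof.
move=> k0 h; rewrite [leLHS]/Num.norm /= mx_normrE; apply/bigmax_leP; split=> // -[i j] _.
Qed.

Lemma closed_nball k : closed (nball k : set T).
Proof.
apply: (@continuous_comp_closed _ _ (fun A : T => `|A|) [set x : R | x <= k]); last exact: closed_le.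
exact: norm_continuous.
Qed.

Lemma compact_nball k : compact (nball k).
Proof.
apply: (subclosed_compact (closed_nball (k := k)) (@compact_mx R 3 3 k)).
by move=> A Ak i j; apply: le_trans Ak; exact: mx_entry_norm.
Qed.

Lemma compact_nballP (K : set T) : compact K -> exists k, K `<=` nball k.
Proof.
move=> /compact_bounded[k [_ hk]]; exists (k + 1) => A KA; apply: (hk (k + 1)) => //; lra.
Qed.

Lemma csP f : cs f <-> continuous f /\ exists k, forall A, k < `|A| -> f A = 0.
Proof.
split=> [[cf [K cK fK]]|[cf [k fk]]]; split=> //.
  have [k Kk] := compact_nballP cK; exists k => A kA; apply: contrapT => /eqP/fK/Kk.
  by rewrite /nball /= leNgt kA.
exists (nball k); first exact: compact_nball.
by move=> A /eqP fA; rewrite /nball /= leNgt; apply/negP => /fk.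
Qed.

Lemma csMl f g : cs f -> continuous g -> cs (fun A => f A * g A).
Proof.
move=> [cf [K cK fK]] cg; split; last first.
  by exists K => // A; rewrite mulf_eq0 negb_or => /andP[/fK].
exact: continuousMR.
Qed.

Lemma cs_sub f g : cs f -> continuous g -> (forall A, f A = 0 -> g A = 0) -> cs g.
Proof.
move=> [cf [K cK fK]] cg fg; split=> //; exists K => // A gA; apply: fK.
by apply: contra gA => /eqP/fg ->.
Qed.

Lemma csD f g : cs f -> cs g -> cs (fun A => f A + g A).
Proof.
move=> /csP[cf [k fk]] /csP[cg [l gl]]; apply/csP; split.
  exact: continuousDR.
exists (Num.max k l) => A; rewrite gt_max => /andP[kA lA].
by rewrite fk // gl // addr0.
Qed.

Lemma csZ (a : R) f : cs f -> cs (fun A => a * f A).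
Proof.
move=> csf; apply: (cs_sub csf); last by move=> A ->; rewrite mulr0.
by apply: continuousMR; [exact: continuous_cstR|case: csf].
Qed.

Lemma csB f g : cs f -> cs g -> cs (fun A => f A - g A).
Proof.
move=> csf csg; have := csD csf (csZ (-1) csg).
by congr cs; apply/funext => A; rewrite mulN1r.
Qed.

Lemma cs0 : cs (fun _ => 0).
Proof. by apply/csP; split; [exact: cst_continuous|exists 0]. Qed.

Lemma cs_norm f : cs f -> cs (fun A => `|f A|).
Proof.
move=> csf; apply: (cs_sub csf); last by move=> A ->; rewrite normr0.
by apply: continuous_normR; case: csf.
Qed.

Lemma cs_sum (I : Type) (s : seq I) (P : pred I) (f : I -> T -> R) :
  (forall i, cs (f i)) -> cs (fun A => \sum_(i <- s | P i) f i A).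
Proof.
move=> csf; elim: s => [|i s IH].
  by under eq_fun do rewrite big_nil; exact: cs0.
under eq_fun do rewrite big_cons; case: (P i) => //; exact: csD.
Qed.

Definition bump k (A : T) : R := Num.max 0 (k - `|A|).

Lemma bump_ge0 k A : 0 <= bump k A. Proof. by rewrite le_max lexx. Qed.

Lemma cs_bump k : cs (bump k).
Proof.
apply/csP; split.
  apply: continuous_maxR; first exact: continuous_cstR.
  by apply: continuousBR; [exact: continuous_cstR|exact: norm_continuous].
by exists k => A kA; apply/max_idPl; lra.
Qed.

Lemma bump_gt0 k A : (0 < bump k A) = (`|A| < k).
Proof. by rewrite lt_max ltxx subr_gt0. Qed.

Lemma bump_ge1 k A : `|A| <= k -> 1 <= bump (k + 1) A.
Proof. by move=> kA; rewrite le_max; apply/orP; right; lra. Qed.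

Lemma cs_comp f (h : T -> T) k l : cs f -> continuous h ->
  (forall c, exists d, forall A, `|h A| <= c -> `|A| <= d) -> k = l -> cs (f \o h).
Proof.
move=> /csP[cf [m fm]] ch hp _; apply/csP; split.
  by move=> A; apply: continuous_comp; [exact: ch|exact: cf].
have [d hd] := hp m; exists d => A dA /=; apply: fm; rewrite ltNge.
by apply/negP => /hd; rewrite leNgt dA.
Qed.

End TestFunctions.

Section BorelMatrices.
Variable R : realType.
Notation T := 'M[R]_3.
Notation BT := (borel T).
Notation cs := (@compactly_supported R T).

Lemma open_measurable_borel (S : ptopologicalType) (U : set S) : open U -> measurable (U : set (borel S)).
Proof. exact: sub_sigma_algebra. Qed.

Lemma closed_measurable_borel (S : ptopologicalType) (U : set S) : closed U -> measurable (U : set (borel S)).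
Proof.
move=> cU; rewrite -[U]setCK; apply: measurableC; apply: open_measurable_borel.
exact: closed_openC.
Qed.

Lemma continuous_measurable_borel (S : ptopologicalType) (f : S -> R) D : continuous f ->
  measurable_fun D (f : borel S -> R).
Proof.
move=> cf; apply: (@measurable_funS _ _ _ _ setT) => //.
apply: (measurability _ (measurable_realfun.RGenOInfty.measurableE R)) => _ [_ [x ->] <-].
rewrite setTI; apply: open_measurable_borel.
by apply: open_comp => // y _; exact: cf.
Qed.

Lemma continuous_measurable_map (S S' : ptopologicalType) (f : S -> S') : continuous f ->
  measurable_fun setT (f : borel S -> borel S').
Proof.
move=> cf; apply: (@measurability _ _ (borel S) (borel S') setT f (@open S')) => // _ [U oU <-].
rewrite setTI; apply: open_measurable_borel.
by apply: open_comp => // y _; exact: cf.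
Qed.

Definition locally_finite (mu : gmeasure R) := forall k : R, (mu (nball k) < +oo)%E.

Lemma radon_locally_finite (mu : gmeasure R) : radon mu -> locally_finite mu.
Proof. by move=> [h _] k; apply: h; exact: compact_nball. Qed.

Lemma measurable_nball (k : R) : measurable (nball k : set BT).
Proof. exact: (@closed_measurable_borel T _ (@closed_nball R k)). Qed.

Lemma cs_bounded f : cs f -> exists2 M : R, 0 <= M & forall A, `|f A| <= M.
Proof.
move=> /csP[cf [k fk]].
have cK : compact (f @` nball k) by apply: continuous_compact; [exact: continuous_subspaceT|exact: compact_nball].
have [M [_ hM]] := compact_bounded cK.
exists `|M + 1| => // A; have [Ak|kA] := leP `|A| k; last by rewrite fk // normr0.
apply: le_trans (ler_norm _); apply: (hM (M + 1)); [lra|by exists A].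
Qed.

Lemma bounded_integrable (mu : gmeasure R) (f : BT -> R) (k M : R) : locally_finite mu ->
  measurable_fun setT f -> (forall A, `|f A| <= M) -> (forall A, k < `|A : T| -> f A = 0) ->
  mu.-integrable setT (EFin \o f).
Proof.
move=> lf mf fM fk; have -> : EFin \o f = (EFin \o f) \_ (nball k : set BT).
  apply/funext => A; rewrite /patch; case: ifPn => // /negP kA.
  by rewrite /= fk // ltNge; apply/negP => h; apply: kA; exact/mem_set.
apply/integrable_restrict; [exact: measurable_nball|exact: measurableT|].
rewrite setTI.
apply: (measurable_bounded_integrable (measurable_nball k)).
- exact: lf.
- exact: measurable_funS mf.
- by exists M; split; [exact: num_real|move=> x Mx A _ /=; apply: le_trans (fM A) (ltW Mx)].
Qed.

Lemma cs_integrable (mu : gmeasure R) f : locally_finite mu -> cs f ->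
  mu.-integrable setT (EFin \o (f : BT -> R)).
Proof.
move=> lf csf; have [M _ fM] := cs_bounded csf; have [cf [k fk]] := (csP f).1 csf.
by apply: (bounded_integrable lf _ fM fk); exact: continuous_measurable_borel.
Qed.

(** Distance from [x] to the complement of [U], truncated at 1 so that it remains finite when [U] is
    the whole space. *)
Definition opendist (U : set T) (x : T) : R :=
  sup [set r | 0 <= r <= 1 /\ forall y, `|y - x| < r -> U y].

Lemma opendist_has_sup U x : has_sup [set r : R | 0 <= r <= 1 /\ forall y : T, `|y - x| < r -> U y].
Proof.
split; first by exists 0; split; [rewrite lexx ler01|move=> y; rewrite ltNge normr_ge0].
by exists 1 => r [/andP[]].
Qed.

Lemma opendist01 U x : 0 <= opendist U x <= 1.
Proof.
have [h1 h2] := opendist_has_sup U x; apply/andP; split.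
  apply: ub_le_sup => //; split; first by rewrite lexx ler01.
  by move=> y; rewrite ltNge normr_ge0.
by apply: ge_sup => // r [/andP[]].
Qed.

Lemma opendist_lip U x y : opendist U x - `|x - y| <= opendist U y.
Proof.
have hx := opendist_has_sup U x; have hy := opendist_has_sup U y.
rewrite lerBlDr; apply: ge_sup; first by case: hx.
move=> r [r01 hr]; have [rd|rd] := leP r `|x - y|.
  by have := opendist01 U y; lra.
rewrite -lerBlDr; apply: ub_le_sup; first by case: hy.
split; first by have := normr_ge0 (x - y); lra.
move=> z zy; apply: hr; have := ler_normD (z - y) (y - x); rewrite addrA subrK.
by rewrite (distrC y x); lra.
Qed.

Lemma continuous_opendist U : continuous (opendist U).
Proof.
move=> x; apply/(@cvgrPdist_le _ _ _ (nbhs x)) => e e0.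
have : \forall y \near x, `|x - y| <= e.
  by apply: (@cvgr_dist_le _ _ _ (nbhs x)) => //; exact: cvg_id.
apply: filterS => y hy.
have h1 := opendist_lip U x y; have h2 := opendist_lip U y x.
rewrite distrC in h2; rewrite ler_norml; lra.
Qed.

Lemma opendist_gt0 U x : open U -> (0 < opendist U x) <-> U x.
Proof.
move=> oU; split=> [|Ux].
  move=> /(sup_gt (proj1 (opendist_has_sup U x)))[r [_ hr] r0]; apply: hr.
  by rewrite subrr normr0.
have /nbhs_ballP[e /= e0 he] : nbhs x U by exact: open_nbhs_nbhs.
have m0 : 0 < Num.min e 1 by rewrite lt_min e0 ltr01.
apply: (lt_le_trans m0); apply: ub_le_sup; first by case: (opendist_has_sup U x).
split; first by rewrite (ltW m0) ge_min lexx orbT.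
by move=> y; rewrite lt_min => /andP[ye _]; apply: he; rewrite -ball_normE /= distrC.
Qed.

Definition indic_approx U (n : nat) (x : T) : R := Num.min 1 (n%:R * opendist U x).

Lemma indic_approx01 U n x : 0 <= indic_approx U n x <= 1.
Proof.
rewrite /indic_approx ge_min lexx le_min ler01 /= andbT mulr_ge0 //.
by have /andP[] := opendist01 U x.
Qed.

Lemma continuous_indic_approx U n : continuous (indic_approx U n).
Proof.
apply: continuous_minR; first exact: continuous_cstR.
by apply: continuousMR; [exact: continuous_cstR|exact: continuous_opendist].
Qed.

Lemma indic_approx_homo U x n m : (n <= m)%N -> indic_approx U n x <= indic_approx U m x.
Proof.
move=> nm; rewrite /indic_approx le_min !ge_min lexx /=; apply/orP; right.
by apply: ler_wpM2r; [case/andP: (opendist01 U x)|rewrite ler_nat].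
Qed.

Lemma indic_approx_notin U x n : open U -> ~ U x -> indic_approx U n x = 0.
Proof.
move=> oU Ux; have : opendist U x <= 0 by rewrite leNgt; apply/negP => /(opendist_gt0 _ oU).
have := opendist01 U x => /andP[h _] h'; have -> : indic_approx U n x = Num.min 1 0.
  by rewrite /indic_approx (_ : opendist U x = 0) ?mulr0 //; lra.
by apply/min_idPr.
Qed.

Lemma indic_approx_in U x : open U -> U x -> exists N, forall n, (N <= n)%N -> indic_approx U n x = 1.
Proof.
move=> oU /(opendist_gt0 _ oU) d0.
have [N hN] : exists N : nat, (opendist U x)^-1 < N%:R.
  by exists (Num.bound (opendist U x)^-1); apply: archi_boundP; rewrite invr_ge0 ltW.
exists N => n Nn; apply/min_idPl; rewrite -ler_pdivrMr // div1r.
by apply: le_trans (ltW hN) _; rewrite ler_nat.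
Qed.

End BorelMatrices.

(** * The Riesz representation theorem *)

Section Uniqueness.
Variable R : realType.
Notation T := 'M[R]_3.
Notation BT := (borel T).
Notation cs := (@compactly_supported R T).

Definition open_approx (U : set T) (n : nat) (x : T) : R :=
  indic_approx U n x * Num.min 1 (bump n%:R x).

Lemma cs_open_approx U n : cs (open_approx U n).
Proof.
apply: (@cs_sub _ (bump n%:R)); first exact: cs_bump.
  apply: continuousMR; first exact: continuous_indic_approx.
  by apply: continuous_minR; [exact: continuous_cstR|case: (@cs_bump R n%:R)].
by move=> A b0; rewrite /open_approx b0 (min_idPr _) ?mulr0.
Qed.

Lemma bump01 (k : R) (x : T) : 0 <= Num.min 1 (bump k x) <= 1.
Proof. by rewrite ge_min lexx le_min ler01 bump_ge0. Qed.

Lemma open_approx01 U n x : 0 <= open_approx U n x <= 1.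
Proof.
have /andP[a0 a1] := indic_approx01 U n x; have /andP[b0 b1] := bump01 n%:R x.
by rewrite mulr_ge0 // mulr_ile1.
Qed.

Lemma open_approx_homo U n m x : (n <= m)%N -> open_approx U n x <= open_approx U m x.
Proof.
move=> nm; have /andP[a0 _] := indic_approx01 U n x; have /andP[b0 _] := bump01 n%:R x.
apply: ler_pM => //; first exact: indic_approx_homo.
have : bump n%:R x <= bump m%:R x.
  have : (n%:R <= m%:R :> R) by rewrite ler_nat.
  by rewrite /bump ge_max !le_max lexx /= => h; apply/orP; right; lra.
by rewrite le_min !ge_min lexx /= => ->; rewrite orbT.
Qed.

Lemma open_approx_cvg U x : open U -> (open_approx U n x)%:E @[n --> \oo] --> (\1_U x)%:E.
Proof.
move=> oU; have [Ux|Ux] := pselect (U x); last first.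
  rewrite indicE memNset //; under eq_fun do rewrite /open_approx indic_approx_notin // mul0r.
  exact: cvg_cst.
rewrite indicE mem_set //.
have [N hN] := indic_approx_in oU Ux.
have [M hM] : exists M : nat, `|x| + 1 < M%:R.
  by exists (Num.bound (`|x| + 1)); apply: archi_boundP; rewrite addr_ge0.
apply: cvg_near_cst; exists (N + M)%N => // n /= NMn.
have Nn : (N <= n)%N by apply: leq_trans NMn; rewrite leq_addr.
have Mn : (M <= n)%N by apply: leq_trans NMn; rewrite leq_addl.
rewrite /open_approx hN // mul1r (min_idPl _) //.
have : (M%:R <= n%:R :> R) by rewrite ler_nat.
by move=> h; rewrite le_max; apply/orP; right; lra.
Qed.

Lemma open_approx_integral_cvg (mu : gmeasure R) (U : set T) : open U ->
  (\int[mu]_x (open_approx U n x)%:E)%E @[n --> \oo] --> mu U.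
Proof.
move=> oU; have mU : measurable (U : set BT) by exact: open_measurable_borel.
have -> : mu U = (\int[mu]_x (\1_U x)%:E)%E by rewrite integral_indic // setIT.
have -> : (\int[mu]_x (\1_U x)%:E)%E = (\int[mu]_x limn (fun n => (open_approx U n x)%:E))%E.
  by apply: eq_integral => x _; rewrite (cvg_lim _ (open_approx_cvg (x := x) oU)).
apply: (@cvg_monotone_convergence _ BT R mu setT measurableT (fun n x => (open_approx U n x)%:E)).
- move=> n; apply/measurable_EFinP; apply: continuous_measurable_borel.
  by case: (cs_open_approx U n).
- by move=> n x _; rewrite lee_fin; case/andP: (open_approx01 U n x).
- by move=> x _ n m nm; rewrite lee_fin open_approx_homo.
Qed.

Lemma integral_cs (mu : gmeasure R) f : locally_finite mu -> cs f ->
  (\int[mu]_x (f x)%:E)%E = (\int[mu]_x f x)%:E.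
Proof.
move=> lf csf; rewrite /Rintegral fineK //.
by apply: integrable_fin_num => //; exact: cs_integrable.
Qed.

Lemma measure_eq_tests (mu nu : gmeasure R) : locally_finite mu -> locally_finite nu ->
  (forall f, cs f -> (forall x, 0 <= f x) -> \int[mu]_x f x = \int[nu]_x f x) ->
  forall E, measurable (E : set BT) -> mu E = nu E.
Proof.
move=> lm ln mn; apply: (@measure_unique _ R BT (@open T) (fun n => [set x : T | `|x| < n%:R])).
- by [].
- by move=> A B; exact: openI.
- move=> n; apply: (@open_comp _ _ (fun x : T => `|x|) [set x : R | x < n%:R]); last exact: open_lt.
  by move=> x _; exact: norm_continuous.
- apply/seteqP; split=> // x _; exists (Num.bound `|x|) => //=.
  by apply: archi_boundP.
- move=> U oU; have h1 := @open_approx_integral_cvg mu U oU.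
  have h2 := @open_approx_integral_cvg nu U oU.
  rewrite -(cvg_lim _ h1) // -(cvg_lim _ h2) //; congr (limn _); apply/funext => n.
  have csn := cs_open_approx U n.
  rewrite !integral_cs // mn // => x; by case/andP: (open_approx01 U n x).
- move=> n; apply: le_lt_trans (lm n%:R); apply: le_measure.
  + apply/mem_set; apply: open_measurable_borel.
    apply: (@open_comp _ _ (fun x : T => `|x|) [set x : R | x < n%:R]); last exact: open_lt.
    by move=> x _; exact: norm_continuous.
  + by apply/mem_set; exact: measurable_nball.
  + by move=> x; exact: ltW.
Qed.

End Uniqueness.

Section Normalization.
Variables (R : realType) (S : ptopologicalType).
Variable nu : borel_measure R S.

(** [radon] prescribes the value zero outside the Borel sets; this enforces it while keeping the
    values on Borel sets. *)
Definition normal_measure (E : set (borel S)) : \bar R :=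
  if `[< measurable E >] then nu E else 0%E.

Lemma normal_measureE E : measurable E -> normal_measure E = nu E.
Proof. by move=> mE; rewrite /normal_measure asboolT. Qed.

Lemma normal_measureN E : ~ measurable E -> normal_measure E = 0%E.
Proof. by move=> mE; rewrite /normal_measure asboolF. Qed.

Lemma normal_measure0 : normal_measure set0 = 0%E.
Proof. by rewrite normal_measureE. Qed.

Lemma normal_measure_ge0 E : (0 <= normal_measure E)%E.
Proof. by rewrite /normal_measure; case: ifP. Qed.

Lemma normal_measure_sigma_additive : semi_sigma_additive normal_measure.
Proof.
move=> F mF tF mUF; rewrite normal_measureE //.
under eq_fun do under eq_bigr do rewrite normal_measureE //.
exact: measure_semi_sigma_additive.
Qed.

HB.instance Definition _ := isMeasure.Build _ (borel S) R normal_measure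
  normal_measure0 normal_measure_ge0 normal_measure_sigma_additive.

Lemma exists_normal_measure : exists mu : borel_measure R S,
  (forall E, measurable E -> mu E = nu E) /\ (forall E, ~ measurable E -> mu E = 0%E).
Proof.
by exists (normal_measure : borel_measure R S); split; [exact: normal_measureE|exact: normal_measureN].
Qed.

End Normalization.

Section Riesz.
Variable R : realType.
Notation T := 'M[R]_3.
Notation BT := (borel T).
Notation cs := (@compactly_supported R T).

Record positive_functional := PositiveFunctional {
  functional :> (T -> R) -> R ;
  functionalD : forall f g, cs f -> cs g ->
    functional (fun x => f x + g x) = functional f + functional g ;
  functionalZ : forall a f, cs f -> functional (fun x => a * f x) = a * functional f ;
  functional_ge0 : forall f, cs f -> (forall x, 0 <= f x) -> 0 <= functional f }.

Variable L : positive_functional.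

Lemma functionalB f g : cs f -> cs g -> L (fun x => f x - g x) = L f - L g.
Proof.
move=> csf csg; have -> : (fun x => f x - g x) = (fun x => f x + (-1) * g x).
  by apply/funext => x; rewrite mulN1r.
by rewrite functionalD // ?functionalZ ?mulN1r //; exact: csZ.
Qed.

Lemma functional_le f g : cs f -> cs g -> (forall x, f x <= g x) -> L f <= L g.
Proof.
move=> csf csg fg; rewrite -subr_ge0 -functionalB //; apply: functional_ge0; first exact: csB.
by move=> x; rewrite subr_ge0.
Qed.

Lemma functional0 : L (fun _ => 0) = 0.
Proof.
have := functionalZ L 0 (cs0 R); by rewrite !mul0r.
Qed.

Lemma functional_sum n (f : nat -> T -> R) : (forall i, cs (f i)) ->
  L (fun x => \sum_(i < n) f i x) = \sum_(i < n) L (f i).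
Proof.
move=> csf; elim: n => [|n IH].
  by rewrite big_ord0 -[RHS]functional0; congr (L _); apply/funext => x; rewrite big_ord0.
rewrite big_ord_recr /= -IH -functionalD //; last exact: cs_sum.
by congr (L _); apply/funext => x; rewrite big_ord_recr.
Qed.

(** Dini's argument: by compactness of the support, a single [g N] exceeds [f] up to an error [e],
    which is absorbed by [e] times a bump equal to at least 1 on the support. *)
Lemma functional_daniell (f : T -> R) (g : nat -> T -> R) (c : R) :
  cs f -> (forall n, cs (g n)) -> (forall n m x, (n <= m)%N -> g n x <= g m x) ->
  (forall n x, 0 <= g n x) ->
  (forall x d, d < f x -> exists n, d < g n x) -> (forall n, L (g n) <= c) -> L f <= c.
Proof.
move=> csf csg gh g0 fg gc; have [cf [k fk]] := (csP f).1 csf.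
have b0 : 0 <= L (bump (k + 1)) by apply: functional_ge0; [exact: cs_bump|exact: bump_ge0].
have hN e : exists N : nat, 0 < e -> forall x, f x <= g N x + e * bump (k + 1) x.
  have [e0|e0] := ltP 0 e; last by exists 0%N => h; lra.
  have [n hn] := choice (fun x => fg x (f x - e / 2) ltac:(lra)).
  have [|D _ KD] := @compact_nbhs_cover _ _ (fun x => [set y | f y - e < g (n x) y]) (@compact_nball R k).
    move=> x _; have : \forall y \near x, g (n x) y - f y > - e.
      have cgf : continuous (fun y => g (n x) y - f y).
        by apply: continuousBR => //; case: (csg (n x)).
      by apply: (cvgr_gt _ (cgf x)); have := hn x; lra.
    by apply: filterS => y /=; lra.
  exists (\max_(x <- D) n x)%N => _ x.
  have [xk|xk] := leP `|x| k; last first.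
    by rewrite fk // addr_ge0 // mulr_ge0 ?bump_ge0 // ltW.
  have [y Dy /= hy] := KD x xk.
  have h1 : g (n y) x <= g (\max_(x <- D) n x)%N x by apply: gh; exact: leq_bigmax_seq.
  have h2 := bump_ge1 xk; have : e <= e * bump (k + 1) x by rewrite ler_peMr // ltW.
  lra.
have {hN} [N hN] := choice hN.
apply/ler_addgt0Pl => e e0.
pose e' := e / (L (bump (k + 1)) + 1).
have e'0 : 0 < e' by rewrite divr_gt0 //; lra.
have := functional_le csf (csD (csg (N e')) (csZ e' (@cs_bump R (k + 1)))) (hN e' e'0).
rewrite functionalD //; [|exact/csZ/cs_bump].
rewrite functionalZ; [|exact: cs_bump].
have : e' * L (bump (k + 1)) <= e.
  by rewrite /e' -mulrA ler_piMr ?ltW // mulrC ltr_pdivrMr ?mul1r; lra.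
have := gc (N e'); lra.
Qed.

(** Daniell's construction: the increasing sequence stands for a lower semicontinuous majorant of
    the indicator of [E] whose integral is at most [c]. Its supremum has to reach 1 on [E], possibly
    without being attained. *)
Definition outer_cover (c : R) (E : set T) := exists g : nat -> T -> R,
  [/\ forall n, cs (g n), forall n x, 0 <= g n x,
      forall n m x, (n <= m)%N -> g n x <= g m x,
      forall x, E x -> forall d, d < 1 -> exists n, d < g n x & forall n, L (g n) <= c].

Lemma outer_cover_ge0 c E : outer_cover c E -> 0 <= c.
Proof. by case=> g [csg g0 _ _ gc]; apply: le_trans (gc 0%N); exact: functional_ge0. Qed.

Definition riesz_outer (E : set T) : \bar R := ereal_inf [set c%:E | c in [set c | outer_cover c E]].

Lemma riesz_outer_le c E : outer_cover c E -> (riesz_outer E <= c%:E)%E.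
Proof. by move=> cE; apply: ereal_inf_lbound; exists c. Qed.

Lemma riesz_outer_ge0 E : (0 <= riesz_outer E)%E.
Proof. by apply: le_ereal_inf_tmp => _ [c cE <-]; rewrite lee_fin (outer_cover_ge0 cE). Qed.

Lemma riesz_outer0 : riesz_outer set0 = 0%E.
Proof.
apply/eqP; rewrite eq_le riesz_outer_ge0 andbT; apply: riesz_outer_le.
exists (fun _ _ => 0); split=> //; first by move=> _; exact: cs0.
by move=> _; rewrite functional0.
Qed.

Lemma riesz_outer_mono : {homo riesz_outer : A B / A `<=` B >-> (A <= B)%E}.
Proof.
move=> A B AB; apply: le_ereal_inf_tmp => _ [c [g [csg g0 gh gB gc]] <-].
apply: riesz_outer_le; exists g; split=> // x /AB; exact: gB.
Qed.

Lemma riesz_outer_sigma_subadditive : sigma_subadditive riesz_outer.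
Proof.
move=> F; have [->|ny] := eqVneq (\sum_(i <oo) riesz_outer (F i))%E +oo%E; first by rewrite leey.
have F0 n : (0 <= riesz_outer (F n))%E by exact: riesz_outer_ge0.
have S0 : (0 <= \sum_(i <oo) riesz_outer (F i))%E by exact: nneseries_ge0.
have Sf : (\sum_(i <oo) riesz_outer (F i))%E \is a fin_num by rewrite ge0_fin_numE // lt_neqAle ny leey.
have Ff n : riesz_outer (F n) \is a fin_num.
  rewrite ge0_fin_numE //; apply: le_lt_trans (_ : _ <= \sum_(i <oo) riesz_outer (F i))%E _.
    have := @nneseries_lim_ge R (fun i => riesz_outer (F i)) xpredT 0 n.+1 (fun i _ _ => F0 i).
    by apply: le_trans; rewrite big_nat_recr //= leeDr // sume_ge0.
  by rewrite lt_neqAle ny leey.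
apply/lee_addgt0Pr => e e0.
have hc i : exists c, outer_cover c (F i) /\ (c%:E <= riesz_outer (F i) + (e / (2 ^ i.+1)%:R)%:E)%E.
  have e1 : 0 < e / (2 ^ i.+1)%:R by rewrite divr_gt0 // ltr0n expn_gt0.
  by have [_ [c cF <-] h] := lb_ereal_inf_adherent e1 (Ff i); exists c; split=> //; exact: ltW.
have [c {}hc] := choice hc.
have [g hg] := choice (fun i => proj1 (hc i)).
have -> : (\sum_(i <oo) riesz_outer (F i) + e%:E)%E = (fine (\sum_(i <oo) riesz_outer (F i)) + e)%:E.
  by rewrite EFinD fineK.
(* On the diagonal [n] is both the number of summands and the index in each sequence; this keeps the
   sums increasing and finite. *)
apply: riesz_outer_le; exists (fun n x => \sum_(i < n) g i n x); split.
- by move=> n; apply: cs_sum => i; case: (hg i).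
- by move=> n x; apply: sumr_ge0 => i _; case: (hg i).
- move=> n m x nm; rewrite -(subnKC nm) big_split_ord /= ler_wpDr //.
    by apply: sumr_ge0 => i _; case: (hg (n + i)%N).
  by apply: ler_sum => i _; case: (hg i) => _ _ h _ _; apply: h; rewrite leq_addr.
- move=> x [i _ Fix] d d1; have [csg g0 gh gF _] := hg i.
  have [n dn] := gF x Fix d d1; exists (maxn n i.+1).
  apply: lt_le_trans dn _; apply: le_trans (gh _ _ x (leq_maxl n i.+1)) _.
  have im : (i < maxn n i.+1)%N by rewrite leq_max ltnSn orbT.
  rewrite (bigD1 (Ordinal im)) //= lerDl; apply: sumr_ge0 => j _; by case: (hg j).
- move=> n; rewrite (functional_sum n (f := fun i => g i n)); last by move=> i; case: (hg i).
  rewrite -lee_fin EFinD fineK //.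
  apply: le_trans (epsilon_trick xpredT F0 (ltW e0)).
  apply: le_trans (@nneseries_lim_ge R (fun i => riesz_outer (F i) + (e / (2 ^ i.+1)%:R)%:E)%E xpredT 0 n _); last first.
    by move=> i _ _; rewrite adde_ge0 // lee_fin divr_ge0 // ltW.
  rewrite big_mkord -sumEFin; apply: lee_sum => i _.
  by apply: le_trans (proj2 (hc i)); rewrite lee_fin; case: (hg i).
Qed.

HB.instance Definition _ := isOuterMeasure.Build R T riesz_outer
  riesz_outer0 riesz_outer_ge0 riesz_outer_mono riesz_outer_sigma_subadditive.

(** A sequence [g] covering [X] is split by cutoffs of [U]. The products [g n * u n] cover the part
    in [U], with integrals at most [a]. The rest is covered by the sequence [g - g * u m] for one
    fixed [m], chosen with [L (g m * u m)] close to [a]: fixing [m] is what keeps this sequence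
    increasing. *)
Lemma riesz_outer_open (U : set T) : open U -> riesz_outer.-caratheodory U.
Proof.
move=> oU; apply: le_caratheodory_measurable => X.
apply: le_ereal_inf_tmp => _ [c [g [csg g0 gh gX gc]] <-].
pose u := indic_approx U.
have u01 n x : 0 <= u n x /\ u n x <= 1 by have /andP[] := indic_approx01 U n x.
have cu n : continuous (u n) by exact: continuous_indic_approx.
have csgu n m : cs (fun x => g n x * u m x) by apply: csMl.
pose a := sup [set L (fun x => g n x * u n x) | n in [set: nat]].
have ub n m : L (fun x => g n x * u m x) <= c.
  apply: le_trans (gc n); apply: functional_le => // x.
  by rewrite ler_piMr //; case: (u01 m x).
have hs : has_sup [set L (fun x => g n x * u n x) | n in [set: nat]].
  split; first by exists (L (fun x => g 0%N x * u 0%N x)); exists 0%N.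
  by exists c => _ [n _ <-].
have h1 : (riesz_outer (X `&` U) <= a%:E)%E.
  apply: riesz_outer_le; exists (fun n x => g n x * u n x); split=> //.
  - by move=> n x; rewrite mulr_ge0 //; case: (u01 n x).
  - move=> n m x nm; apply: ler_pM => //; [by case: (u01 n x)|exact: gh|exact: indic_approx_homo].
  - move=> x [Xx Ux] d d1; have [n dn] := gX x Xx d d1.
    have [N hN] := indic_approx_in oU Ux; exists (maxn n N).
    by rewrite /u hN ?leq_maxr // mulr1; apply: lt_le_trans dn _; apply: gh; rewrite leq_maxl.
  - by move=> n; apply: ub_le_sup; [case: hs|exists n].
apply/lee_addgt0Pr => e e0.
have [_ [m _ <-] hm] := sup_adherent e0 hs.
have h2 : (riesz_outer (X `&` ~` U) <= (c - a + e)%:E)%E.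
  apply: riesz_outer_le; exists (fun n x => g (n + m)%N x - g (n + m)%N x * u m x); split.
  - by move=> n; exact: csB.
  - by move=> n x; rewrite subr_ge0 ler_piMr //; case: (u01 m x).
  - move=> n n' x nn'; have := gh (n + m)%N (n' + m)%N x (leq_add nn' (leqnn m)); have := u01 m x; nra.
  - move=> x [Xx Ux] d d1; have [n dn] := gX x Xx d d1; exists n.
    rewrite /u indic_approx_notin // mulr0 subr0; apply: lt_le_trans dn _.
    by apply: gh; rewrite leq_addr.
  - move=> n; rewrite functionalB //.
    have : L (fun x => g m x * u m x) <= L (fun x => g (n + m)%N x * u m x).
      apply: functional_le => // x; apply: ler_wpM2r; first by case: (u01 m x).
      by apply: gh; rewrite leq_addl.
    by have := gc (n + m)%N; rewrite -/a in hm; lra.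
apply: le_trans (leeD h1 h2) _; rewrite -!EFinD lee_fin; lra.
Qed.

Lemma riesz_outer_borel (E : set BT) : measurable E -> riesz_outer.-caratheodory E.
Proof.
move=> mE; apply: mE; split; last exact: riesz_outer_open.
split=> [|A mA|F mF].
- exact: caratheodory_measurable_set0.
- by rewrite setTD; exact: caratheodory_measurable_setC.
- exact: caratheodory_measurable_bigcup.
Qed.

Definition riesz_measure (E : set BT) : \bar R := riesz_outer E.

Lemma riesz_measure_sigma_additive : semi_sigma_additive riesz_measure.
Proof.
move=> F mF tF mUF; apply: (@caratheodory_measure_sigma_additive R T riesz_outer F) => //.
- by move=> i; exact: riesz_outer_borel.
- exact: riesz_outer_borel.
Qed.

HB.instance Definition _ := isMeasure.Build _ BT R riesz_measure
  riesz_outer0 riesz_outer_ge0 riesz_measure_sigma_additive.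

Lemma riesz_outer_le_functional g E : cs g -> (forall x, 0 <= g x) ->
  (forall x, E x -> 1 <= g x) -> (riesz_outer E <= (L g)%:E)%E.
Proof.
move=> csg g0 gE; apply: riesz_outer_le; exists (fun _ => g); split=> // x Ex d d1.
by exists 0%N; apply: lt_le_trans d1 (gE x Ex).
Qed.

Lemma functional_le_riesz_outer g E : cs g -> (forall x, g x <= 1) ->
  (forall x, ~ E x -> g x <= 0) -> ((L g)%:E <= riesz_outer E)%E.
Proof.
move=> csg g1 gE; apply: le_ereal_inf_tmp => _ [c [h [csh h0 hh hE hc]] <-].
rewrite lee_fin; apply: (functional_daniell csg csh hh h0) => // x d dg.
have [Ex|Ex] := pselect (E x); first by apply: hE => //; apply: lt_le_trans dg (g1 x).
by exists 0%N; apply: lt_le_trans (h0 _ _); apply: lt_le_trans dg (gE x Ex).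
Qed.

Lemma riesz_locally_finite : locally_finite (riesz_measure : gmeasure R).
Proof.
move=> k; apply: le_lt_trans (ltry (L (bump (k + 1)))).
by apply: riesz_outer_le_functional; [exact: cs_bump|exact: bump_ge0|exact: bump_ge1].
Qed.

End Riesz.

Section RieszRepresentation.
Variable R : realType.
Notation T := 'M[R]_3.
Notation BT := (borel T).
Notation cs := (@compactly_supported R T).

(* Layer-cake comparison: both functionals are squeezed on each slice of height
   e between the measures of two consecutive superlevel sets. *)
Lemma functional_layers (J1 J2 : positive_functional R) (m : R -> R) (f : T -> R) :
  (forall c, 0 <= m c) ->
  (forall g c, 0 <= c -> cs g -> (forall x, 0 <= g x <= 1) ->
     (forall x, f x <= c -> g x = 0) -> J1 g <= m c) ->
  (forall g c, 0 <= c -> cs g -> (forall x, 0 <= g x) -> (forall x, c < f x -> 1 <= g x) ->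
     m c <= J2 g) ->
  cs f -> (forall x, 0 <= f x) -> J1 f <= J2 f.
Proof.
move=> m0 J1m mJ2 csf f0; have [M M0 fM] := cs_bounded csf; have [cf _] := csf.
pose F e (n : nat) x := Num.min (f x) (n%:R * e).
have csF e n : 0 <= e -> cs (F e n).
  move=> e0; apply: (cs_sub csf); last by move=> A fA; rewrite /F fA; apply/min_idPl; rewrite mulr_ge0.
  by apply: continuous_minR => //; exact: continuous_cstR.
have step e n : 0 < e -> J1 (F e n) <= J2 (F e n) +
    e * (m 0 - m (n%:R * e)).
  move=> e0; have en : e != 0 by rewrite gt_eqF.
  elim: n => [|n IH].
    have F0 : F e 0%N = fun _ => 0 by apply/funext => x; rewrite /F mul0r; apply/min_idPr.
    by rewrite F0 !functional0 mul0r subrr mulr0 addr0.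
  pose D x := e^-1 * (F e n.+1 x - F e n x).
  have csD1 : cs (fun x => F e n.+1 x - F e n x) by apply: csB; exact: csF (ltW e0).
  have csD' : cs D by exact: csZ.
  have FE x : F e n.+1 x = F e n x + e * D x by rewrite /D mulrA divff // mul1r addrC subrK.
  have FJ (J : positive_functional R) : J (F e n.+1) = J (F e n) + e * J D.
    rewrite -functionalZ // -functionalD; [|exact: csF (ltW e0)|exact: csZ].
    by congr (J _); apply/funext.
  have nS : n.+1%:R * e = n%:R * e + e by rewrite -natr1 mulrDl mul1r.
  have D01 x : 0 <= D x <= 1.
    have : 0 <= F e n.+1 x - F e n x <= e.
      by rewrite /F nS; case: (leP (f x)) => h1; case: (leP (f x)) => h2; lra.
    move=> /andP[h1 h2]; apply/andP; split; first by rewrite /D mulr_ge0 // invr_ge0 ltW.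
    by rewrite /D mulrC ler_pdivrMr // mul1r.
  have a1 : J1 D <= m (n%:R * e).
    apply: J1m => // [|x h]; first by rewrite mulr_ge0 // ltW.
    rewrite /D /F nS (min_idPl _) ?(min_idPl h) ?subrr ?mulr0 //; lra.
  have a2 : m (n.+1%:R * e) <= J2 D.
    apply: mJ2 => // [|x|x]; [by rewrite mulr_ge0 // ltW|by case/andP: (D01 x)|].
      rewrite nS => h; rewrite /D /F nS (min_idPr _); last by lra.
      by rewrite (min_idPr _); [rewrite addrAC subrr add0r mulVf|lra].
  rewrite !FJ; move: IH a1 a2; set p := m (n.+1%:R * e).
  by set q := m (n%:R * e); nra.
apply/ler_addgt0Pl => d d0.
pose e := d / (m 0 + 1).
have m1 : 0 < m 0 + 1 by have := m0 0; lra.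
have e0 : 0 < e by rewrite divr_gt0.
have [n hn] : exists n : nat, M / e < n%:R.
  by exists (Num.bound (M / e)); apply: archi_boundP; rewrite divr_ge0 // ltW.
have Fn : F e n = f.
  apply/funext => x; apply/min_idPl; apply: le_trans (ler_norm _) _.
  by apply: le_trans (fM x) _; rewrite -ler_pdivrMr // ltW.
have := step e n e0; rewrite Fn => /le_trans; apply; rewrite addrC lerD2r.
apply: (@le_trans _ _ (e * (m 0 + 1))); last by rewrite /e divfK // gt_eqF.
by rewrite ler_pM2l //; have := m0 (n%:R * e); lra.
Qed.

Definition integral_functional (mu : gmeasure R) (lf : locally_finite mu) : positive_functional R.
Proof.
exists (fun f => \int[mu]_x f x) => [f g csf csg|a f csf|f csf f0].
- by apply: RintegralD => //; exact: cs_integrable.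
- by apply: RintegralZl => //; exact: cs_integrable.
- exact: Rintegral_ge0.
Defined.

Theorem riesz_representation (L : positive_functional R) : exists mu : gmeasure R,
  radon mu /\ forall f, cs f -> \int[mu]_x f x = L f.
Proof.
pose nu : gmeasure R := riesz_measure L.
have [mu [muE muN]] := exists_normal_measure nu.
have lf : locally_finite mu.
  by move=> k; rewrite muE; [exact: riesz_locally_finite|exact: measurable_nball].
exists mu; split.
  split=> // K cK; have [k Kk] := compact_nballP cK.
  apply: le_lt_trans (lf k); apply: le_measure => //; apply/mem_set.
    by apply: closed_measurable_borel; exact: compact_closed (@norm_hausdorff _ _) cK.
  exact: measurable_nball.
have lo : forall E, measurable (E : set BT) -> mu E = riesz_outer L E by move=> E /muE.
pose J := integral_functional lf.
have pos f : cs f -> (forall x, 0 <= f x) -> J f = L f.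
  move=> csf f0; have [cf [k fk]] := (csP f).1 csf.
  have mE c : measurable ([set x | c < f x] : set BT).
    apply: open_measurable_borel; apply: (@open_comp _ _ f [set y : R | c < y]); last exact: open_gt.
    by move=> x _; exact: cf.
  (* Superlevel sets at negative heights may have infinite measure; the maximum with 0 makes [m]
     finite and meaningful for every real [c]. *)
  pose m c := fine (riesz_outer L [set x | Num.max 0 c < f x]).
  have fin c : riesz_outer L [set x | Num.max 0 c < f x] \is a fin_num.
    rewrite ge0_fin_numE ?riesz_outer_ge0 //.
    apply: le_lt_trans (riesz_locally_finite L k).
    apply: riesz_outer_mono => x /=; rewrite gt_max => /andP[fx _].
    by rewrite /nball /= leNgt; apply/negP => /fk f0'; rewrite f0' ltxx in fx.
  have m0 c : 0 <= m c by apply: fine_ge0; exact: riesz_outer_ge0.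
  have mc c : 0 <= c -> (m c)%:E = riesz_outer L [set x | c < f x].
    by move=> c0; have := fineK (fin c); rewrite -/(m c) (max_idPr c0).
  have int_indic c : (\int[mu]_x (\1_[set x | (c < f x)%R] x)%:E)%E = riesz_outer L [set x | c < f x].
    by rewrite integral_indic // setIT muE.
  have mind c : measurable_fun setT (fun x : BT => (\1_[set x | c < f x] x)%:E : \bar R).
    exact/measurable_EFinP/measurable_indic.
  have mg g : cs g -> measurable_fun setT (fun x : BT => (g x)%:E : \bar R).
    by move=> [cg _]; apply/measurable_EFinP; exact: continuous_measurable_borel.
  apply: le_anti; apply/andP; split; apply: (functional_layers m0) => // g c c0 csg.
  - move=> g01 gE; rewrite -lee_fin mc // -integral_cs // -int_indic.
    apply: ge0_le_integral => //; try by [exact: mg|exact: mind].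
    + by move=> x _; rewrite lee_fin; case/andP: (g01 x).
    + move=> x _; rewrite lee_fin indicE; have [cx|cx] := ltP c (f x).
        by rewrite mem_set //; case/andP: (g01 x).
      by rewrite gE // memNset //= ltNge cx.
  - move=> g0 gE; rewrite -lee_fin mc //.
    exact: riesz_outer_le_functional.
  - move=> g01 gE; rewrite -lee_fin mc //.
    apply: functional_le_riesz_outer => // x; first by case/andP: (g01 x).
    by move=> /negP; rewrite -leNgt => /gE ->.
  - move=> g0 gE; rewrite -lee_fin mc // -[leRHS]integral_cs // -int_indic.
    apply: ge0_le_integral => //; try by [exact: mg|exact: mind].
    + move=> x _; rewrite lee_fin indicE; have [cx|cx] := ltP c (f x).
        by rewrite mem_set //; exact: gE.
      by rewrite memNset //= ltNge cx.
move=> f csf; rewrite -[LHS]/(J f).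
have -> : f = (fun x => (f x + `|f x|) - `|f x|) by apply/funext => x; rewrite addrK.
have csn := cs_norm csf; have csp := csD csf csn.
rewrite !functionalB // !pos // => x; rewrite -lerBlDr sub0r; exact: lerNnormlW.
Qed.

End RieszRepresentation.

(** * Currents *)

HB.instance Definition _ (R : realType) := gen_eqMixin (test_function R).

Section ImageMeasure.
Variables (R : realType) (S S' : ptopologicalType).

Lemma image_measure (mu : borel_measure R S) (h : S -> S') : continuous h ->
  exists nu : borel_measure R S', (forall E, nu E = mu (h @^-1` E)) /\
   forall f : borel S' -> R, measurable_fun setT f ->
     mu.-integrable setT (EFin \o (f \o (h : borel S -> borel S'))) ->
     (\int[nu]_x f x = \int[mu]_x f (h x))%R.
Proof.
move=> ch; have mh := continuous_measurable_map ch.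
exists (measure_function_pushforward__canonical__measure_function_Measure mu mh); split=> // f mf fi.
rewrite /Rintegral (@integral_pushforward _ _ _ _ _ _ mh mu setT (EFin \o f)) //.
exact/measurable_EFinP.
Qed.

End ImageMeasure.

Section PointwiseTopology.
Variable R : realType.

Lemma ptws_cvg (I : eqType) (T : Type) (F : set_system T) (FF : Filter F)
    (h : T -> prod_topology (fun _ : I => R)) (f : prod_topology (fun _ : I => R)) :
  (forall i, h x i @[x --> F] --> f i) -> h x @[x --> F] --> f.
Proof.
move=> hf; apply/cvg_sup => i; apply/cvg_image.
  by rewrite eqEsubset; split=> v // _; exists (cst v).
move=> W /hf FW; exists ((fun g : I -> R => g i) @^-1` W) => //.
by rewrite eqEsubset; split=> [_ [g Wg <-]//|v Wv]; exists (cst v).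
Qed.

Variable P : mclass R.

Definition test f (csf : compactly_supported f) : test_function R := exist _ f csf.

Lemma continuous_pairing f : compactly_supported f ->
  continuous (fun mu : mspace P => \int[mval mu]_A f A).
Proof.
move=> csf mu.
have c1 := @proj_continuous (test_function R) (fun _ => R) (test csf).
have c2 := @initial_continuous _ _ (@evaluation R P).
exact: (continuous_comp (c2 mu) (c1 _)).
Qed.

Lemma continuous_to_mspace (S : topologicalType) (h : S -> mspace P) :
  (forall f, compactly_supported f -> continuous (fun s => \int[mval (h s)]_A f A)) ->
  continuous h.
Proof.
move=> ch; apply: continuous_comp_initial => s; apply: (@ptws_cvg _ _ (nbhs s)) => -[f csf].
exact: ch.
Qed.

End PointwiseTopology.

Section MeasureSpaces.
Variable R : realType.
Notation T := 'M[R]_3.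
Notation BT := (borel T).
Notation cs := (@compactly_supported R T).

Lemma mval_inj (P : mclass R) (mu nu : mspace P) : mval mu = mval nu -> mu = nu.
Proof. by move: mu nu => [m Pm] [n Pn] /= e; subst n; congr exist. Qed.

Lemma the_measureE (P : mclass R) (m : set BT -> \bar R) (nu : mspace P) :
  (forall E, measurable E -> mval nu E = m E) ->
  forall E, measurable E -> mval (the_measure P m) E = m E.
Proof. by move=> h; rewrite /the_measure; case: xgetP => [nu' _ //|/(_ nu)]; exact. Qed.

Lemma radon_eq (mu nu : gmeasure R) : radon mu -> radon nu ->
  (forall E, measurable E -> mu E = nu E) -> mu = nu.
Proof.
move=> [_ m0] [_ n0] mn; apply: eq_measure; apply/funext => E.
by have [mE|mE] := pselect (measurable E); [exact: mn|rewrite m0 ?n0].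
Qed.

Lemma radon_eq_tests (mu nu : gmeasure R) : radon mu -> radon nu ->
  (forall f, cs f -> (forall x, 0 <= f x) -> \int[mu]_x f x = \int[nu]_x f x) -> mu = nu.
Proof.
move=> rm rn h; apply: radon_eq => //.
by apply: measure_eq_tests => //; exact: radon_locally_finite.
Qed.

Lemma norm_mulmx (A B : T) : `|A *m B| <= 3 * `|A| * `|B|.
Proof.
apply: mx_norm_le => [|i j]; first by rewrite !mulr_ge0.
rewrite mulmx3E; have h k : `|A i k * B k j| <= `|A| * `|B|.
  by rewrite normrM ler_pM // mx_entry_norm.
have := h 0; have := h 1; have := h ord_max => h2 h1 h0.
apply: le_trans (ler_normD _ _) _; have := ler_normD (A i 0 * B 0 j) (A i 1 * B 1 j).
lra.
Qed.

Lemma norm_act w (A : T) : `|act w A| <= 9 * `|w| * `|w^-1| * `|A|.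
Proof.
apply: le_trans (norm_mulmx _ _) _; have := norm_mulmx w A => h.
have := ler_wpM2r (normr_ge0 w^-1) h; lra.
Qed.

Lemma isometry_norm (w : T) : isometry w -> `|w| <= w ord_max ord_max.
Proof.
move=> iw; apply: mx_norm_le => [|i j]; last exact: isometry_entries.
by have := isometry_ge1 iw; lra.
Qed.

Lemma cs_act w f : isometry w -> cs f -> cs (f \o act w).
Proof.
move=> iw csf; apply: (@cs_comp _ f (act w) 0 0 csf) => //; first exact: continuous_act.
move=> c; exists (9 * `|w^-1| * `|w| * c) => A Ac.
rewrite -{1}(actK A iw); apply: le_trans (norm_act _ _) _; rewrite invrK.
by apply: ler_wpM2l => //; rewrite !mulr_ge0.
Qed.

Lemma measurable_act w (E : set BT) : measurable E -> measurable (act w @^-1` E : set BT).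
Proof.
move=> mE; rewrite -[X in measurable X]setTI.
exact: (continuous_measurable_map (@continuous_act R w) measurableT).
Qed.

Lemma locally_finite_act (mu : gmeasure R) w : isometry w -> locally_finite mu ->
  forall k : R, (mu (act w @^-1` (nball k)) < +oo)%E.
Proof.
move=> iw lmu k; apply: le_lt_trans (lmu (9 * `|w^-1| * `|w| * k)); apply: le_measure.
- by apply/mem_set; apply: measurable_act; exact: measurable_nball.
- by apply/mem_set; exact: measurable_nball.
move=> A; rewrite /nball /= => Ak; rewrite -{1}(actK A iw); apply: le_trans (norm_act _ _) _.
by rewrite invrK; apply: ler_wpM2l => //; rewrite !mulr_ge0.
Qed.

Lemma tests_invariant (mu : gmeasure R) w : isometry w -> locally_finite mu ->
  (forall f, cs f -> \int[mu]_A f (act w A) = \int[mu]_A f A) ->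
  forall E : set BT, measurable E -> mu (act w @^-1` E) = mu E.
Proof.
move=> iw lmu inv E mE; have [nu [nuE nuI]] := image_measure mu (@continuous_act R w).
rewrite -nuE; apply: measure_eq_tests => // [k|f csf f0].
  by rewrite nuE; exact: locally_finite_act.
rewrite nuI ?inv //; first by apply: continuous_measurable_borel; case: csf.
by apply: cs_integrable => //; exact: cs_act.
Qed.

Variables (G : set T) (X : set 'cV[R]_3).
Hypothesis Giso : forall w, G w -> isometry w.
Hypothesis cX : closed X.
Notation C := (mspace (current_class G X)).

Lemma currentP (mu : C) : is_current G X (mval mu).
Proof. exact: (svalP mu). Qed.

Lemma current_lf (mu : C) : locally_finite (mval mu).
Proof. by have [/radon_locally_finite] := currentP mu. Qed.

Lemma current_ext (mu nu : C) :
  (forall E, measurable E -> mval mu E = mval nu E) -> mu = nu.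
Proof.
by move=> h; apply: mval_inj; apply: radon_eq => //; [case: (currentP mu)|case: (currentP nu)].
Qed.

Lemma current_ext_tests (mu nu : C) :
  (forall f, cs f -> (forall x, 0 <= f x) -> \int[mval mu]_x f x = \int[mval nu]_x f x) -> mu = nu.
Proof.
by move=> h; apply: mval_inj; apply: radon_eq_tests => //; [case: (currentP mu)|case: (currentP nu)].
Qed.

Lemma measurable_geodesics_in : measurable (geodesics_in X : set BT).
Proof. by apply: closed_measurable_borel; exact: closed_geodesics_in. Qed.

Lemma invariant_Rintegral (mu : gmeasure R) w (f : BT -> R) : isometry w ->
  (forall E : set BT, measurable E -> mu (act w @^-1` E) = mu E) ->
  measurable_fun setT f -> mu.-integrable setT (EFin \o (fun A => f (act w A))) ->
  \int[mu]_A f (act w A) = \int[mu]_A f A.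
Proof.
move=> iw inv mf fi; have [nu [nuE nuI]] := image_measure mu (@continuous_act R w).
rewrite -nuI // /Rintegral; congr fine.
by apply: eq_measure_integral => E mE _; rewrite nuE inv.
Qed.

Lemma current_act (mu : C) w f : G w -> cs f ->
  \int[mval mu]_A f (act w A) = \int[mval mu]_A f A.
Proof.
move=> Gw csf; have [_ _ inv] := currentP mu; have iw := Giso Gw.
apply: invariant_Rintegral => //; first by move=> E; exact: inv.
  by apply: continuous_measurable_borel; case: csf.
by apply: cs_integrable; [exact: current_lf|exact: cs_act].
Qed.

Lemma carried_Rintegral (mu : gmeasure R) (Y : set BT) (f : BT -> R) : measurable Y ->
  mu (~` Y) = 0%E -> mu.-integrable setT (EFin \o f) -> \int[mu]_A f A = \int[mu]_(A in Y) f A.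
Proof.
move=> mY Y0 fi; rewrite /Rintegral (@negligible_integral _ _ _ mu setT (~` Y)) //.
  by rewrite setTD setCK.
exact: measurableC.
Qed.

Lemma carried_le (mu : gmeasure R) (Y : set BT) (f g : BT -> R) : measurable Y ->
  mu (~` Y) = 0%E -> mu.-integrable setT (EFin \o f) -> mu.-integrable setT (EFin \o g) ->
  (forall A, Y A -> f A <= g A) -> \int[mu]_A f A <= \int[mu]_A g A.
Proof.
move=> mY Y0 fi gi fg; rewrite (carried_Rintegral mY) // [leRHS](carried_Rintegral mY) //.
by apply: le_Rintegral => //; exact: (integrableS measurableT mY).
Qed.

Lemma current_le (mu : C) f g : cs f -> cs g -> (forall A, geodesics_in X A -> f A <= g A) ->
  \int[mval mu]_A f A <= \int[mval mu]_A g A.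
Proof.
move=> csf csg fg; have [_ Y0 _] := currentP mu.
by apply: carried_le fg => //; [exact: measurable_geodesics_in|
  apply: cs_integrable => //; exact: current_lf|apply: cs_integrable => //; exact: current_lf].
Qed.

(** The Riesz measure is carried by the geodesics in [X] because their complement is open, so that
    its measure is a limit of values of the functional at test functions vanishing on those
    geodesics. *)
Lemma functional_current (L : positive_functional R) :
  (forall w f, G w -> cs f -> L (fun A => f (act w A)) = L f) ->
  (forall f, cs f -> (forall A, geodesics_in X A -> f A = 0) -> L f = 0) ->
  exists mu : C, forall f, cs f -> \int[mval mu]_A f A = L f.
Proof.
move=> Linv L0; have [mu [rmu muL]] := riesz_representation L.
suff cmu : is_current G X mu by exists (exist _ mu cmu).
have lf := radon_locally_finite rmu.
split=> //.
- have oU : open (~` geodesics_in X) by apply: closed_openC; exact: closed_geodesics_in.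
  have := @open_approx_integral_cvg _ mu _ oU; move/cvg_lim => <- //.
  apply: cvg_lim => //; apply: cvg_near_cst; apply: nearW => n.
  rewrite integral_cs //; last exact: cs_open_approx.
  rewrite muL ?L0 //; try exact: cs_open_approx.
  move=> A gA; rewrite /open_approx indic_approx_notin ?mul0r //; exact.
- move=> w E Gw; have iw := Giso Gw; apply: tests_invariant => // f csf.
  by rewrite !muL ?Linv //; exact: cs_act.
Qed.

Definition current_functional (mu : C) : positive_functional R :=
  integral_functional (@current_lf mu).

(** [the_measure] falls back on the zero current. This default is excluded by exhibiting the
    rescaled measure, set to zero outside the Borel sets, as a current. *)
Lemma scale_spec (t : R) (mu : C) : 0 <= t ->
  forall E, measurable E -> mval (scale t mu) E = (t%:E * mval mu E)%E.
Proof.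
move=> t0; have [nu [nuE nuN]] := exists_normal_measure (mscale (NngNum t0) (mval mu) : borel_measure R T).
have [[muK _] mu0 inv] := currentP mu.
have mY := measurable_geodesics_in.
have cnu : is_current G X nu.
  split; first split=> // K cK.
  - rewrite nuE /mscale /=; last first.
      by apply: closed_measurable_borel; exact: compact_closed (@norm_hausdorff _ _) cK.
    by rewrite lte_mul_pinfty // ?muK.
  - rewrite nuE; last exact: measurableC.
    exact: (etrans (congr1 (fun z => t%:E * z)%E mu0) (mule0 _)).
  - move=> w E Gw mE; rewrite !nuE //; first by rewrite /mscale; congr (_ * _)%E; exact: inv.
    exact: measurable_act.
apply: (the_measureE (nu := exist _ nu cnu : C)) => E mE /=.
by rewrite /mval /= nuE.
Qed.

Lemma scale_pairing (t : R) (mu : C) f : 0 <= t -> cs f ->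
  \int[mval (scale t mu)]_A f A = t * \int[mval mu]_A f A.
Proof.
move=> t0; have pos f' : cs f' -> (forall A, 0 <= f' A) ->
    \int[mval (scale t mu)]_A f' A = t * \int[mval mu]_A f' A.
  move=> csf f0; have h : \int[mval (scale t mu)]_A f' A = \int[(mscale (NngNum t0) (mval mu))]_A f' A.
    by rewrite /Rintegral; congr fine; apply: eq_measure_integral => E mE _; exact: scale_spec.
  have lf := @current_lf mu.
  rewrite h /Rintegral ge0_integral_mscale //.
  - by rewrite integral_cs.
  - by apply/measurable_EFinP; apply: continuous_measurable_borel; case: csf.
  - by move=> x _; rewrite lee_fin.
move=> csf; have csn := cs_norm csf; have csp := csD csf csn.
have fE : f = (fun x => (f x + `|f x|) - `|f x|) by apply/funext => x; rewrite addrK.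
have e1 := functionalB (current_functional (scale t mu)) csp csn.
have e2 := functionalB (current_functional mu) csp csn.
rewrite /= -fE in e1 e2; rewrite e1 e2 mulrBr !pos // => x.
by rewrite -lerBlDr sub0r; exact: lerNnormlW.
Qed.

End MeasureSpaces.

(** * Compactness of currents of bounded length *)

Section Compactness.
Variable R : realType.
Notation T := 'M[R]_3.
Notation BT := (borel T).
Notation cs := (@compactly_supported R T).
Variables (G : set T) (X : set 'cV[R]_3).
Hypothesis Giso : forall w, G w -> isometry w.
Hypothesis cX : closed X.
Variable c0 : R.
Hypothesis Gcocompact : forall x, X x -> exists2 w, G w & (w *m x) ord_max 0 <= c0.
Notation C := (mspace (current_class G X)).

(** By [points33], a geodesic through a point of height at most [c0] has norm less than this; hence
    every orbit of geodesics in [X] enters the ball of this radius. *)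
Definition length_height : R := 2 * c0 ^+ 2.

(** The pairing with one fixed test function that is at least 1 at some representative of each orbit
    of geodesics; it plays the part of the length of a current. *)
Definition length (mu : C) : R := \int[mval mu]_A bump (length_height + 1) A.

Lemma length_ge0 mu : 0 <= length mu.
Proof. by apply: Rintegral_ge0 => A _; exact: bump_ge0. Qed.

Lemma continuous_length : continuous length.
Proof. exact: (continuous_pairing (cs_bump _)). Qed.

Lemma scale_length t mu : 0 <= t -> length (scale t mu) = t * length mu.
Proof. by move=> t0; apply: scale_pairing => //; exact: cs_bump. Qed.

Lemma move_geodesic A : geodesics_in X A -> exists2 w, G w & `|act w A| < length_height.
Proof.
move=> [gA AX]; have [x [Ax _]] := geodesic_foot gA; have [w Gw wx] := Gcocompact (AX _ Ax).
have iw := Giso Gw; exists w => //.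
have gwA := act_geodesic iw gA.
apply: le_lt_trans (isometry_norm (geodesic_isometry gwA)) _.
have wAx : points (act w A) (w *m x) by apply/points_act.
apply: le_lt_trans (points33 gwA wAx) _; rewrite /length_height.
have hwx : hyp (w *m x) by apply: hyp_isometry => //; case: Ax.
have := hwx => -[_ p0]; have : (w *m x) ord_max 0 ^+ 2 <= c0 ^+ 2.
  by rewrite ler_pXn2r // ?nnegrE; lra.
lra.
Qed.

(** The geodesics of [X] in a ball form a compact set, covered by finitely many open sets each of
    which an element of [G] moves into the ball of radius [length_height]. By invariance each of
    these sets contributes at most the length. *)
Lemma length_bound f : cs f -> exists2 b : R, 0 <= b &
  forall mu : C, `|\int[mval mu]_A f A| <= b * length mu.
Proof.
move=> csf; have [M M0 fM] := cs_bounded csf; have [cf [k fk]] := (csP f).1 csf.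
have ex A : exists w, isometry w /\ (geodesics_in X A -> G w /\ `|act w A| < length_height).
  have [/move_geodesic[w Gw wA]|nA] := pselect (geodesics_in X A).
    by exists w; split=> //; exact: Giso.
  by exists 1; split=> //; exact: isometry1.
have [w hw] := choice ex.
have cK : compact (nball k `&` geodesics_in X : set T).
  apply: compact_closedI; first exact: compact_nball.
  exact: closed_geodesics_in.
have [|D DK KD] := @compact_nbhs_cover _ _ (fun A => [set B | `|act (w A) B| < length_height]) cK.
  move=> A [_ /(proj2 (hw A))[_ h]].
  have cn : continuous (fun B => `|act (w A) B|).
    move=> B; apply: (@continuous_comp _ _ _ (act (w A)) (fun B => `|B|)); first exact: continuous_act.
    exact: norm_continuous.
  exact: (cvgr_lt _ (cn A)).
pose g (s : seq T) A := \sum_(B <- s) bump (length_height + 1) (act (w B) A).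
have csb B : cs (fun A => bump (length_height + 1) (act (w B) A)).
  by apply: cs_act; [case: (hw B)|exact: cs_bump].
have csg s : cs (g s) by exact: cs_sum.
have gE (mu : C) s : (forall B, B \in s -> geodesics_in X B) ->
    \int[mval mu]_A g s A = (size s)%:R * length mu.
  pose J := current_functional mu.
  elim: s => [|B s IH] sX.
    rewrite mul0r -[RHS](functional0 J); congr (J _); apply/funext => A.
    by rewrite /g big_nil.
  have h : J (g (B :: s)) = J (fun A => bump (length_height + 1) (act (w B) A)) + J (g s).
    by rewrite -functionalD //; congr (J _); apply/funext => A; rewrite /g big_cons.
  rewrite [LHS]h {1}/J /= IH; last by move=> B' sB'; apply: sX; rewrite inE sB' orbT.
  have GB : G (w B) by apply: (proj1 (proj2 (hw B) _)); apply: sX; rewrite mem_head.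
  by rewrite (current_act Giso mu GB (cs_bump _)) -natr1 mulrDl mul1r addrC.
exists (M * (size D)%:R); first by rewrite mulr_ge0.
move=> mu; rewrite -mulrA -(gE mu (enum_fset D)) => [|B DB]; last by case: (DK B DB).
pose J := current_functional mu.
have le1 (h : T -> R) : cs h -> (forall A, `|h A| <= `|f A|) -> \int[mval mu]_A h A <= M * \int[mval mu]_A g D A.
  move=> csh hf; rewrite -[leRHS](functionalZ J M (csg D)).
  apply: current_le => //; first exact: csZ.
  move=> A gA; have [Ak|kA] := leP `|A| k; last first.
    have := hf A; rewrite fk // normr0 normr_le0 => /eqP ->.
    by rewrite mulr_ge0 //; apply: sumr_ge0 => B _; exact: bump_ge0.
  have [B DB hB] := KD A (conj Ak gA).
  apply: le_trans (ler_norm _) _; apply: le_trans (hf A) _; apply: le_trans (fM A) _.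
  rewrite ler_peMr // /g (big_rem B) //=; apply: ler_wpDr.
    by apply: sumr_ge0 => B' _; exact: bump_ge0.
  by apply: bump_ge1; exact: ltW.
rewrite ler_norml; apply/andP; split; last exact: le1.
rewrite lerNl; have -> : - (\int[mval mu]_A f A) = \int[mval mu]_A (-1 * f A).
  by rewrite -[RHS]/(J (fun A => -1 * f A)) functionalZ // mulN1r.
by apply: le1 => [|A]; [exact: csZ|rewrite mulN1r normrN].
Qed.

(** Banach-Alaoglu: by Tychonoff's theorem the evaluations accumulate at a point [p] of a product of
    segments. Linearity, positivity, invariance and support pass to [p], each being a family of
    closed conditions on finitely many coordinates, and Riesz representation turns [p] into a
    current. *)
Lemma compact_length (c : R) : compact [set mu : C | length mu <= c].
Proof.
have ex (f : test_function R) : exists b : R, 0 <= b /\ forall mu : C,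
    `|\int[mval mu]_A (sval f) A| <= b * length mu.
  by case: f => f csf; have [b b0 hb] := length_bound csf; exists b.
have [b hb] := choice ex.
pose S := [set mu : C | length mu <= c].
pose K := [set p : prod_topology (fun _ : test_function R => R) |
  forall f, `[- (b f * c), b f * c]%classic (p f)].
have cK : compact K.
  exact: (@tychonoff _ (fun _ => R) (fun f => `[- (b f * c), b f * c]%classic)
    (fun f => @segment_compact R _ _)).
move=> F PF FS.
pose ev : C -> prod_topology (fun _ : test_function R => R) := @evaluation R (current_class G X).
have evK : S `<=` ev @^-1` K.
  move=> mu Smu f /=; rewrite in_itv /= -ler_norml; have [b0 h] := hb f.
  by apply: le_trans (h mu) _; apply: ler_wpM2l.
have [p [Kp clp]] := cK (ev @ F) _ (filterS evK FS).
have clD (D : set (prod_topology (fun _ : test_function R => R))) : closed D ->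
    S `<=` ev @^-1` D -> D p.
  move=> cD SD; apply: cD => B nB.
  exact: (clp D B (filterS SD FS) nB).
have cpr (f : test_function R) : continuous (fun q : prod_topology (fun _ : test_function R => R) => q f).
  exact: (@proj_continuous (test_function R) (fun _ => R) f).
have eq0 (h : prod_topology (fun _ : test_function R => R) -> R) : continuous h ->
    (forall mu, h (ev mu) = 0) -> h p = 0.
  move=> ch h0; apply: (clD [set q | h q = 0]); last by move=> mu _ /=.
  by apply: (continuous_comp_closed (D := [set 0 : R])) => //; exact: closed_eq.
have ge0 (h : prod_topology (fun _ : test_function R => R) -> R) : continuous h ->
    (forall mu, S mu -> 0 <= h (ev mu)) -> 0 <= h p.
  move=> ch h0; apply: (clD [set q | 0 <= h q]); last by move=> mu /h0.
  by apply: (continuous_comp_closed (D := [set x : R | 0 <= x])) => //; exact: closed_ge.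
pose L f := if pselect (cs f) is left csf then p (test csf) else 0.
have LE f (csf : cs f) : L f = p (test csf).
  by rewrite /L; case: pselect => // csf'; congr (p (test _)); exact: Prop_irrelevance.
have [Lam LamE] : exists Lam : positive_functional R, forall f, Lam f = L f.
  unshelve eexists; [exists L|by []].
  - move=> f g csf csg; rewrite (LE _ (csD csf csg)) (LE _ csf) (LE _ csg).
    apply/eqP; rewrite -subr_eq0; apply/eqP.
    apply: (eq0 (fun q => q (test (csD csf csg)) - (q (test csf) + q (test csg)))).
      by apply: continuousBR => //; exact: continuousDR.
    move=> mu; apply/eqP; rewrite subr_eq0; apply/eqP.
    exact: (functionalD (current_functional mu)).
  - move=> a f csf; rewrite (LE _ (csZ a csf)) (LE _ csf).
    apply/eqP; rewrite -subr_eq0; apply/eqP.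
    apply: (eq0 (fun q => q (test (csZ a csf)) - a * q (test csf))).
      by apply: continuousBR => //; apply: continuousMR => //; exact: continuous_cstR.
    move=> mu; apply/eqP; rewrite subr_eq0; apply/eqP.
    exact: (functionalZ (current_functional mu)).
  - move=> f csf f0; rewrite (LE _ csf); apply: (ge0 (fun q => q (test csf))) => // mu _.
    exact: (functional_ge0 (current_functional mu)).
have [||mu muE] := functional_current (G := G) Giso cX (L := Lam).
- move=> w f Gw csf; have csw := cs_act (Giso Gw) csf.
  rewrite !LamE (LE _ csw) (LE _ csf); apply/eqP; rewrite -subr_eq0; apply/eqP.
  apply: (eq0 (fun q => q (test csw) - q (test csf))); first exact: continuousBR.
  by move=> mu; apply/eqP; rewrite subr_eq0; apply/eqP; exact: (current_act Giso mu Gw csf).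
- move=> f csf f0; rewrite LamE (LE _ csf); apply: (eq0 (fun q => q (test csf))) => // mu.
  have z := functional0 (current_functional mu).
  have e1 : \int[mval mu]_A f A <= 0.
    by rewrite -[leRHS]z; apply: (current_le cX) => //; [exact: cs0|move=> A /f0 ->].
  have e2 : 0 <= \int[mval mu]_A f A.
    by rewrite -[leLHS]z; apply: (current_le cX) => //; [exact: cs0|move=> A /f0 ->].
  by apply: le_anti; rewrite [_ <= 0]e1.
have evp : ev mu = p.
  by apply/funext => -[f csf]; rewrite -[LHS]/(\int[mval mu]_A f A) muE // LamE (LE _ csf).
exists mu; split.
  rewrite /= /length muE ?LamE; last exact: cs_bump.
  rewrite (LE _ (cs_bump _)) -subr_ge0.
  apply: (ge0 (fun q => c - q (test (cs_bump _)))).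
    by apply: continuousBR => //; exact: continuous_cstR.
  by move=> nu Snu; rewrite subr_ge0.
(* Neighbourhoods of [mu] are pulled back by the evaluation from neighbourhoods of [p], so that a
   cluster point of the evaluations gives one of the currents. *)
move=> A B FA [_ [[B' oB' <-] B'mu] sB].
have nB' : nbhs p B' by rewrite -evp; exact: open_nbhs_nbhs.
have [_ [[nu Anu <-] B'nu]] := clp (ev @` A) B' (filterS (@preimage_image _ _ ev A) FA) nB'.
by exists nu; split=> //; exact: sB.
Qed.

End Compactness.

(** * Doubling currents *)

Section Esum.
Variables (R : realType) (I : choiceType).
Implicit Types (A S : set I) (a : I -> \bar R).

Lemma esum_finite_set A S a : (forall i, A i -> (0 <= a i)%E) -> S `<=` A ->
  (forall i, S i -> (1 <= a i)%E) -> (\esum_(i in A) a i < +oo)%E -> finite_set S.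
Proof.
move=> a0 SA a1 fin; apply: contrapT => /infinite_set_fsetP infS.
have ge n : (n%:R%:E <= \esum_(i in A) a i)%E.
  have [B BS nB] := infS n; apply: esum_ge; exists [set` B]; first by split=> // i /BS /SA.
  rewrite fsbig_finite //= set_fsetK; apply: (@le_trans _ _ (\sum_(i <- B) 1%:E)%E).
    by rewrite sumEFin big_const_seq count_predT iter_addr_0 lee_fin ler_nat.
  by rewrite big_seq [leRHS]big_seq; apply: lee_sum => i iB; apply: a1; exact: BS.
have e0 : (0 <= \esum_(i in A) a i)%E by exact: esum_ge0.
have /fineK E : (\esum_(i in A) a i)%E \is a fin_num by rewrite ge0_fin_numE.
have := ge (Num.truncn (fine (\esum_(i in A) a i)%E)).+1.
rewrite -E lee_fin => h.
by have := truncnS_gt (fine (\esum_(i in A) a i)%E); rewrite ltNge h.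
Qed.

Lemma esum_support A F a : finite_set F -> F `<=` A -> (forall i, A i -> (0 <= a i)%E) ->
  (forall i, A i -> ~ F i -> a i = 0%E) -> (\esum_(i in A) a i = \sum_(i \in F) a i)%E.
Proof.
move=> finF FA a0 z; rewrite (esumID F) // [X in (_ + X)%E]esum1; last by move=> i [Ai nF]; exact: z.
by rewrite adde0 setIidr // esum_fset // => i /set_mem Fi; apply/a0/FA.
Qed.

Lemma esum_measure (d : measure_display) (T : measurableType d) A (m : I -> {measure set T -> \bar R}) :
  exists nu : {measure set T -> \bar R}, forall E, nu E = (\esum_(i in A) m i E)%E.
Proof.
pose nu (E : set T) := (\esum_(i in A) m i E)%E.
have nu0 : nu set0 = 0%E by apply: esum1 => i _; rewrite measure0.
have nu_ge0 E : (0 <= nu E)%E by apply: esum_ge0 => i _.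
have nuS : semi_sigma_additive nu.
  move=> F mF tF mU.
  have -> : nu (\bigcup_n F n) = (\sum_(0 <= n <oo) nu (F n))%E.
    rewrite nneseries_esumT // /nu.
    transitivity (\esum_(i in A) \esum_(n in [set: nat]) m i (F n))%E.
      by apply: eq_esum => i _; rewrite measure_bigcup // nneseries_esum // set_mem_set.
    rewrite esum_esum ?esum_esum //.
    rewrite (@reindex_esum R _ _ (A `*`` fun=> [set: nat]) _ (fun p => (p.2, p.1))) //.
    split=> [[i n] [] //|[i n] [j k] _ _ [-> ->] //|[n i] [_ Ai]]; by exists (i, n).
  by apply: is_cvg_ereal_nneg_natsum => n _.
pose mix := isMeasure.Build d T R nu nu0 nu_ge0 nuS.
by exists (HB.pack_for {measure set T -> \bar R} nu mix).
Qed.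

End Esum.

Section Cosets.
Variables (R : realType) (K : set 'M[R]_3).
Hypotheses (Ksub : subgroup K) (Kiso : forall w, K w -> isometry w).
Implicit Types (w : 'M[R]_3) (S : set 'M[R]_3).

Lemma repr_lcoset w : exists2 k, K k & repr (lcoset w K) = w * k.
Proof.
have [K1 _ _] := Ksub.
have [k Kk <-] : lcoset w K (repr (lcoset w K)) by apply: xgetPex; exists (w * 1), 1.
by exists k.
Qed.

Lemma lcoset_mul w k : isometry w -> K k -> lcoset (w * k) K = lcoset w K.
Proof.
have [_ KM KV] := Ksub => iw Kk; apply/seteqP; split=> _ [k' Kk' <-].
  by exists (k * k'); [exact: KM|rewrite mulrA].
exists (k^-1 * k'); first by apply: KM => //; exact: KV.
by rewrite -mulrA (mulrA k) mulrV ?mul1r //; apply: isometry_unit; exact: Kiso.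
Qed.

Lemma lcoset_eq w w' : isometry w -> lcoset w K = lcoset w' K -> exists2 k, K k & w' = w * k.
Proof.
have [K1 _ _] := Ksub => iw e; have : lcoset w' K w' by exists 1 => //; rewrite mulr1.
by rewrite -e => -[k Kk <-]; exists k.
Qed.

Lemma lcosetsP S c : (forall w, S w -> isometry w) -> (forall w k, S w -> K k -> S (w * k)) ->
  lcosets S K c -> S (repr c) /\ lcoset (repr c) K = c.
Proof.
move=> iS SK [w Sw <-]; have [k Kk E] := repr_lcoset w; rewrite E.
by split; [exact: SK|apply: lcoset_mul => //; exact: iS].
Qed.

End Cosets.

(** * Validity of the doubling and discreteness of the reflection group *)

Section HatValidity.
Variables (R : realType) (O : orbifold R).
Implicit Types (w A B : 'M[R]_3).
Let X := cover O.
Notation T := 'M[R]_3.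
Notation BT := (borel T).
Notation bdry := (boundary_geodesic O).
Notation W := (reflection_group O).
Notation D := (dgrp O).

Lemma dgrp_isometry w : D w -> isometry w.
Proof. by move=> /dgrp_refl /refl_isometry. Qed.

Lemma scale_point t : 0 <= t -> scale t (point : dcurrents O) = point.
Proof.
move=> t0; apply: current_ext => E mE.
by rewrite (scale_spec (@closed_hyp R)) // /mval /= /mzero mule0.
Qed.

Lemma geodesic_norm A : geodesic A -> `|A| <= A ord_max ord_max.
Proof. by move=> gA; exact: isometry_norm (geodesic_isometry gA). Qed.

Lemma boundary_current : exists mu : currents O,
  forall E, measurable E -> mval mu E = (\esum_(B in bdry) \d_(B : BT) E)%E.
Proof.
have [nu nuE] := esum_measure bdry (fun B => \d_(B : BT) : {measure set BT -> \bar R}).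
have [mu [muE muN]] := exists_normal_measure (nu : borel_measure R T).
suff cmu : is_current (grp O) X mu by exists (exist _ mu cmu) => E mE; rewrite /mval /= muE // nuE.
have mX : measurable (geodesics_in X : set BT) by apply: measurable_geodesics_in; exact: cover_closed.
split; first split=> // K cK.
- have mK : measurable (K : set BT).
    by apply: closed_measurable_borel; exact: compact_closed (@norm_hausdorff _ _) cK.
  have [k Kk] := compact_nballP cK.
  have finF : finite_set [set B | bdry B /\ K B].
    apply: sub_finite_set (boundary_finite O k) => B [bB KB]; split=> //.
    by apply: le_trans (Kk _ KB); apply: le_trans (ler_norm _) _; exact: mx_entry_norm.
  rewrite muE // nuE (@esum_support _ _ bdry _ _ finF) //.
  + rewrite fsbig_finite //=; apply/lte_sum_pinfty => B _.
    by rewrite diracE ltry.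
  + by move=> B [].
  + by move=> B bB nB; rewrite /= diracE; case: (boolP (B \in K)) => // /set_mem KB; case: nB.
- rewrite muE ?nuE; last exact: measurableC.
  apply: esum1 => B [gB BX]; rewrite /= diracE; case: (boolP (B \in _)) => // /set_mem [].
  by split=> // x /BX [].
- move=> w E Gw mE; have iw := grp_isometry_of Gw.
  have mE' := measurable_act w mE.
  rewrite !muE // !nuE; rewrite [RHS](@reindex_esum _ _ _ bdry _ (act w)) //.
  split=> [B|B B' _ _ e|B bB]; first exact: boundary_act.
    by rewrite -(actK B iw) e actK.
  by exists (act w^-1 B); [apply: boundary_act => //; exact: grpV|exact: actVK].
Qed.

Variable Fbar : dcurrents O -> R.
Hypothesis Fhom : forall t nu, 0 < t -> Fbar (scale t nu) = t * Fbar nu.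
Hypothesis Fpos : positive_extension Fbar.

Lemma Fbar0 : Fbar point = 0.
Proof.
have := Fhom point (ltr0n _ 2); rewrite scale_point // => h; lra.
Qed.

Lemma hat_neq0 (mu : currents O) : mu <> point -> hat O (mval mu) <> point.
Proof. by move=> /Fpos; rewrite /on_currents => h e; move: h; rewrite e Fbar0 mul0r ltxx. Qed.

Lemma hatE (mu : currents O) E : measurable E ->
  mval (hat O (mval mu)) E = (iplus O (mval mu) E + iminus O (mval mu) E)%E.
Proof.
have [->|/eqP mu0] := eqVneq mu point.
  apply: (the_measureE (nu := point)) => E' _; rewrite /mval /= /mzero /iplus /iminus /translates.
  by rewrite !esum1 // adde0.
have := hat_neq0 mu0; rewrite {1}/hat /the_measure.
case: xgetP => [nu nuE h _ mE|_ //].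
by apply: (the_measureE (nu := nu) h).
Qed.

Variables (B0 : T) (bB0 : bdry B0).

Lemma refl_lcosetP S c : S `<=` W -> (forall w k, S w -> grp O k -> S (w * k)) ->
  lcosets S (grp O) c -> S (repr c) /\ lcoset (repr c) (grp O) = c.
Proof.
move=> SW Sk; apply: lcosetsP => //; first exact: grp_subgroup.
  exact: grp_isometry_of.
by move=> w /SW /refl_isometry.
Qed.

Lemma dgrp_grp w k : D w -> grp O k -> D (w * k).
Proof. by have [_ DM _] := dgrp_subgroup O => Dw /grp_dgrp; exact: DM. Qed.

Lemma refl_grp w k : W w -> grp O k -> W (w * k).
Proof. by move=> Ww /grp_refl; exact: reflM. Qed.

Lemma reflD_grp w k : (W `\` D) w -> grp O k -> (W `\` D) (w * k).
Proof.
move=> [Ww nD] Gk; split; first exact: refl_grp.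
have [_ DM DV] := dgrp_subgroup O => Dwk; apply: nD.
have -> : w = (w * k) * k^-1.
  by rewrite -mulrA mulrV ?mulr1 //; apply: isometry_unit; exact: grp_isometry_of Gk.
by apply: DM => //; apply: DV; exact: grp_dgrp.
Qed.

Lemma lcosets_split : lcosets W (grp O) = lcosets D (grp O) `|` lcosets (W `\` D) (grp O).
Proof.
apply/seteqP; split=> [c [w Ww <-]|c [] [w]]; last 2 first.
- by move=> /dgrp_refl Ww <-; exists w.
- by move=> [Ww _] <-; exists w.
by have [Dw|nD] := pselect (D w); [left|right]; exists w.
Qed.

(* The double of the counting measure on the boundary geodesics is a Radon
   measure, so that only finitely many walls meet a compact set. *)
Lemma boundary_coset_finite (k : R) : finite_set
  [set c | lcosets W (grp O) c /\ exists2 B, bdry B & `|act (repr c) B| <= k].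
Proof.
have [mu muE] := boundary_current.
have mk := @measurable_nball R k.
have fin := current_lf (hat O (mval mu)) k.
have key S : S `<=` W -> (forall w k, S w -> grp O k -> S (w * k)) -> (translates O S (mval mu) (nball k) < +oo)%E ->
    finite_set [set c | lcosets S (grp O) c /\ exists2 B, bdry B & `|act (repr c) B| <= k].
  move=> SW Sk; apply: esum_finite_set => // [c []//|c [Sc [B bB Bk]]].
  have [/SW /refl_isometry ir _] := refl_lcosetP SW Sk Sc.
  rewrite muE; last exact: measurable_act.
  rewrite (esumID [set B]) // ?setI1 ?mem_set // esum_set1 //= diracE mem_set //.
  by rewrite leeDl //; apply: esum_ge0.
rewrite lcosets_split; move: fin; rewrite hatE // => fin.
have e1 : (0 <= iplus O (mval mu) (nball k))%E by apply: esum_ge0.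
have e2 : (0 <= iminus O (mval mu) (nball k))%E by apply: esum_ge0.
have f1 : (iplus O (mval mu) (nball k) < +oo)%E by apply: le_lt_trans fin; rewrite leeDl.
have f2 : (iminus O (mval mu) (nball k) < +oo)%E by apply: le_lt_trans fin; rewrite leeDr.
have h1 := key _ (@dgrp_refl _ O) dgrp_grp f1.
have h2 := key _ (@subDsetl _ W D) reflD_grp f2.
apply: sub_finite_set (_ : _ `<=` _ `|` _) (_ : finite_set _); last first.
  by rewrite finite_setU; split; [exact: h1|exact: h2].
by move=> c [[cD|cD] h]; [left|right].
Qed.

(** By [act33], an element of size at most [c] moves [B0] to a wall of norm at most [k], which
    leaves finitely many cosets of [grp O]. Two such elements of the same coset differ by an element
    of [grp O] of size at most [2 * c * c], and [grp O] is discrete. *)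
Lemma refl_finite (c : R) : finite_set [set w | W w /\ w ord_max ord_max <= c].
Proof.
set k := 4 * c ^+ 2 * B0 ord_max ord_max.
have finF := boundary_coset_finite k.
apply: sub_finite_set (bigcup_finite finF (F := fun C => [set w | [/\ W w, C w & w ord_max ord_max <= c]]) _).
  move=> w [Ww wc]; exists (lcoset w (grp O)); last first.
    by split=> //; exists 1; rewrite ?mulr1 //; exact: grp1.
  split; first by exists w.
  have iw := refl_isometry Ww; have gB := boundary_geod bB0.
  have [g Gg rE] := repr_lcoset (grp_subgroup O) w; have ig := grp_isometry_of Gg.
  exists (act g^-1 B0); first by apply: boundary_act => //; exact: grpV.
  rewrite rE actM // ?actVK //.
  apply: le_trans (geodesic_norm (act_geodesic iw gB)) _.
  apply: le_trans (act33 iw gB) _; rewrite /k.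
  apply: ler_wpM2r; first by apply: le_trans ler01 _; apply: isometry_ge1; exact: geodesic_isometry.
  apply: ler_wpM2l => //; rewrite lerXn2r // nnegrE; apply: le_trans ler01 _; first exact: isometry_ge1.
  exact: le_trans (isometry_ge1 iw) wc.
move=> C FC; have [[w0 [Ww0 Cw0 w0c]]|no] := pselect (exists w0, [/\ W w0, C w0 & w0 ord_max ord_max <= c]); last first.
  by apply: (sub_finite_set (B := set0)) => // w h; case: no; exists w.
have iw0 := refl_isometry Ww0.
have finG : finite_set [set g | grp O g /\ g ord_max ord_max <= 2 * c * c].
  apply: sub_finite_set (grp_discrete O (2 * c * c)) => g [Gg gc]; split=> // i j.
  by apply: le_trans gc; exact: isometry_entries (grp_isometry_of Gg).
apply: sub_finite_set (finite_image (fun g => w0 * g) finG) => w [Ww Cw wc].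
have iw := refl_isometry Ww; exists (w0^-1 * w); last first.
  by rewrite /= mulrA mulrV ?mul1r //; exact: isometry_unit.
split.
  case: FC => -[w1 Ww1 EC] _; have iw1 := refl_isometry Ww1.
  move: Cw0 Cw; rewrite -EC => -[g0 Gg0 <-] [g Gg <-].
  have -> : (w1 * g0)^-1 * (w1 * g) = g0^-1 * g.
    rewrite invrM; [|exact: isometry_unit|exact: isometry_unit (grp_isometry_of Gg0)].
    by rewrite -mulrA (mulrA w1^-1) mulVr ?mul1r //; exact: isometry_unit.
  by apply: grpM => //; exact: grpV.
apply: le_trans (isometryM33 (isometryV iw0) iw) _; rewrite isometryV33 //.
have h1 := isometry_ge1 iw0; have h2 := isometry_ge1 iw; apply: ler_pM => //; nra.
Qed.

End HatValidity.

Section FiniteSums.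
Variable R : realType.
Notation T := 'M[R]_3.
Notation BT := (borel T).
Notation cs := (@compactly_supported R T).

Lemma measure_seq_sum (I : Type) (m : I -> gmeasure R) (s : seq I) :
  (forall i, locally_finite (m i)) ->
  exists nu : gmeasure R, [/\ locally_finite nu,
    forall E, nu E = (\sum_(i <- s) m i E)%E &
    forall f, cs f -> \int[nu]_x f x = \sum_(i <- s) \int[m i]_x f x].
Proof.
move=> lf; elim: s => [|i s [nu [lnu nuE nuI]]].
  exists mzero; split=> [k|E|f _]; rewrite ?big_nil //; first by rewrite /mzero ltry.
  by rewrite /Rintegral integral_measure_zero.
have addE (E : set BT) : measure_add (m i) nu E = (m i E + nu E)%E by exact: measure_addE.
exists (measure_add (m i) nu); split=> [k|E|f csf].
- by rewrite [X in (X < _)%E]addE lte_add_pinfty //; exact: lf.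
- by rewrite [LHS]addE nuE big_cons.
rewrite big_cons -nuI // /Rintegral integral_measure_add //; try exact: cs_integrable.
by rewrite fineD //; apply: integrable_fin_num => //; exact: cs_integrable.
Qed.

Lemma local_sum_integral (mu : gmeasure R) (I : Type) (m : I -> gmeasure R) (s : seq I) (k : R) (f : T -> R) :
  locally_finite mu -> (forall i, locally_finite (m i)) ->
  (forall E : set BT, measurable E -> E `<=` (nball k : set T) -> mu E = (\sum_(i <- s) m i E)%E) ->
  cs f -> (forall A, k < `|A| -> f A = 0) ->
  \int[mu]_x f x = \sum_(i <- s) \int[m i]_x f x.
Proof.
move=> lmu lf muE csf fk; have [nu [lnu nuE <- //]] := measure_seq_sum s lf.
have loc (m' : gmeasure R) : locally_finite m' -> \int[m']_x f x = \int[m']_(x in (nball k : set BT)) f x.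
  move=> lm; have mk := @measurable_nball R k.
  rewrite /Rintegral [in RHS]integral_mkcond; congr fine; apply: eq_integral => A _.
  rewrite patchE; case: ifPn => // /negP nA; rewrite fk // ltNge; apply/negP => h.
  by apply: nA; exact/mem_set.
rewrite loc // [RHS]loc // /Rintegral; congr fine; apply: eq_measure_integral => E mE Ek.
by rewrite nuE muE.
Qed.

End FiniteSums.

Lemma continuous_sumR (R : realType) (S : topologicalType) (I : eqType) (s : seq I) (f : I -> S -> R) :
  (forall i, i \in s -> continuous (f i)) -> continuous (fun x => \sum_(i <- s) f i x).
Proof.
elim: s => [|i s IH] cf.
  rewrite (_ : (fun _ => _) = fun=> 0); first exact: continuous_cstR.
  by apply/funext => x; rewrite big_nil.
rewrite (_ : (fun _ => _) = fun x => f i x + \sum_(j <- s) f j x); last by apply/funext => x; rewrite big_cons.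
apply: continuousDR; first by apply: cf; rewrite mem_head.
by apply: IH => j js; apply: cf; rewrite inE js orbT.
Qed.

(** * Doubles as locally finite sums over tiles *)

Section Tiles.
Variables (R : realType) (O : orbifold R).
Implicit Types (w A B : 'M[R]_3).
Let X := cover O.
Notation T := 'M[R]_3.
Notation BT := (borel T).
Notation cs := (@compactly_supported R T).
Notation bdry := (boundary_geodesic O).
Notation W := (reflection_group O).
Notation D := (dgrp O).
Hypothesis Wfin : forall c, finite_set [set w | W w /\ w ord_max ord_max <= c].

Lemma cover_height : exists c : R, forall x, X x -> exists2 w, grp O w & (w *m x) ord_max 0 <= c.
Proof.
have [K [cK _ KX]] := cover_cocompact O.
have [k [_ hk]] := compact_bounded cK.
exists (k + 1) => x /KX[w Gw Kw]; exists w => //.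
apply: le_trans (hk (k + 1) _ _ Kw); last by lra.
apply: le_trans (ler_norm _) _; rewrite [leRHS]/Num.norm /= mx_normrE.
by apply/bigmax_geP; right => /=; exists (ord_max, 0).
Qed.

(** When the element that brings [x] into the cover reverses the orientation, it is corrected by the
    reflection [B], at the cost of the factor [2 * B ord_max ord_max]. *)
Lemma dgrp_height : bdry !=set0 -> exists c : R, forall x, @hyp R x ->
  exists2 w, D w & (w *m x) ord_max 0 <= c.
Proof.
move=> [B bB]; have [c hc] := cover_height.
have iB := refl_isometry (boundary_refl bB); have B1 := isometry_ge1 iB.
exists (2 * B ord_max ord_max * c) => x hx.
have [w Ww Xw] := tile_cover Wfin hx; have [g Gg gc] := hc _ Xw.
have hgw : hyp (g *m (w *m x)).
  by apply: hyp_isometry; [exact: grp_isometry_of Gg|exact: cover_hyp Xw].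
have gp : 0 < (g *m (w *m x)) ord_max 0 by case: hgw.
have c0 := lt_le_trans gp gc.
have Wgw : W (g * w) by apply: reflM => //; exact: grp_refl.
have [Dgw|Dgw] := dgrp_or_boundary bB Wgw.
  exists (g * w) => //; rewrite mul_mxM; apply: le_trans gc _; rewrite ler_peMl //; lra.
exists (B * (g * w)) => //; rewrite !mul_mxM.
apply: le_trans (isometry_move33 iB hgw) _; rewrite ler_wpM2l //; lra.
Qed.

Definition tiles (k : R) : set (set T) :=
  [set c | lcosets W (grp O) c /\ exists2 A, geodesics_in X A & `|act (repr c) A| <= k].

Lemma tile_reprW c : lcosets W (grp O) c -> W (repr c).
Proof. by move=> /(refl_lcosetP (@subset_refl _ W) (@refl_grp _ O))[]. Qed.

Lemma tile_isometry c : lcosets W (grp O) c -> isometry (repr c).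
Proof. by move=> /tile_reprW /refl_isometry. Qed.

(** By [foot_ball] such a tile contains a point of height at most [(1 + k) / 2]. Moving the preimage
    of this point in the cover to height at most [c0] by [grp O] changes the representative within
    its coset, and [isometry_move] bounds the size of the new one. *)
Lemma finite_tiles (k : R) : finite_set (tiles k).
Proof.
have [c0 hc0] := cover_height.
apply: sub_finite_set (finite_image (fun w => lcoset w (grp O)) (Wfin (4 * c0 * ((1 + k) / 2)))).
move=> c [cW [A [gA AX] Ak]]; have [Wr rc] := refl_lcosetP (@subset_refl _ W) (@refl_grp _ O) cW.
have ir := refl_isometry Wr; set r := repr c in Ak Wr rc ir.
have A33 : (act r A) ord_max ord_max <= k.
  by apply: le_trans Ak; apply: le_trans (ler_norm _) _; exact: mx_entry_norm.
have [x px xk] := foot_ball (act_geodesic ir gA) A33.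
have Xy : X (r^-1 *m x) by apply: AX; apply/points_actV.
have hx : hyp x by case: px.
have [g Gg gc] := hc0 _ Xy; have ig := grp_isometry_of Gg.
exists (r * g^-1); last by rewrite lcoset_mul //; [exact: grp_subgroup|exact: grp_isometry_of|exact: grpV].
split; first by apply: refl_grp => //; exact: grpV.
set y := g *m _ in gc; have hy : hyp y by apply: hyp_isometry => //; exact: cover_hyp Xy.
have yx : (r * g^-1) *m y = x by rewrite mul_mxM isometryK // isometryKV.
have irg : isometry (r * g^-1) by apply: isometryM => //; exact: isometryV.
apply: le_trans (isometry_move irg hy hx) _; rewrite yx.
have [-> x0] := hx; have [_ y0] := hy.
rewrite opprK mulr1 -!mulrA ler_pM2l // ler_pM //; exact: ltW.
Qed.

Hypothesis hatE : forall (mu : currents O) E, measurable E ->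
  mval (hat O (mval mu)) E = (iplus O (mval mu) E + iminus O (mval mu) E)%E.

Lemma hat_coset_sum (mu : currents O) E : measurable E ->
  mval (hat O (mval mu)) E = (\esum_(c in lcosets W (grp O)) mval mu (act (repr c) @^-1` E))%E.
Proof.
move=> mE; rewrite hatE // /iplus /iminus /translates lcosets_split.
rewrite [RHS](esumID (lcosets D (grp O))) //; congr (_ + _)%E; congr esum.
  by rewrite setIUl setIid setUidl //; apply: subIsetr.
rewrite setIUl setICr set0U setIidl // => c cW cD.
have [[_ nD] _] := refl_lcosetP (@subDsetl _ W D) (@reflD_grp _ O) cW.
by have [] := refl_lcosetP (@dgrp_refl _ O) (@dgrp_grp _ O) cD.
Qed.

(* Only the finitely many tiles met by the geodesics in the support of f contribute. *)
Lemma hat_integral (mu : currents O) f k : cs f -> (forall A, k < `|A| -> f A = 0) ->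
  \int[mval (hat O (mval mu))]_A f A =
  \sum_(c <- fset_set (tiles k)) \int[mval mu]_A f (act (repr c) A).
Proof.
move=> csf fk; have finF := finite_tiles k.
have [_ muX _] := currentP mu; have lmu := current_lf mu.
have mX : measurable (geodesics_in X : set BT) by apply: measurable_geodesics_in; exact: cover_closed.
pose w c := if pselect (tiles k c) then repr c else 1.
have iw c : isometry (w c).
  by rewrite /w; case: pselect => [[cW ?]|?]; [exact: tile_isometry|exact: isometry1].
have [m hm] := choice (fun c => image_measure (mval mu) (@continuous_act R (w c))).
have lm c : locally_finite (m c).
  by move=> j; have [-> _] := hm c; exact: locally_finite_act.
rewrite (local_sum_integral (m := m) (s := fset_set (tiles k)) (k := k) (current_lf _) lm) //.
  rewrite big_seq [RHS]big_seq; apply: eq_bigr => c; rewrite in_fset_set // => /set_mem tc.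
  have [_ ->] := hm c; first by rewrite /w; case: pselect.
    by apply: continuous_measurable_borel; case: csf.
  by apply: cs_integrable => //; exact: cs_act.
move=> E mE Ek; rewrite hat_coset_sum // (esum_support finF) //.
- rewrite fsbig_finite //= big_seq [RHS]big_seq; apply: eq_bigr => c.
  rewrite in_fset_set // => /set_mem tc; have [-> _] := hm c.
  by rewrite /w; case: pselect.
- by move=> c [].
- move=> c cW nc; apply: (subset_measure0 (B := ~` geodesics_in X : set BT)) => //.
  + exact: measurable_act.
  + exact: measurableC.
  + by move=> A EA gA; apply: nc; split=> //; exists A => //; exact: Ek.
Qed.

Lemma hat_continuous : continuous (fun mu : currents O => hat O (mval mu)).
Proof.
apply: continuous_to_mspace => f csf; have [cf [k fk]] := (csP f).1 csf.
rewrite (_ : (fun _ => _) = (fun mu : currents O => \sum_(c <- fset_set (tiles k)) \int[mval mu]_A f (act (repr c) A))); last first.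
  by apply/funext => mu; exact: hat_integral.
apply: continuous_sumR => c; rewrite in_fset_set; last exact: finite_tiles.
move=> /set_mem[cW _]; have := @continuous_pairing R (current_class (grp O) X) (f \o act (repr c)); apply.
by apply: cs_act => //; exact: tile_isometry.
Qed.

End Tiles.

(** * Geodesics crossing no wall *)

Section NoCrossing.
Variables (R : realType) (O : orbifold R).
Implicit Types (w A B : 'M[R]_3) (u v n z : 'cV[R]_3).
Let X := cover O.
Notation T := 'M[R]_3.
Notation BT := (borel T).
Notation cs := (@compactly_supported R T).
Notation bdry := (boundary_geodesic O).
Notation W := (reflection_group O).
Hypothesis Wfin : forall c, finite_set [set w | W w /\ w ord_max ord_max <= c].

(** At the common point [z] the vectors [n] and [e] form an orthonormal basis of the complement of
    [z], so that [(n.u)^2 + (e.u)^2 = 1]; the assumption makes the second term vanish. *)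
Lemma meet_reflection u n z : mdot u u = 1 -> mdot n n = 1 -> hyp z ->
  mdot u z = 0 -> mdot n z = 0 -> 1 <= mdot n u ^+ 2 -> reflection u = reflection n.
Proof.
move=> uu nn [zz _] uz nz nu; have [e [ee ez en]] := tangent nn zz nz.
have uE := orthonormal_basis nn ee zz (etrans (mdotC _ _) en) nz ez u.
rewrite (mdotC z) uz scale0r subr0 in uE.
have := uu; rewrite {1}uE mdotDl !mdotZl => h.
have e0 : mdot e u = 0 by apply/eqP; rewrite -sqrf_eq0; apply/eqP; nra.
rewrite e0 scale0r addr0 in uE; rewrite e0 mul0r addr0 in h.
have [h1|h1] : mdot n u = 1 \/ mdot n u = -1.
  have /eqP : (mdot n u - 1) * (mdot n u + 1) = 0 by nra.
  by rewrite mulf_eq0 => /orP[] /eqP h'; [left|right]; lra.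
- by rewrite uE h1 scale1r.
- by rewrite uE h1 scaleN1r reflectionN.
Qed.

(** For [A = reflection n] the quantity is [1 - 2 (n.v)^2], and [|n.v| >= 1] means that the
    geodesics coincide or do not meet. Expressed through [A] it is a closed condition that ignores
    the sign of [n]. *)
Definition uncrossed A := geodesic A /\
  forall v, mdot v v = 1 -> wall O (reflection v) -> mdot v (A *m v) <= -1.

Lemma mdot_self_reflection n v : mdot v v = 1 -> mdot v (reflection n *m v) = 1 - 2 * mdot n v ^+ 2.
Proof. by move=> vv; rewrite reflectionE mdotBr vv mdotZr (mdotC v n); ring. Qed.

Lemma uncrossed_act w A : W w -> uncrossed A -> uncrossed (act w A).
Proof.
move=> Ww [gA h]; have iw := refl_isometry Ww; split=> [|v vv wv]; first exact: act_geodesic.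
have iV := isometryV iw; have := h (w^-1 *m v).
rewrite isometry_mdot // -act_reflection // => /(_ vv (wall_act (reflV Ww) wv)).
by rewrite mdotC -(isometry_mdot _ _ iw) isometryKV // mdotC /act !mul_mxM.
Qed.

(** A tile that contains one point of [A] contains all of it: to leave the tile from an interior
    point, [A] would have to cross a boundary geodesic, and at a frontier point it can only be the
    boundary geodesic itself. *)
Lemma uncrossed_tile A : uncrossed A -> exists2 w, W w & geodesics_in X (act w A).
Proof.
move=> uA; have [x [[hx Ax] _]] := geodesic_foot (proj1 uA).
have [w Ww Xw] := tile_cover Wfin hx; exists w => //; have iw := refl_isometry Ww.
have [gB hB] := uncrossed_act Ww uA; split=> //.
have pB : points (act w A) (w *m x) by apply/points_act.
have [n nn nE] := gB; rewrite nE in hB pB *; set y0 := w *m x in Xw pB.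
have [hy0 ny0] := (points_reflection nn y0).1 pB.
have cross v : mdot v v = 1 -> wall O (reflection v) -> 1 <= mdot n v ^+ 2.
  by move=> vv wv; have := hB _ vv wv; rewrite mdot_self_reflection //; lra.
have [iy0|niy0] := pselect (inner X y0); last first.
  have [C [gC Cy0 CX]] := cover_frontier Xw niy0.
  have bC : bdry C by split.
  have [u uu uE] := gC; rewrite uE in bC Cy0 CX.
  have [_ uy0] := (points_reflection uu y0).1 Cy0.
  have <- := meet_reflection uu nn hy0 uy0 ny0 (cross u uu (boundary_wall bC)).
  by move=> y /CX[].
move=> y /(points_reflection nn)[hy ny]; apply: contrapT => nXy.
have [C [u [bC [uu CE _ ui] uy]]] := exit_boundary iy0 hy nXy.
have uy0 := ui _ iy0.
have [p1 p2 p3] : [/\ 0 <= mdot u y, 0 <= - mdot u y0 & 0 < mdot u y - mdot u y0] by split; lra.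
have [z0 zpos] := hyp_sum hy0 hy p1 p2 p3; set z := _ + _ in z0 zpos; have hz := hyp_normalize z0 zpos.
have uz : mdot u (normalize z) = 0 by rewrite /normalize mdotZr [mdot u z](_ : _ = 0) ?mulr0 // /z mdotDr !mdotZr; ring.
have nz : mdot n (normalize z) = 0 by rewrite /normalize mdotZr [mdot n z](_ : _ = 0) ?mulr0 // /z mdotDr !mdotZr ny0 ny; ring.
have wC : wall O (reflection u) by rewrite -CE; exact: boundary_wall.
have /reflection_inj := meet_reflection uu nn hz uz nz (cross u uu wC).
by move=> /(_ uu nn)[] uE; move: uy; rewrite uE ?mdotNl ny; lra.
Qed.

(** Among geodesics, positive exactly on those of norm below [k] that cross the wall of [v] at an
    angle bounded below in terms of [e]; all crossings are exhausted as [e] tends to 0 and [k] to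
    infinity. *)
Definition transversal v (e k : R) (A : T) : R := Num.max 0 (mdot v (A *m v) + 1 - e) * bump k A.

Lemma continuous_angle v : continuous (fun A : T => mdot v (A *m v)).
Proof.
move=> A; apply: (@continuous_comp _ _ _ (fun A : T => A *m v) (mdot v)); first exact: continuous_mulmxr.
exact: continuous_mdot.
Qed.

Lemma cs_transversal v e k : cs (transversal v e k).
Proof.
have -> : transversal v e k = (fun A => bump k A * Num.max 0 (mdot v (A *m v) + 1 - e)).
  by apply/funext => A; rewrite /transversal mulrC.
apply: csMl; first exact: cs_bump.
apply: continuous_maxR; first exact: continuous_cstR.
apply: continuousBR; last exact: continuous_cstR.
apply: continuousDR; [exact: continuous_angle|exact: continuous_cstR].
Qed.

Lemma transversal_ge0 v e k A : 0 <= transversal v e k A.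
Proof. by rewrite mulr_ge0 ?bump_ge0 // le_max lexx. Qed.

Lemma null_crossing (mu : gmeasure R) v : locally_finite mu ->
  (forall e k, 0 < e -> \int[mu]_A transversal v e k A = 0) ->
  mu.-negligible ([set A | -1 < mdot v (A *m v)] : set BT).
Proof.
move=> lmu h.
have neg (n : nat) : mu.-negligible ([set A | 0 < transversal v n.+1%:R^-1 n%:R A] : set BT).
  have cst := cs_transversal v n.+1%:R^-1 n%:R.
  have e0 : (\int[mu]_A `|(transversal v n.+1%:R^-1 n%:R A)%:E| = 0)%E.
    transitivity (\int[mu]_A (transversal v n.+1%:R^-1 n%:R A)%:E)%E.
      by apply: eq_integral => A _; rewrite gee0_abs // lee_fin transversal_ge0.
    by rewrite integral_cs // h // invr_gt0.
  have mt : measurable_fun setT (EFin \o (transversal v n.+1%:R^-1 n%:R : BT -> R)).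
    by apply/measurable_EFinP; apply: continuous_measurable_borel; case: cst.
  have := (ae_eq_integral_abs mu measurableT mt).1 e0.
  apply: negligibleS => A /= A0 /(_ I) [] A1; rewrite A1 ltxx in A0.
  by [].
apply: negligibleS (negligible_bigcup neg) => A /= hA.
pose a := mdot v (A *m v) + 1; have a0 : 0 < a by rewrite /a; lra.
pose n := (Num.truncn (`|A| + a^-1)).+1; exists n => //=.
have ngt : `|A| + a^-1 < n%:R by exact: truncnS_gt.
have ai : 0 < a^-1 by rewrite invr_gt0.
have nA := normr_ge0 A.
rewrite /transversal mulr_gt0 //; last by rewrite bump_gt0; lra.
rewrite lt_max; apply/orP; right; rewrite subr_gt0 -/a.
rewrite -[ltRHS]invrK ltf_pV2 ?posrE // -natr1; lra.
Qed.

Lemma closed_uncrossed : closed uncrossed.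
Proof.
have -> : uncrossed = @geodesic R `&` \bigcap_(v in [set v | mdot v v = 1 /\ wall O (reflection v)])
    [set A | mdot v (A *m v) <= -1].
  apply/seteqP; split=> [A [gA h]|A [gA h]]; split=> // v; first by move=> [vv wv]; exact: h.
  by move=> vv wv; exact: h.
apply: closedI; first exact: closed_geodesic.
apply: closed_bigI => v _.
by apply: (continuous_comp_closed (D := [set x : R | x <= -1])); [exact: continuous_angle|exact: closed_le].
Qed.

Lemma countable_walls : countable (wall O).
Proof.
have -> : wall O = \bigcup_n [set V | wall O V /\ V ord_max ord_max <= n%:R].
  apply/seteqP; split=> [V wV|V [n _ []] //].
  exists (Num.truncn (V ord_max ord_max)).+1 => //; split=> //.
  by apply: ltW; exact: truncnS_gt.
apply: bigcup_countable => // n _; apply: finite_set_countable.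
by apply: sub_finite_set (Wfin n%:R) => V [wV h]; split=> //; exact: wall_refl.
Qed.

(** There are countably many walls, and each is crossed by a null set of geodesics only. *)
Lemma uncrossed_full (nu : dcurrents O) :
  (forall v e k, mdot v v = 1 -> wall O (reflection v) -> 0 < e ->
     \int[mval nu]_A transversal v e k A = 0) ->
  mval nu (~` uncrossed : set BT) = 0%E.
Proof.
move=> h; have lmu := current_lf nu; have [_ nuX _] := currentP nu.
have [i iinj] := countable_injP _ countable_walls.
have mY : measurable (~` uncrossed : set BT).
  by apply: open_measurable_borel; apply: closed_openC; exact: closed_uncrossed.
apply/negligibleP => //.
pose F (k : nat) : set BT := [set A | exists v, [/\ mdot v v = 1, wall O (reflection v),
  i (reflection v) = k & -1 < mdot v (A *m v)]].
have Fneg k : (mval nu).-negligible (F k).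
  have [[v [vv wv vk]]|no] := pselect (exists v, [/\ mdot v v = 1, wall O (reflection v) & i (reflection v) = k]).
    apply: negligibleS (null_crossing lmu (fun e j => h v e j vv wv)) => A [v' [vv' wv' vk' cA]].
    have /reflection_inj : reflection v' = reflection v.
      by apply: iinj; [exact/mem_set|exact/mem_set|rewrite vk].
    move=> /(_ vv' vv)[] E; first by rewrite /= -E.
    by move: cA; rewrite /= E mulmxN mdotNl mdotNr opprK.
  by apply: negligibleS (negligible_set0 _) => A [v [vv wv vk _]]; case: no; exists v.
have Xneg : (mval nu).-negligible (~` geodesics_in (@hyp R) : set BT).
  by apply/negligibleP => //; apply: measurableC; apply: measurable_geodesics_in; exact: closed_hyp.
apply: negligibleS (negligibleU Xneg (negligible_bigcup Fneg)) => A nA.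
have [gA|ngA] := pselect (geodesic A); last by left=> -[].
right; apply: contrapT => nF; apply: nA; split=> // v vv wv.
rewrite leNgt; apply/negP => cA; apply: nF; exists (i (reflection v)) => //.
by exists v.
Qed.

End NoCrossing.

(** * Reflection invariant currents without crossings are doubles *)

Section Reindex.
Variables (R : realType) (K S : set 'M[R]_3).
Hypotheses (Ksub : subgroup K) (Kiso : forall w, K w -> isometry w).
Hypotheses (Siso : forall w, S w -> isometry w) (SK : forall a k, S a -> K k -> S (a * k)).

(** The maps [p] and [q] are inverse bijections of [S] that descend to cosets. The representative
    chosen by [repr] in an image coset differs from the image of the representative by an element of
    [K], which [phi] ignores. The lemma serves for left translations and, with doubled arcs, for the
    map [x |-> w * x * A]. *)
Lemma esum_lcosets_reindex (p q : 'M[R]_3 -> 'M[R]_3) (phi : 'M[R]_3 -> \bar R) :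
  (forall a k, S a -> K k -> phi (a * k) = phi a) ->
  (forall a, S a -> S (p a)) -> (forall a, S a -> S (q a)) ->
  (forall a, S a -> q (p a) = a) -> (forall a, S a -> p (q a) = a) ->
  (forall a k, S a -> K k -> exists2 k', K k' & p (a * k) = p a * k') ->
  (forall a k, S a -> K k -> exists2 k', K k' & q (a * k) = q a * k') ->
  (\esum_(c in lcosets S K) phi (p (repr c)) = \esum_(c in lcosets S K) phi (repr c))%E.
Proof.
move=> phiK pS qS qp pq pK qK.
have rP c : lcosets S K c -> S (repr c) /\ lcoset (repr c) K = c by exact: lcosetsP.
rewrite [RHS](@reindex_esum _ _ _ (lcosets S K) _ (fun c => lcoset (p (repr c)) K)).
  apply: eq_esum => c cS; have [Sr _] := rP _ cS.
  by have [k Kk ->] := repr_lcoset Ksub (p (repr c)); rewrite phiK //; exact: pS.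
split=> [c /rP[Sr _]|c c' /set_mem cS /set_mem c'S e|_ [a Sa <-]].
- by exists (p (repr c)) => //; exact: pS.
- have [Sr <-] := rP _ cS; have [Sr' <-] := rP _ c'S.
  have [k Kk pE] := lcoset_eq Ksub (Siso (pS _ Sr)) e.
  have [k' Kk' qE] := qK _ _ (pS _ Sr) Kk.
  have -> : repr c' = repr c * k' by rewrite -(qp _ Sr') pE qE qp.
  by rewrite lcoset_mul //; exact: Siso.
- exists (lcoset (q a) K); first by exists (q a) => //; exact: qS.
  have [k Kk ->] := repr_lcoset Ksub (q a).
  have [k' Kk' ->] := pK _ _ (qS _ Sa) Kk.
  by rewrite pq // lcoset_mul //; exact: Siso.
Qed.

End Reindex.

Lemma Rintegral_seq_sum (R : realType) (d : measure_display) (T : measurableType d)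
    (mu : {measure set T -> \bar R}) (I : eqType) (s : seq I) (h : I -> T -> R) :
  (forall i, i \in s -> mu.-integrable setT (EFin \o h i)) ->
  mu.-integrable setT (EFin \o (fun x => \sum_(i <- s) h i x)) /\
  \int[mu]_x (\sum_(i <- s) h i x) = \sum_(i <- s) \int[mu]_x h i x.
Proof.
elim: s => [|i s IH] hi.
  have -> : (fun x => \sum_(i <- [::]) h i x) = cst 0 by apply/funext => x; rewrite big_nil.
  rewrite big_nil; split; first exact: integrable0.
  by rewrite /Rintegral integral0.
have [|iI IE] := IH; first by move=> j js; apply: hi; rewrite inE js orbT.
have ii := hi i (mem_head _ _).
have -> : (fun x => \sum_(j <- i :: s) h j x) = (fun x => h i x + \sum_(j <- s) h j x).
  by apply/funext => x; rewrite big_cons.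
rewrite big_cons -IE; split; last exact: RintegralD.
by rewrite (_ : _ \o _ = (EFin \o h i) \+ (EFin \o (fun x => \sum_(j <- s) h j x))) //; exact: integrableD.
Qed.

Section Surjectivity.
Variables (R : realType) (O : orbifold R).
Implicit Types (w A B : 'M[R]_3) (u v z : 'cV[R]_3).
Let X := cover O.
Notation T := 'M[R]_3.
Notation BT := (borel T).
Notation cs := (@compactly_supported R T).
Notation bdry := (boundary_geodesic O).
Notation W := (reflection_group O).
Notation D := (dgrp O).
Hypothesis Wfin : forall c, finite_set [set w | W w /\ w ord_max ord_max <= c].
Hypothesis hatE : forall (mu : currents O) E, measurable E ->
  mval (hat O (mval mu)) E = (iplus O (mval mu) E + iminus O (mval mu) E)%E.

Definition in_cover A : R := \1_(geodesics_in X) A.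

Lemma in_cover_grp g A : grp O g -> in_cover (act g A) = in_cover A.
Proof.
move=> Gg; have key g' B : grp O g' -> geodesics_in X B -> geodesics_in X (act g' B).
  move=> Gg' [gB BX]; have ig' := grp_isometry_of Gg'; split; first exact: act_geodesic.
  move=> x /(points_actV _ _ ig')/BX Xx; rewrite -(isometryKV x ig'); exact: cover_invariant.
have ig := grp_isometry_of Gg.
rewrite /in_cover !indicE; congr (nat_of_bool _)%:R; apply/idP/idP => /set_mem h; apply/mem_set.
  by rewrite -(actK A ig); apply: key => //; exact: grpV.
exact: key.
Qed.

Lemma in_cover01 A : in_cover A = 0 \/ in_cover A = 1.
Proof. by rewrite /in_cover indicE; case: (_ \in _); [right|left]. Qed.

Lemma in_cover_ge0 A : 0 <= in_cover A.
Proof. by case: (in_cover01 A) => ->. Qed.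

Definition multiplicity A : R :=
  fine (\esum_(c in lcosets W (grp O)) (in_cover (act (repr c)^-1 A))%:E)%E.

Lemma in_cover_reprV w k A : W w -> grp O k ->
  in_cover (act (w * k)^-1 A) = in_cover (act w^-1 A).
Proof.
move=> Ww Gk; have iw := refl_isometry Ww; have ik := grp_isometry_of Gk.
rewrite invrM; [|exact: isometry_unit|exact: isometry_unit].
by rewrite actM; [apply: in_cover_grp; exact: grpV|exact: isometryV|exact: isometryV].
Qed.

Lemma multiplicity_act w A : W w -> multiplicity (act w A) = multiplicity A.
Proof.
move=> Ww; have iw := refl_isometry Ww; have uw := isometry_unit iw; congr fine.
rewrite -[RHS](@esum_lcosets_reindex R (grp O) W _ _ _ _ (fun a => w^-1 * a) (fun a => w * a)
  (fun a => (in_cover (act a^-1 A))%:E)) //.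
- apply: eq_esum => c cW; have ir := tile_isometry cW.
  by rewrite invrM ?unitrV ?isometry_unit // invrK actM //; exact: isometryV.
- exact: grp_subgroup.
- exact: grp_isometry_of.
- exact: refl_isometry.
- exact: refl_grp.
- by move=> a k Wa Gk; rewrite in_cover_reprV.
- by move=> a; apply: reflM; exact: reflV.
- by move=> a; exact: reflM.
- by move=> a _; rewrite mulrA mulrV // mul1r.
- by move=> a _; rewrite mulrA mulVr // mul1r.
- by move=> a k _ Gk; exists k => //; rewrite mulrA.
- by move=> a k _ Gk; exists k => //; rewrite mulrA.
Qed.

Lemma multiplicityE A (k : R) : `|A| <= k ->
  multiplicity A = \sum_(c <- fset_set (tiles O k)) in_cover (act (repr c)^-1 A).
Proof.
move=> Ak; have finF := finite_tiles Wfin k; rewrite /multiplicity (esum_support finF).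
- by rewrite fsbig_finite //= sumEFin.
- by move=> c [].
- by move=> c _; rewrite lee_fin in_cover_ge0.
- move=> c cW nc; rewrite /in_cover indicE; case: (boolP (_ \in _)) => // /set_mem h.
  by case: nc; split=> //; exists (act (repr c)^-1 A) => //; rewrite actVK //; exact: tile_isometry cW.
Qed.

(** A geodesic on the frontier belongs to several tiles; dividing by the number of tiles containing
    it makes the translates of the weight sum to 1 on every uncrossed geodesic. *)
Definition tile_weight A : R := in_cover A / multiplicity A.

Lemma tile_weight_grp g A : grp O g -> tile_weight (act g A) = tile_weight A.
Proof. by move=> Gg; rewrite /tile_weight in_cover_grp // multiplicity_act //; exact: grp_refl. Qed.

Lemma multiplicity_ge0 A : 0 <= multiplicity A.
Proof. by apply: fine_ge0; apply: esum_ge0 => c _; rewrite lee_fin in_cover_ge0. Qed.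

Lemma multiplicity_ge1 A w : W w -> geodesics_in X (act w A) -> 1 <= multiplicity A.
Proof.
move=> Ww h; rewrite (multiplicityE (lexx `|A|)).
have iw := refl_isometry Ww; have iV := isometryV iw.
pose c := lcoset w^-1 (grp O).
have cW : lcosets W (grp O) c by exists w^-1 => //; exact: reflV.
have hc : in_cover (act (repr c)^-1 A) = 1.
  have [g Gg ->] := repr_lcoset (grp_subgroup O) w^-1.
  rewrite in_cover_reprV //; last exact: reflV.
  by rewrite invrK /in_cover indicE mem_set.
have cF : c \in fset_set (tiles O `|A|).
  rewrite in_fset_set; last exact: finite_tiles.
  apply/mem_set; split=> //; exists (act (repr c)^-1 A).
    by move: hc; rewrite /in_cover indicE; case: (boolP (_ \in _)) => [/set_mem //|_ /= /eqP]; rewrite eq_sym oner_eq0.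
  by rewrite actVK //; exact: tile_isometry cW.
rewrite (big_rem c) //= hc lerDl; apply: sumr_ge0 => c' _; exact: in_cover_ge0.
Qed.

Lemma tile_weight_ge0 A : 0 <= tile_weight A.
Proof. by rewrite divr_ge0 ?in_cover_ge0 ?multiplicity_ge0. Qed.

Lemma tile_weight_le1 A : tile_weight A <= 1.
Proof.
rewrite /tile_weight /in_cover indicE; case: (boolP (_ \in _)) => [/set_mem h|_]; last by rewrite mul0r.
have n1 : 1 <= multiplicity A by apply: (multiplicity_ge1 (@refl1 R O)); rewrite act1.
by rewrite mul1r invf_le1 // (lt_le_trans ltr01).
Qed.

Lemma tile_weight_sum A k : uncrossed O A -> `|A| <= k ->
  \sum_(c <- fset_set (tiles O k)) tile_weight (act (repr c)^-1 A) = 1.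
Proof.
move=> /(uncrossed_tile Wfin)[w Ww h] Ak; have n1 := multiplicity_ge1 Ww h.
transitivity (\sum_(c <- fset_set (tiles O k)) in_cover (act (repr c)^-1 A) / multiplicity A).
  rewrite big_seq [RHS]big_seq; apply: eq_bigr => c; rewrite in_fset_set; last exact: finite_tiles.
  move=> /set_mem[cW _]; rewrite /tile_weight multiplicity_act //; apply: reflV; exact: tile_reprW.
rewrite -mulr_suml -multiplicityE // divff //; apply/eqP => n0; rewrite n0 in n1; lra.
Qed.

Lemma measurable_tile_weight f : cs f -> measurable_fun setT (fun A : BT => f A * tile_weight A).
Proof.
move=> csf; have [cf [k fk]] := (csP f).1 csf.
pose n A := \sum_(c <- fset_set (tiles O k)) in_cover (act (repr c)^-1 A).
(* On the ball carrying [f] the multiplicity is a finite sum, and its inverse is rewritten as a real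
   power so that [measurable_powR] applies. *)
have -> : (fun A => f A * tile_weight A) = (fun A => f A * (in_cover A * n A `^ (-1))).
  apply/funext => A; have [Ak|kA] := leP `|A| k; last by rewrite fk // !mul0r.
  rewrite /tile_weight (multiplicityE Ak) powR_inv1 //.
  by apply: sumr_ge0 => c _; exact: in_cover_ge0.
have mX : measurable_fun setT (in_cover : BT -> R).
  by apply: measurable_indic; apply: measurable_geodesics_in; exact: cover_closed.
apply: measurable_funM; first exact: continuous_measurable_borel.
apply: measurable_funM => //.
apply: (measurableT_comp (measurable_powR _)); apply: measurable_sum => c.
apply: (measurableT_comp (f := in_cover : BT -> R)) => //.
exact: continuous_measurable_map (@continuous_act R _).
Qed.

Lemma integrable_tile_weight (nu : gmeasure R) f : locally_finite nu -> cs f ->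
  nu.-integrable setT (EFin \o (fun A : BT => f A * tile_weight A)).
Proof.
move=> lnu csf; have [cf [k fk]] := (csP f).1 csf; have [M M0 fM] := cs_bounded csf.
apply: (bounded_integrable (k := k) (M := M)) => //; first exact: measurable_tile_weight.
  move=> A; rewrite normrM (ger0_norm (tile_weight_ge0 A)); apply: le_trans (fM A).
  by rewrite ler_piMr // tile_weight_le1.
by move=> A kA; rewrite fk // mul0r.
Qed.

(** The current of [O] is [nu] weighted by [tile_weight]. By invariance, its translate to a tile is
    [nu] with the translated weight, and these weights add up to 1 on uncrossed geodesics, which
    carry [nu]. *)
Lemma hat_surjective (nu : dcurrents O) :
  (forall w f, W w -> cs f -> \int[mval nu]_A f (act w A) = \int[mval nu]_A f A) ->
  (forall v e k, mdot v v = 1 -> wall O (reflection v) -> 0 < e ->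
     \int[mval nu]_A transversal v e k A = 0) ->
  exists mu : currents O, nu = hat O (mval mu).
Proof.
move=> inv tr; have lnu := current_lf nu.
have full := uncrossed_full Wfin tr.
have mU : measurable (uncrossed O : set BT) by apply: closed_measurable_borel; exact: closed_uncrossed.
have int f := @integrable_tile_weight (mval nu) f lnu.
have [L LE] : exists L : positive_functional R, forall f, L f = \int[mval nu]_A (f A * tile_weight A).
  unshelve eexists; [exists (fun f => \int[mval nu]_A (f A * tile_weight A))|by []].
  - move=> f g csf csg; rewrite -RintegralD //; try exact: int.
    by congr fine; apply: eq_integral => A _; rewrite mulrDl.
  - move=> a f csf; rewrite -RintegralZl //; last exact: int.
    by congr fine; apply: eq_integral => A _; rewrite mulrA.
  - by move=> f csf f0; apply: Rintegral_ge0 => A _; rewrite mulr_ge0 // tile_weight_ge0.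
have intw w f : W w -> cs f ->
    (mval nu).-integrable setT (EFin \o (fun A : BT => f A * tile_weight (act w^-1 A))).
  move=> Ww csf; have iw := refl_isometry Ww; have iV := isometryV iw.
  have [cf [k fk]] := (csP f).1 csf; have [M M0 fM] := cs_bounded csf.
  apply: (bounded_integrable (k := k) (M := M)) => //.
  - have -> : (fun A => f A * tile_weight (act w^-1 A)) =
        ((fun A : BT => f (act w A) * tile_weight A) : BT -> R) \o (act w^-1 : BT -> BT).
      by apply/funext => A /=; rewrite actVK.
    apply: measurableT_comp; last exact: continuous_measurable_map (@continuous_act R _).
    by apply: measurable_tile_weight; exact: cs_act.
  - move=> A; rewrite normrM (ger0_norm (tile_weight_ge0 _)); apply: le_trans (fM A).
    by rewrite ler_piMr // tile_weight_le1.
  - by move=> A kA; rewrite fk // mul0r.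
have invm w f : W w -> cs f -> \int[mval nu]_A (f A * tile_weight (act w^-1 A)) = \int[mval nu]_A (f (act w A) * tile_weight A).
  move=> Ww csf; have iw := refl_isometry Ww; have iV := isometryV iw.
  pose h A := f (act w A) * tile_weight A.
  have csw := cs_act iw csf.
  have := @invariant_Rintegral R (mval nu) w^-1 h iV; rewrite /h => <-.
  - by congr fine; apply: eq_integral => A _; rewrite actVK.
  - apply: tests_invariant => // f' csf'; apply: inv => //; exact: reflV.
  - exact: measurable_tile_weight csw.
  - have -> : (fun A => f (act w (act w^-1 A)) * tile_weight (act w^-1 A)) =
        (fun A => f A * tile_weight (act w^-1 A)) by apply/funext => A; rewrite actVK.
    exact: intw.
have gi w : grp O w -> isometry w by exact: grp_isometry_of.
have [||mu muE] := functional_current gi (@cover_closed R O) (L := L).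
- move=> g f Gg csf; rewrite !LE; have Wg := grp_refl Gg.
  rewrite -(invm g f Wg csf).
  suff -> : (fun A => f A * tile_weight (act g^-1 A)) = (fun A => f A * tile_weight A) by [].
  by apply/funext => A; rewrite (tile_weight_grp A (grpV Gg)).
- move=> f csf f0; rewrite LE /Rintegral integral0_eq // => A _.
  rewrite /tile_weight /in_cover indicE; case: (boolP (_ \in _)) => [/set_mem/f0 ->|_]; first by rewrite mul0r.
  by rewrite mul0r mulr0.
exists mu; apply: current_ext_tests => f csf _; have [cf [k fk]] := (csP f).1 csf.
rewrite (hat_integral Wfin hatE mu csf fk).
transitivity (\sum_(c <- fset_set (tiles O k)) \int[mval nu]_A (f A * tile_weight (act (repr c)^-1 A))); last first.
  rewrite big_seq [RHS]big_seq; apply: eq_bigr => c; rewrite in_fset_set; last exact: finite_tiles.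
  move=> /set_mem[cW _]; have Wc := tile_reprW cW.
  by rewrite muE ?LE ?invm //; apply: cs_act => //; exact: refl_isometry Wc.
have [intS <-] : (mval nu).-integrable setT (EFin \o (fun A : BT => \sum_(c <- fset_set (tiles O k))
    f A * tile_weight (act (repr c)^-1 A))) /\
  \int[mval nu]_A (\sum_(c <- fset_set (tiles O k)) f A * tile_weight (act (repr c)^-1 A)) =
  \sum_(c <- fset_set (tiles O k)) \int[mval nu]_A (f A * tile_weight (act (repr c)^-1 A)).
  apply: Rintegral_seq_sum => c; rewrite in_fset_set; last exact: finite_tiles.
  by move=> /set_mem[cW _]; apply: intw => //; exact: tile_reprW.
have intf := cs_integrable lnu csf.
rewrite (carried_Rintegral mU full intS) [LHS](carried_Rintegral mU full intf) /Rintegral.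
congr fine; apply: eq_integral => A /set_mem uA; have [Ak|kA] := leP `|A| k.
  by rewrite -mulr_sumr tile_weight_sum // mulr1.
by rewrite -mulr_sumr fk // mul0r.
Qed.

End Surjectivity.

(** * Doubled arcs *)

Section CommonPerpendicular.
Variables (R : realType) (O : orbifold R).
Implicit Types (w A B h : 'M[R]_3) (u v n x y z : 'cV[R]_3).
Let X := cover O.
Notation T := 'M[R]_3.
Notation bdry := (boundary_geodesic O).
Notation W := (reflection_group O).
Notation D := (dgrp O).
Hypothesis Wfin : forall c, finite_set [set w | W w /\ w ord_max ord_max <= c].

Lemma crossing_point n v : mdot n n = 1 -> mdot v v = 1 -> mdot n v ^+ 2 < 1 ->
  exists y, [/\ hyp y, mdot n y = 0 & mdot v y = 0].
Proof.
move=> nn vv nv.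
have [x [px _]] : exists x, points (reflection n) x /\ x ord_max 0 ^+ 2 = (1 + (reflection n) ord_max ord_max) / 2.
  by apply: geodesic_foot; exists n.
have [hx nx] := (points_reflection nn x).1 px; have [xx x0] := hx.
pose s := mdot n v; pose d := 1 - s ^+ 2; have d0 : 0 < d by rewrite /d /s; lra.
pose t := mdot v x / d; have td : t * d = mdot v x by rewrite /t divfK // gt_eqF.
(* The correction is along the part of [v] orthogonal to [n], so it keeps the product with [n] zero;
   [t] is chosen to make the product with [v] vanish. *)
pose y : 'cV[R]_3 := x - t *: (v - s *: n).
have yy : mdot y y = -1 - t * mdot v x.
  rewrite /y !mdotlin xx nx (mdotC x n) nx (mdotC x v) (mdotC v n) vv nn -/s.
  have -> : mdot v x = t * d by rewrite td.
  rewrite /d; ring.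
have tv : 0 <= t * mdot v x by rewrite -td mulrCA mulrA -expr2 mulr_ge0 ?sqr_ge0 // ltW.
have yn : mdot n y = 0 by rewrite /y !mdotlin nx nn -/s; ring.
have yv : mdot v y = 0.
  by rewrite /y !mdotlin vv (mdotC v n) -/s -td /d; ring.
have yx : mdot y x = -1 - t * mdot v x by rewrite /y !mdotlin xx nx; ring.
have y2 : mdot y y < 0 by rewrite yy; lra.
have ypos : 0 < y ord_max 0 by apply: (future (ltW y2) hx); rewrite yx; lra.
exists (normalize y); split; first exact: hyp_normalize.
  by rewrite /normalize mdotZr yn mulr0.
by rewrite /normalize mdotZr yv mulr0.
Qed.

Section Arc.
Variables A B : T.
Hypotheses (bA : bdry A) (bB : bdry B) (AB : A <> B).
Notation h := (B * A).
Variables (n : 'cV[R]_3).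
Hypotheses (nn : mdot n n = 1) (hn : h * reflection n = reflection n * h).

(** As [h] maps [n] to [n] or [- n], comparing [B *m (h *m n)] with [A *m n] gives a linear
    relation. In the first case [a *: u = b *: u'], and nonzero coefficients would force [A = B]. In
    the second case [n = a *: u + b *: u'], which forces [u] and [u'] to be orthogonal; then [B]
    preserves the geodesic of [A], whose points lie on one side of [B], so that the two boundary
    geodesics would meet. *)
Lemma normal_orthogonal u u' : outward O u A -> outward O u' B -> mdot u n = 0 /\ mdot u' n = 0.
Proof.
move=> [uu AE uX ui] [uu' BE uX' ui'].
have [gA gB] : geodesic A /\ geodesic B by split; [case: bA|case: bB].
have iA := geodesic_isometry gA; have iB := geodesic_isometry gB.
have ih : isometry h by exact: isometryM.
have an : reflection (h *m n) = reflection n.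
  by rewrite -act_reflection // /act hn -mulrA mulrV ?mulr1 // isometry_unit.
have hh : mdot (h *m n) (h *m n) = 1 by rewrite isometry_mdot.
have Bh : B *m (h *m n) = A *m n by rewrite -mul_mxM mulrA geodesicK // mul1r.
have inj := reflection_inj hh nn an.
pose a := mdot u n; pose b := mdot u' n; pose s := mdot u u'.
have An : A *m n = n - (2 * a) *: u by rewrite AE reflectionE.
have Bn : B *m n = n - (2 * b) *: u' by rewrite BE reflectionE.
case: inj => E.
  have e : a *: u = b *: u'.
    apply/matrixP => i j; have := congr1 (fun z : 'cV[R]_3 => z i j) Bh.
    rewrite E An Bn !mxE; lra.
  have ab : a = b * s by have := congr1 (mdot u) e; rewrite !mdotZr uu mulr1.
  have ab' : a * s = b by have := congr1 (fun z => mdot z u') e; rewrite !mdotZl uu' mulr1.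
  have [a0|a0] := eqVneq a 0.
    by split=> //; rewrite -/b -ab' a0 mul0r.
  exfalso; apply: AB; have s2 : s ^+ 2 = 1.
    apply: (mulfI a0); rewrite mulr1 {2}ab -ab'; ring.
  have uE : u = s *: u'.
    apply: (scalerI (a := a)); first exact: a0.
    by rewrite e scalerA ab'.
  rewrite AE BE uE; have /eqP : (s - 1) * (s + 1) = 0 by rewrite -subr_sqr s2 expr1n subrr.
  rewrite mulf_eq0 subr_eq0 addr_eq0 => /orP[] /eqP ->; first by rewrite scale1r.
  by rewrite scaleN1r reflectionN.
have e : n = a *: u + b *: u'.
  apply/matrixP => i j; have := congr1 (fun z : 'cV[R]_3 => z i j) Bh.
  rewrite E mulmxN An Bn !mxE; lra.
have e1 : a = a + b * s by have := congr1 (mdot u) e; rewrite !mdotlin uu mulr1.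
have e2 : b = a * s + b by have := congr1 (mdot u') e; rewrite !mdotlin uu' mulr1 (mdotC u' u).
have s0 : s = 0.
  apply/eqP; case: (eqVneq s 0) => // s0; have b0 : b = 0.
    by apply: (mulIf s0); rewrite mul0r; lra.
  have a0 : a = 0 by apply: (mulIf s0); rewrite mul0r; lra.
  by move: nn; rewrite e a0 b0 !scale0r addr0 mdotE !mxE; lra.
have [x [px _]] := geodesic_foot gA; have [hx ux] : hyp x /\ mdot u x = 0.
  by apply/points_reflection => //; rewrite -AE.
have XA y : points A y -> X y by case: bA => _ h /h[].
have pBx : points A (B *m x).
  rewrite AE; apply/points_reflection => //; split; first exact: hyp_isometry.
  by rewrite BE reflectionE mdotBr mdotZr ux -/s s0 mulr0 subr0.
have := uX' _ (XA _ pBx); rewrite {1}BE reflectionE mdotBr mdotZr uu'.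
have := uX' _ (XA _ px) => h1 h2.
have u'x : mdot u' x = 0 by lra.
exfalso; apply: AB; apply: (boundary_disjoint bA bB px).
by rewrite BE; apply/points_reflection.
Qed.

Lemma axis_boundary_act : act A (reflection n) = reflection n /\ act B (reflection n) = reflection n.
Proof.
have [u ou] := boundary_normal bA; have [u' ou'] := boundary_normal bB.
have [un u'n] := normal_orthogonal ou ou'.
have iA := geodesic_isometry (boundary_geod bA); have iB := geodesic_isometry (boundary_geod bB).
have [_ AE _ _] := ou; have [_ BE _ _] := ou'.
by rewrite !act_reflection // AE BE !reflectionE un u'n !mulr0 !scale0r !subr0.
Qed.

(** The dihedral group generated by the reflections [A] and [B], listed through the powers of their
    product. *)
Definition dihedral s := exists j : int, s = h ^ j \/ s = h ^ j * A.

Lemma involution_expz (x a : T) (j : int) : a * a = 1 -> x \is a GRing.unit ->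
  a * x ^ j * a = (a * x * a) ^ j.
Proof.
move=> aa ux; have ua : a \is a GRing.unit by apply/unitrP; exists a.
have av : a^-1 = a by apply: (mulrI ua); rewrite mulrV.
have nat k : a * x ^+ k * a = (a * x * a) ^+ k.
  elim: k => [|k IH]; first by rewrite !expr0 mulr1.
  by rewrite !exprS -IH -!mulrA (mulrA a a) aa mul1r.
case: j => k; first by rewrite -!exprnP.
by rewrite !NegzE -!exprnN -nat invrM ?invrM ?av ?mulrA // ?unitrX // unitrMr // unitrX.
Qed.

Lemma subgroup_expz (K : set T) (x : T) (j : int) : subgroup K -> K x -> K (x ^ j).
Proof.
move=> [K1 KM KV] Kx; have nat k : K (x ^+ k).
  by elim: k => [|k IH]; [rewrite expr0|rewrite exprS; exact: KM].
by case: j => k; rewrite -?exprnP // NegzE -exprnN; exact: KV.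
Qed.

Let gA : geodesic A. Proof. by case: bA. Qed.
Let gB : geodesic B. Proof. by case: bB. Qed.

Lemma unit_h : h \is a GRing.unit.
Proof. by apply: isometry_unit; apply: isometryM; exact: geodesic_isometry. Qed.

Lemma boundary_conj j : A * h ^ j = h ^ (- j) * A.
Proof.
have AA := geodesicK gA; have BB := geodesicK gB.
have e : A * h * A = h^-1.
  rewrite invrM; last 2 first.
  - by apply: isometry_unit; exact: geodesic_isometry.
  - by apply: isometry_unit; exact: geodesic_isometry.
  by rewrite !geodesicV // mulrA -mulrA AA mulr1.
by rewrite -exprz_inv -e -involution_expz ?unit_h // -[RHS]mulrA AA mulr1.
Qed.

Lemma dihedral_mull s : dihedral s -> dihedral (A * s) /\ dihedral (B * s).
Proof.
have AA := geodesicK gA.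
have BE : B = h * A by rewrite -mulrA AA mulr1.
have hS j : h * h ^ j = h ^ (1 + j) by rewrite exprzDr ?unit_h.
move=> [j [] ->].
  split; first by exists (- j); right; exact: boundary_conj.
  exists (1 - j); right; rewrite {1}BE -mulrA boundary_conj mulrA hS //.
split; first by exists (- j); left; rewrite mulrA boundary_conj -mulrA AA mulr1.
by exists (1 - j); left; rewrite mulrA {1}BE -(mulrA h A) boundary_conj mulrA hS -mulrA AA mulr1.
Qed.

Lemma h_dgrp : D h.
Proof. exact: boundaryM_dgrp. Qed.

Lemma dihedral_refl s : dihedral s -> W s.
Proof.
have Dh j : W (h ^ j) by apply: dgrp_refl; apply: subgroup_expz; [exact: dgrp_subgroup|exact: h_dgrp].
by move=> [j [] ->] //; apply: reflM => //; exact: boundary_refl.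
Qed.

Lemma dihedral_axis s : dihedral s -> act s (reflection n) = reflection n.
Proof.
have [aA aB] := axis_boundary_act.
have ah j : act (h ^ j) (reflection n) = reflection n.
  rewrite /act; have c : GRing.comm (reflection n) h by exact/esym.
  have -> : h ^ j * reflection n = reflection n * h ^ j by apply/esym; exact: commrXz.
  by rewrite -mulrA mulrV ?mulr1 // unitrXz // unit_h.
move=> ds; have := dihedral_refl ds; case: ds => j [] -> Ws //.
have ij : isometry (h ^ j).
  by apply: refl_isometry; apply: dgrp_refl; apply: subgroup_expz; [exact: dgrp_subgroup|exact: h_dgrp].
by rewrite actM // ?aA ?ah //; exact: geodesic_isometry.
Qed.

(* The segment of the axis between A and B is a fundamental domain for the
   action of the dihedral group on the axis, and its interior lies in the
   interior of the cover, which no wall meets. *)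
Lemma wall_meets_axis u u' pA pB V y : outward O u A -> outward O u' B ->
  hyp pA -> mdot n pA = 0 -> mdot u pA = 0 -> hyp pB -> mdot n pB = 0 -> mdot u' pB = 0 ->
  wall O V -> points V y -> mdot n y = 0 -> exists2 s, dihedral s & s *m y = pA \/ s *m y = pB.
Proof.
move=> ou ou' hpA npA upA hpB npB upB wV Vy ny.
have [un u'n] := normal_orthogonal ou ou'.
have [uu AE uX ui] := ou; have [uu' BE uX' ui'] := ou'.
have hy : hyp y by case: Vy.
have PA : points A pA by rewrite AE; apply/points_reflection.
have PB : points B pB by rewrite BE; apply/points_reflection.
have XA : X pA by case: bA => _ hA; case: (hA _ PA).
have XB : X pB by case: bB => _ hB; case: (hB _ PB).
have upB' : mdot u pB < 0.
  rewrite lt_neqAle uX // andbT; apply/eqP => e; apply: AB.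
  by apply: (boundary_disjoint bA bB (x := pB)) => //; rewrite AE; apply/points_reflection.
have upA' : mdot u' pA < 0.
  rewrite lt_neqAle uX' // andbT; apply/eqP => e; apply: AB.
  by apply: (boundary_disjoint bA bB (x := pA)) => //; rewrite BE; apply/points_reflection.
have seg (a b : R) z : hyp z -> 0 < a -> 0 < b -> z = a *: pA + b *: pB -> inner X z.
  move=> hz a0 b0 zE; have Xz : X z by apply: (cover_convex XA XB hz (ltW a0) (ltW b0) zE).
  apply: contrapT => niz; have [C [gC Cz CX]] := cover_frontier Xz niz.
  have bC : bdry C by split.
  have [uC [uuC CE uCX _]] := boundary_normal bC.
  have zC : mdot uC z = 0 by move: Cz; rewrite CE => /(points_reflection uuC)[].
  have hA := uCX _ XA; have hB := uCX _ XB.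
  rewrite zE mdotDr !mdotZr in zC.
  have zA : mdot uC pA = 0 by nra.
  have zB : mdot uC pB = 0 by nra.
  have CA : C = A by apply: (boundary_disjoint bC bA (x := pA)) => //; rewrite CE; apply/points_reflection.
  have CB : C = B by apply: (boundary_disjoint bC bB (x := pB)) => //; rewrite CE; apply/points_reflection.
  by apply: AB; rewrite -CA.
have [s0 spos] := hyp_sum hpA hpB ler01 ler01 (addr_gt0 ltr01 ltr01).
rewrite !scale1r in s0 spos; have ho := hyp_normalize s0 spos; have [l0 lE] := normalize_scale s0.
set o := normalize _ in ho lE; set l := Num.sqrt _ in l0 lE.
have oE : o = l^-1 *: pA + l^-1 *: pB by rewrite -scalerDr lE scalerA mulVf ?scale1r // gt_eqF.
have li : 0 < l^-1 by rewrite invr_gt0.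
have io : inner X o by apply: seg oE.
have d1 : dihedral 1 by exists 0; left.
(* The element that brings [y] nearest to the midpoint [o] of the two feet puts it on the inner side
   of both [A] and [B]: otherwise one more reflection would bring it closer. *)
have [||s ds smin] := minimize Wfin ho hy (S := dihedral); [exact: dihedral_refl|by exists 1|].
have iss := refl_isometry (dihedral_refl ds).
have [dAs dBs] := dihedral_mull ds.
set y' := s *m y; have hy' : hyp y' by exact: hyp_isometry.
have uy' : mdot u y' <= 0.
  have := smin _ dAs; rewrite mul_mxM AE reflectionE mdotBr mdotZr -/y' (mdotC o u).
  by have := ui _ io; nra.
have uy'' : mdot u' y' <= 0.
  have := smin _ dBs; rewrite mul_mxM BE reflectionE mdotBr mdotZr -/y' (mdotC o u').
  by have := ui' _ io; nra.
have ny' : mdot n y' = 0.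
  apply: (proj2 ((points_reflection nn y').1 _)); rewrite -(dihedral_axis ds).
  by apply/points_act => //; exact/points_reflection.
have [ppA _] := hpA; have [ppB _] := hpB.
(* These are the coordinates of [y'] with respect to [pA] and [pB], since [u] vanishes on [pA] and
   [u'] on [pB]. If both were positive, [y'] would be interior to the cover, where no wall
   passes. *)
pose be := mdot u y' / mdot u pB; pose al := mdot u' y' / mdot u' pA.
have be0 : 0 <= be by rewrite /be -mulrNN -invrN divr_ge0 // oppr_ge0 // ltW.
have al0 : 0 <= al by rewrite /al -mulrNN -invrN divr_ge0 // oppr_ge0 // ltW.
have beE : be * mdot u pB = mdot u y' by rewrite /be divfK // lt_eqF.
have yE : exists a, y' = a *: pA + be *: pB.
  exists (be * mdot pA pB - mdot pA y').
  have bas := orthonormal_basis uu nn ppA un upA npA.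
  have ey := bas y'; have ep := bas pB; rewrite ny' scale0r addr0 -beE in ey.
  rewrite npB scale0r addr0 in ep; rewrite [LHS]ey [X in _ + be *: X]ep.
  by apply/matrixP => i j; rewrite !mxE; ring.
have [a aE] := yE.
have aal : a = al.
  by rewrite /al aE mdotDr !mdotZr upB mulr0 addr0 mulfK // lt_eqF.
rewrite aal in aE.
have niy : ~ inner X y'.
  apply: (@wall_inner _ _ (act s V)); first by apply: wall_act => //; exact: dihedral_refl.
  exact/points_act.
have unique z c' : hyp z -> hyp y' -> 0 <= c' -> y' = c' *: z -> y' = z.
  move=> [zz _] [yy _] c0 E; have : c' ^+ 2 = 1.
    by move: yy; rewrite E !mdotlin zz; lra.
  by move=> c1; rewrite E (_ : c' = 1) ?scale1r //; apply/eqP; rewrite -(@eqrXn2 _ 2) // c1 expr1n.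
exists s => //; have [E|al1] := eqVneq al 0.
  by right; apply: (unique _ be) => //; rewrite aE E scale0r add0r.
have [E|be1] := eqVneq be 0.
  by left; apply: (unique _ al) => //; rewrite {1}aE E scale0r addr0.
by exfalso; apply: niy; apply: (seg al be) aE => //; rewrite lt_def ?al1 ?be1.
Qed.

End Arc.
End CommonPerpendicular.

Lemma esum_le_size (R : realType) (I : choiceType) (A : set I) (a : I -> \bar R) (s : seq I) :
  (forall i, A i -> (0 <= a i <= 1)%E) -> (forall i, A i -> i \notin s -> a i = 0%E) ->
  (\esum_(i in A) a i <= (size s)%:R%:E)%E.
Proof.
move=> a01 as0; have finF : finite_set (A `&` [set` s]) by exact: finite_setIr.
have a0 i : A i -> (0 <= a i)%E by move=> /a01 /andP[].
rewrite (esum_support finF) //; last first.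
  by move=> i Ai nF; apply: as0 => //; apply/negP => si; apply: nF.
rewrite fsbig_finite //=; apply: (@le_trans _ _ (\sum_(i <- fset_set (A `&` [set` s])) 1%:E)%E).
  rewrite big_seq [leRHS]big_seq; apply: lee_sum => i; rewrite in_fset_set // => /set_mem[Ai _].
  by have /andP[] := a01 _ Ai.
rewrite sumEFin big_const_seq count_predT iter_addr_0 lee_fin ler_nat.
apply: uniq_leq_size => [|i]; first exact: fset_uniq.
by rewrite in_fset_set // => /set_mem[].
Qed.

(** * Doubled arcs: reflection invariance and bounds on crossings *)

Section DoubledArcs.
Variables (R : realType) (O : orbifold R).
Implicit Types (w A B h : 'M[R]_3) (u v n x y z : 'cV[R]_3) (a : arc_type R) (m : weights R).
Let X := cover O.
Notation T := 'M[R]_3.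
Notation BT := (borel T).
Notation cs := (@compactly_supported R T).
Notation bdry := (boundary_geodesic O).
Notation W := (reflection_group O).
Notation D := (dgrp O).
Hypothesis Wfin : forall c, finite_set [set w | W w /\ w ord_max ord_max <= c].

Definition weight_support m : set (arc_type R) := [set a | m a != 0].

Definition total_weight m : R := \sum_(a <- fset_set (weight_support m)) m a.

Lemma arc_double a : arc O a -> exists A B, [/\ bdry A, bdry B, A <> B & double_of_arc O a = B * A].
Proof.
move=> arca; have [bA bB AB _] : arc_ends O a (xget (1, 1) (arc_ends O a)).
  by apply: xgetPex; case: arca => e he; exists e.
by exists (xget (1, 1) (arc_ends O a)).1, (xget (1, 1) (arc_ends O a)).2.
Qed.

Lemma cyclic_group_subgroup h : h \is a GRing.unit -> subgroup (cyclic_group h).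
Proof.
move=> uh; split=> [|_ _ [i _ <-] [j _ <-]|_ [i _ <-]].
- by exists 0.
- by exists (i + j) => //; rewrite exprzDr.
- by exists (- i) => //; rewrite -invr_expz.
Qed.

Lemma axisP h : geodesic (axis h) -> h * axis h = axis h * h.
Proof.
rewrite /axis; case: xgetP => [A AE [] // |_ [u uu /(congr1 (fun M : T => \det M))]].
by rewrite det1 det_reflection // => e; exfalso; move: e; lra.
Qed.

(** The double of a multiarc is either the zero default or given by this formula. Both cases are
    carried along, as invariance and the crossing bound are immediate for the zero current. *)
Definition genuine m := forall E, measurable E -> mval (hat_multiarc O m) E =
  (\sum_(a <- fset_set (weight_support m)) (m a)%:E * curve D (double_of_arc O a) E)%E.

Lemma hat_multiarcP m : multiarc O m -> hat_multiarc O m = point \/ genuine m.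
Proof.
move=> [m0 marc mfin _]; rewrite /genuine /hat_multiarc /the_measure.
case: xgetP => [nu nuE h|_]; last by left.
right=> E mE; rewrite h //.
rewrite -(@fsbig_widen _ _ _ _ (weight_support m)) ?fsbig_finite //.
by move=> a [_] /=; rewrite /weight_support /= => /negP; rewrite negbK => /eqP ->; rewrite mul0e.
Qed.

Lemma curve_ge0 h E : (0 <= curve D h E)%E.
Proof. by apply: esum_ge0 => c _; rewrite diracE. Qed.

(** If [axis] took its default value, the Dirac masses of this arc would charge matrices that are
    not geodesics, whereas a current is carried by geodesics. *)
Lemma genuine_axis m a : multiarc O m -> genuine m -> m a != 0 ->
  geodesic (axis (double_of_arc O a)).
Proof.
move=> [m0 marc mfin _] gm ma; apply: contrapT => ng.
have cX := @closed_hyp R.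
have mY : measurable (~` geodesics_in (@hyp R) : set BT) by apply: measurableC; exact: measurable_geodesics_in.
have [_ nu0 _] := currentP (hat_multiarc O m).
have := gm _ mY; rewrite nu0 => e.
have aF : a \in fset_set (weight_support m) by rewrite in_fset_set //; exact/mem_set.
have c1 : (1 <= curve D (double_of_arc O a) (~` geodesics_in (@hyp R)))%E.
  rewrite /curve; set h := double_of_arc O a in ng *.
  have [A [B [bA bB AB hE]]] := arc_double (marc _ ma).
  have uh : h \is a GRing.unit by rewrite /h hE; exact: (unit_h bA bB).
  have sub := cyclic_group_subgroup uh.
  have cD : lcosets D (cyclic_group h) (lcoset 1 (cyclic_group h)).
    by exists 1 => //; have [] := dgrp_subgroup O.
  rewrite (esumID [set lcoset 1 (cyclic_group h)]) //.
  rewrite setIidr ?esum_set1 //; last by move=> c ->.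
  rewrite diracE mem_set ?leeDl //; first by apply: esum_ge0 => c _; rewrite diracE.
  move=> [g _]; apply: ng.
  have [_ [j _ <-] rE] := repr_lcoset sub 1; rewrite rE mul1r in g.
  have Dh : D (h ^ j) by apply: subgroup_expz; [exact: dgrp_subgroup|rewrite /h hE; exact: boundaryM_dgrp].
  by rewrite -(actK (axis h) (dgrp_isometry Dh)); apply: act_geodesic => //; exact: isometryV (dgrp_isometry Dh).
have : (0 < (m a)%:E * curve D (double_of_arc O a) (~` geodesics_in (@hyp R)))%E.
  apply: mule_gt0; first by rewrite lte_fin lt_def ma m0.
  exact: lt_le_trans c1.
suff : ((m a)%:E * curve D (double_of_arc O a) (~` geodesics_in (@hyp R)) <= 0)%E.
  by move=> /le_lt_trans h /h; rewrite ltxx.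
rewrite [leRHS]e (big_rem a) //= leeDl //; apply: sume_ge0 => b _.
by apply: mule_ge0; [rewrite lee_fin|exact: curve_ge0].
Qed.

Section Curve.
Variables A B : T.
Hypotheses (bA : bdry A) (bB : bdry B) (AB : A <> B).
Notation h := (B * A).
Hypothesis gL : geodesic (axis h).
Notation K := (cyclic_group h).

Let uh : h \is a GRing.unit. Proof. exact: (unit_h bA bB). Qed.
Let sK : subgroup K. Proof. exact: cyclic_group_subgroup. Qed.
Let KD k : K k -> D k.
Proof. by move=> [j _ <-]; apply: subgroup_expz; [exact: dgrp_subgroup|exact: boundaryM_dgrp]. Qed.
Let Kiso k : K k -> isometry k. Proof. by move=> /KD /dgrp_isometry. Qed.
Let DK d k : D d -> K k -> D (d * k).
Proof. by have [_ DM _] := dgrp_subgroup O => Dd /KD; exact: DM. Qed.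

Lemma axis_act_boundary : act A (axis h) = axis h.
Proof.
have [n nn nE] := gL; have c := axisP gL; rewrite nE in c *.
by have [] := axis_boundary_act bA bB AB nn c.
Qed.

Lemma axis_act_cyclic k : K k -> act k (axis h) = axis h.
Proof.
move=> [j _ <-]; have [n nn nE] := gL; have c := axisP gL; rewrite nE in c *.
by apply: (dihedral_axis bA bB AB nn c); exists j; left.
Qed.

(** Left multiplication by an orientation reversing [w] leaves [dgrp O] and is replaced by
    [x |-> w * x * A]. This map descends to cosets because [A] inverts [h], and it yields the same
    translates of the axis because [A] preserves the axis. *)
Lemma curve_invariant w E : W w -> curve D h (act w @^-1` E) = curve D h E.
Proof.
move=> Ww; have iw := refl_isometry Ww; have uw := isometry_unit iw.
have AA := geodesicK (boundary_geod bA); have iA := geodesic_isometry (boundary_geod bA).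
have dA := det_geodesic (boundary_geod bA).
pose phi (x : T) : \bar R := (\d_(act x (axis h) : BT) E)%E.
have phiK (x k : T) : D x -> K k -> phi (x * k) = phi x.
  by move=> Dx Kk; rewrite /phi (actM _ (dgrp_isometry Dx) (Kiso Kk)) axis_act_cyclic.
have [Dw|nDw] := pselect (D w).
  have [_ DM DV] := dgrp_subgroup O.
  rewrite /curve -[RHS](@esum_lcosets_reindex R K D sK Kiso (@dgrp_isometry R O) DK (fun x : T => w * x) (fun x : T => w^-1 * x) phi) //.
  - apply: eq_esum => c cD; have [Dr _] := lcosetsP sK Kiso (@dgrp_isometry R O) DK cD.
    by rewrite /phi (actM _ iw (dgrp_isometry Dr)).
  - by move=> x; exact: DM.
  - by move=> x; apply: DM; exact: DV.
  - by move=> x _; rewrite mulrA mulVr ?mul1r.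
  - by move=> x _; rewrite mulrA mulrV ?mul1r.
  - by move=> x k _ Kk; exists k => //; rewrite mulrA.
  - by move=> x k _ Kk; exists k => //; rewrite mulrA.
have dw : \det w = -1.
  by case: (sqr_det_isometry iw) => // dw; case: nDw.
have conj k : K k -> exists2 k', K k' & k * A = A * k'.
  move=> [j _ <-]; exists (h ^ (- j)); first by exists (- j).
  by rewrite (boundary_conj bA bB) opprK.
have DA (w' x : T) : W w' -> \det w' = -1 -> D x -> D (w' * x * A).
  move=> Ww' dw' [Wx dx]; split; last by rewrite !det_mulmx dw' dx dA mulr1 mulN1r opprK.
  by apply: reflM; [exact: reflM|exact: boundary_refl].
have dwV : \det w^-1 = -1 by rewrite det_inv dw invrN1.
rewrite /curve -[RHS](@esum_lcosets_reindex R K D sK Kiso (@dgrp_isometry R O) DK (fun x : T => w * x * A) (fun x : T => w^-1 * x * A) phi) //.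
- apply: eq_esum => c cD; have [Dr _] := lcosetsP sK Kiso (@dgrp_isometry R O) DK cD.
  have ir := dgrp_isometry Dr.
  by rewrite /phi actM ?axis_act_boundary ?actM //; exact: isometryM.
- by move=> x Dx; apply: DA.
- by move=> x Dx; apply: DA => //; exact: reflV.
- by move=> x _; rewrite -!mulrA AA mulr1 mulrA mulVr ?mul1r.
- by move=> x _; rewrite -!mulrA AA mulr1 mulrA mulrV ?mul1r.
- by move=> x k _ /conj[k' Kk' e]; exists k' => //; rewrite -!mulrA e.
- by move=> x k _ /conj[k' Kk' e]; exists k' => //; rewrite -!mulrA e.
Qed.

End Curve.

Lemma hat_multiarc_invariant m w f : multiarc O m -> W w -> cs f ->
  \int[mval (hat_multiarc O m)]_A f (act w A) = \int[mval (hat_multiarc O m)]_A f A.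
Proof.
move=> mm Ww csf; have iw := refl_isometry Ww; have lf := current_lf (hat_multiarc O m).
apply: invariant_Rintegral => //.
- move=> E mE; have mE' := measurable_act w mE.
  case: (hat_multiarcP mm) => [->|gm]; first by [].
  rewrite !gm // big_seq [RHS]big_seq; have [m0 marc mfin _] := mm.
  apply: eq_bigr => a; rewrite in_fset_set // => /set_mem ma.
  have gL := genuine_axis mm gm ma; have [A [B [bA bB AB hE]]] := arc_double (marc _ ma).
  by rewrite hE in gL *; rewrite curve_invariant.
- by apply: continuous_measurable_borel; case: csf.
- by apply: cs_integrable => //; exact: cs_act.
Qed.

(** The reflection in the wall is a reduced word with first letter some [C], so it sends the cover
    beyond [C]. At [p], which it fixes, this puts [p] on [C]; at the points of [C] on both sides of
    [p], it forces the wall to be tangent to [C], hence equal to it. *)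
Lemma wall_boundary V B p : wall O V -> bdry B -> points V p -> points B p -> V = B.
Proof.
move=> wV bB Vp Bp; have [v vv vE] := wall_geodesic wV; rewrite vE in wV Vp *.
have [hp vp] := (points_reflection vv p).1 Vp.
have Xof C y : bdry C -> points C y -> X y by move=> [_ h] /h[].
have [h rh] := refl_reduced (wall_refl wV).
case: h rh => [C|] rh; last first.
  have : grp O (reflection v) by inversion rh.
  by move=> /(@grp_isometry _ O)[_]; rewrite det_reflection // => e; exfalso; move: e; lra.
have bC : bdry C by inversion rh.
have [u ou] := boundary_normal bC; have [uu CE uX ui] := ou.
have half y : X y -> 0 <= mdot u y - 2 * mdot v y * mdot u v.
  move=> Xy; have := reduced_halfplane rh erefl ou Xy.
  by rewrite reflectionE mdotBr mdotZr.
have up : mdot u p = 0.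
  apply: le_anti; rewrite uX /=; last exact: Xof Bp.
  by have := half p (Xof _ _ bB Bp); rewrite vp; lra.
have Cp : points C p by rewrite CE; apply/points_reflection.
have <- : C = B by exact: (boundary_disjoint bC bB Cp Bp).
have [e [ee ep eu]] := tangent uu (proj1 hp) up.
have XC t : X (line p e t).
  apply: (Xof C) => //; rewrite CE; apply/points_reflection => //; split; first exact: hyp_line.
  by rewrite mdot_line up (mdotC u) eu; lra.
have h1 := half _ (XC 1); have h2 := half _ (XC (-1)).
rewrite !mdot_line up vp (mdotC u e) eu in h1 h2.
have ip := innerptP O; have h3 := half _ (inner_cover ip); have h4 := ui _ ip.
have uv : mdot u v != 0 by apply/eqP => uv; rewrite uv in h3; lra.
have ve : mdot v e = 0.
  have : mdot v e * mdot u v = 0 by lra.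
  by move=> /eqP; rewrite mulf_eq0 (negbTE uv) orbF => /eqP.
have vu := orthonormal_basis uu ee (proj1 hp) (etrans (mdotC _ _) eu) up ep v.
rewrite (mdotC e) ve (mdotC p) vp !scale0r addr0 subr0 in vu.
have : mdot u v ^+ 2 = 1 by move: vv; rewrite {1 2}vu !mdotlin uu; lra.
move=> /eqP; rewrite sqrf_eq1 CE => /orP[] /eqP h'; rewrite vu h'; first by rewrite scale1r.
by rewrite scaleN1r reflectionN.
Qed.

(** The wall of [v] is the image of [C], so the lift with normal [x *m n] crosses it orthogonally at
    [x *m p]. This crossing point is thus the point of the lift nearest to any [p0] on the wall. *)
Lemma perpendicular_foot C (x : T) u n v p p0 z : bdry C -> outward O u C -> mdot n n = 1 ->
  mdot u n = 0 -> hyp p -> mdot u p = 0 -> mdot n p = 0 -> W x ->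
  mdot v v = 1 -> wall O (reflection v) -> mdot v (x *m p) = 0 ->
  hyp p0 -> mdot v p0 = 0 -> hyp z -> mdot (x *m n) z = 0 ->
  - mdot (x *m p) p0 <= - mdot z p0.
Proof.
move=> bC [uu CE uX ui] nn un hp up np Wx vv wv vxp hp0 vp0 hz nz.
have ix := refl_isometry Wx; have iV := isometryV ix.
have hq := hyp_isometry ix hp.
have e : act x^-1 (reflection v) = C.
  apply: (@wall_boundary _ _ p) => //; first by apply: wall_act => //; exact: reflV.
    by rewrite -{1}(isometryK p ix); apply/points_act => //; apply/points_reflection.
  by rewrite CE; apply/points_reflection.
have : reflection v = reflection (x *m u) by rewrite -act_reflection // -CE -e actVK.
have xx : mdot (x *m u) (x *m u) = 1 by rewrite isometry_mdot.
move=> /(reflection_inj vv xx) vE.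
have vn : mdot v (x *m n) = 0 by case: vE => ->; rewrite ?mdotNl isometry_mdot // un ?oppr0.
have nn' : mdot (x *m n) (x *m n) = 1 by rewrite isometry_mdot.
have nq : mdot (x *m n) (x *m p) = 0 by rewrite isometry_mdot.
have pE := orthonormal_basis vv nn' (proj1 hq) vn vxp nq p0.
rewrite vp0 scale0r add0r in pE.
rewrite [in leRHS]pE mdotBr !mdotZr (mdotC z (x *m n)) nz mulr0 sub0r opprK.
have h1 := hyp_mdot_le hq hp0; have h2 := hyp_mdot_le hz hq; nra.
Qed.

(** A lift of the axis crosses the wall at a translate of one of its two feet, and by
    [perpendicular_foot] this point lies in a fixed ball once the lift has norm below [k]. Moving
    the feet to height at most [c0] by [grp O] leaves a finite set [S] of isometries that does not
    depend on the arc. *)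
Lemma curve_bound v (k : R) : mdot v v = 1 -> wall O (reflection v) ->
  exists N : nat, forall A B, bdry A -> bdry B -> A <> B -> geodesic (axis (B * A)) ->
    (curve D (B * A) [set L : T | (-1 < mdot v (L *m v))%R /\ (`|L| < k)%R] <= N%:R%:E)%E.
Proof.
move=> vv wv; have [c0 hc0] := cover_height O.
have [p0 [pp0 _]] := geodesic_foot (wall_geodesic wv).
have [hp0 vp0] := (points_reflection vv p0).1 pp0.
(* Bound for the height of a crossing point. By [foot_ball] the lift has a point of height at most
   [(1 + k) / 2]; [cosh_triangle] bounds its distance to [p0], hence that of the crossing point, and
   a second use passes from [p0] to [base]. *)
pose c1 := 2 * ((1 + k) * p0 ord_max 0) * p0 ord_max 0.
have finS := Wfin (4 * c0 * c1); pose S := fset_set [set w | W w /\ w ord_max ord_max <= 4 * c0 * c1].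
pose k4 := size (enum_fset S); exists (k4 + (k4 + (k4 + k4)))%N => A B bA bB AB gL.
have uh := unit_h bA bB; have sK := cyclic_group_subgroup uh.
set h := B * A in gL uh sK *; pose K := cyclic_group h.
have [n nn nE] := gL; have cn := axisP gL; rewrite nE in cn.
have [u ou] := boundary_normal bA; have [u' ou'] := boundary_normal bB.
have [un u'n] := normal_orthogonal bA bB AB nn cn ou ou'.
have [uu AE uX _] := ou; have [uu' BE uX' _] := ou'.
have pt (w : 'cV[R]_3) : mdot w w = 1 -> mdot w n = 0 -> exists p, [/\ hyp p, mdot n p = 0 & mdot w p = 0].
  by move=> ww wn; apply: crossing_point => //; rewrite mdotC wn expr0n ltr01.
have [pA [hpA npA upA]] := pt _ uu un; have [pB [hpB npB upB]] := pt _ uu' u'n.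
have XA : X pA by case: bA => _ hA; case: (hA pA) => //; rewrite AE; apply/points_reflection.
have XB : X pB by case: bB => _ hB; case: (hB pB) => //; rewrite BE; apply/points_reflection.
have [gA' GgA gAc] := hc0 _ XA; have [gB' GgB gBc] := hc0 _ XB.
pose cos (x : T) := lcoset x K.
(* A coset is determined by an element of [S], by the foot at which the crossing occurs, and by
   whether the dihedral element involves the reflection [A]; hence four lists. *)
pose s := map (fun w => cos (w * gA')) S ++ map (fun w => cos (w * gA' * A)) S ++
          map (fun w => cos (w * gB')) S ++ map (fun w => cos (w * gB' * A)) S.
have -> : (k4 + (k4 + (k4 + k4)))%N = size s by rewrite !size_cat !size_map.
apply: esum_le_size => [c _|c cD cs]; first by rewrite diracE !lee_fin; case: (_ \in _); rewrite /= ?lexx ?ler01.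
rewrite diracE; case: (boolP (_ \in _)) => // /set_mem[cr nk]; case/negP: cs.
have KD w : K w -> D w.
  by move=> [j _ <-]; apply: subgroup_expz; [exact: dgrp_subgroup|exact: boundaryM_dgrp].
have Kiso w : K w -> isometry w by move=> /KD /dgrp_isometry.
have DK d w : D d -> K w -> D (d * w).
  by have [_ DM _] := dgrp_subgroup O; move=> Dd /KD; exact: DM.
have [Dx xc] := lcosetsP sK Kiso (@dgrp_isometry R O) DK cD.
set x := repr c in cr nk Dx xc; have Wx := dgrp_refl Dx; have ix := refl_isometry Wx.
rewrite nE act_reflection // in cr nk.
have xnn : mdot (x *m n) (x *m n) = 1 by rewrite isometry_mdot.
have xnv : mdot (x *m n) v ^+ 2 < 1 by move: cr; rewrite mdot_self_reflection //; lra.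
have [q [hq nq vq]] := crossing_point xnn vv xnv.
pose y : 'cV[R]_3 := x^-1 *m q; have xy : x *m y = q by rewrite /y isometryKV.
have ny : mdot n y = 0 by rewrite -(isometry_mdot _ _ ix) xy.
have Vy : points (act x^-1 (reflection v)) y.
  by apply/points_act; [exact: isometryV|apply/points_reflection].
have wV' := wall_act (reflV Wx) wv.
have [s0 ds sp] := wall_meets_axis Wfin bA bB AB nn cn ou ou' hpA npA upA hpB npB upB wV' Vy ny.
have Ws := dihedral_refl bA bB ds; have iss := refl_isometry Ws.
pose x' := x * s0^-1; have Wx' : W x' by apply: reflM => //; exact: reflV.
have ix' := refl_isometry Wx'.
have x'n : reflection (x' *m n) = reflection (x *m n).
  rewrite -!act_reflection // actM //; last exact: isometryV.
  by rewrite -{1}(dihedral_axis bA bB AB nn cn ds) actK.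
have gL' : geodesic (reflection (x *m n)) by exists (x *m n).
have L33 : (reflection (x *m n)) ord_max ord_max <= k.
  by apply: le_trans (ltW nk); apply: le_trans (ler_norm _) _; exact: mx_entry_norm.
have [z pz zk] := foot_ball gL' L33.
have [hz nz] : hyp z /\ mdot (x' *m n) z = 0.
  by apply/points_reflection; [rewrite isometry_mdot|rewrite x'n].
have x'E p : s0 *m y = p -> x' *m p = q by move=> <-; rewrite /x' mul_mxM isometryK.
have cE : c = cos x' \/ c = cos (x' * A).
  have us := isometry_unit iss.
  have xE : x = x' * s0 by rewrite /x' -mulrA mulVr ?mulr1.
  have iA := geodesic_isometry (boundary_geod bA).
  case: ds => j [] sE; [left|right]; rewrite -xc xE sE /cos.
    by rewrite lcoset_mul //; exists j.
  have -> : x' * (h ^ j * A) = x' * A * h ^ (- j).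
    by rewrite -mulrA (boundary_conj bA bB) opprK.
  by rewrite lcoset_mul //; [exact: isometryM|exists (- j)].
have [zz z0] := hz; have [_ p00] := hp0.
have found C (w : 'cV[R]_3) p g : bdry C -> outward O w C -> mdot w n = 0 -> hyp p -> mdot n p = 0 -> mdot w p = 0 ->
    grp O g -> (g *m p) ord_max 0 <= c0 -> s0 *m y = p ->
    c \in map (fun w' => cos (w' * g)) S ++ map (fun w' => cos (w' * g * A)) S.
  move=> bC ow wn hp np wp Gg gp sy; have qE := x'E _ sy; have ig := grp_isometry_of Gg.
  have hgp : hyp (g *m p) by exact: hyp_isometry.
  have e1 : - mdot q p0 <= - mdot z p0.
    rewrite -qE; apply: (perpendicular_foot bC ow nn wn hp wp np Wx' vv wv) => //.
    by rewrite qE.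
  have e2 : - mdot z p0 <= 2 * z ord_max 0 * p0 ord_max 0.
    by have := cosh_triangle hz (hyp_base R) hp0; rewrite (mdotC z (base R)) !mdot_base; lra.
  have e3 : q ord_max 0 <= 2 * - mdot q p0 * p0 ord_max 0.
    by have := cosh_triangle hq hp0 (hyp_base R); rewrite -!(mdotC (base R)) !mdot_base; lra.
  have e4 : q ord_max 0 <= c1.
    apply: le_trans e3 _; rewrite /c1 ler_pM2r // ler_pM2l //.
    apply: le_trans e1 _; apply: le_trans e2 _; rewrite ler_pM2r //; lra.
  pose w' := x' * g^-1.
  have ww' : W w' by apply: refl_grp => //; exact: grpV.
  have iw' := refl_isometry ww'.
  have w'q : w' *m (g *m p) = q by rewrite /w' mul_mxM isometryK.
  have w'E : w' * g = x' by rewrite /w' -mulrA mulVr ?mulr1 // isometry_unit.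
  have wS : w' \in S.
    rewrite in_fset_set; last exact: finS.
    apply/mem_set; split=> //; apply: le_trans (isometry_move iw' hgp hq) _; rewrite w'q.
    have [-> q0] := hq; have [_ gp0] := hgp.
    by rewrite opprK mulr1 -!mulrA ler_pM2l // ler_pM //; exact: ltW.
  rewrite mem_cat; apply/orP; case: cE => ->; [left|right].
    by apply/mapP; exists w' => //; rewrite w'E.
  by apply/mapP; exists w' => //; rewrite w'E.
rewrite /s catA mem_cat; apply/orP; case: sp => sp; [left|right].
  exact: (found A u pA gA').
exact: (found B u' pB gB').
Qed.

Lemma transversal_bound v e (k : R) : mdot v v = 1 -> wall O (reflection v) -> 0 < e ->
  exists2 C : R, 0 <= C & forall m, multiarc O m ->
    \int[mval (hat_multiarc O m)]_A transversal v e k A <= C * total_weight m.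
Proof.
move=> vv wv e0; have [N hN] := curve_bound k vv wv.
pose K := Num.max 0 k; have K0 : 0 <= K by rewrite le_max lexx.
(* On geodesics the angular factor of [transversal] is at most 2, because [mdot v (A *m v) <= 1],
   and the bump is at most [K]. *)
exists (2 * K * N%:R); first by rewrite !mulr_ge0.
move=> m mm; have [m0 marc mfin _] := mm; set nu := mval (hat_multiarc O m).
pose U : set BT := [set L : T | (-1 < mdot v (L *m v))%R /\ (`|L| < k)%R].
have mU : measurable U.
  apply: (@measurableI _ BT [set L : T | (-1 < mdot v (L *m v))%R] [set L : T | (`|L| < k)%R]);
    apply: open_measurable_borel.
    by apply: (@open_comp _ _ (fun A : T => mdot v (A *m v)) [set y : R | -1 < y]); [move=> L _; exact: continuous_angle|exact: open_gt].
  by apply: (@open_comp _ _ (fun A : T => `|A|) [set y : R | y < k]); [move=> L _; exact: norm_continuous|exact: open_lt].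
have lnu := current_lf (hat_multiarc O m); have [_ nuX _] := currentP (hat_multiarc O m).
have mX : measurable (geodesics_in (@hyp R) : set BT) by apply: measurable_geodesics_in; exact: closed_hyp.
have W0 : 0 <= total_weight m by exact: sumr_ge0.
have nuU : (nu U <= (N%:R * total_weight m)%:E)%E.
  case: (hat_multiarcP mm) => [E|gm].
    by rewrite /nu E /mval /= /mzero lee_fin mulr_ge0.
  rewrite /nu gm // /total_weight mulr_sumr -sumEFin big_seq [leRHS]big_seq; apply: lee_sum => a.
  rewrite in_fset_set // => /set_mem ma.
  have gL := genuine_axis mm gm ma; have [A [B [bA bB AB hE]]] := arc_double (marc _ ma).
  by rewrite hE in gL *; rewrite mulrC EFinM lee_pmul2l ?hN // lte_fin lt_def ma m0.
have iU : nu.-integrable setT (EFin \o (\1_U : BT -> R)).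
  apply: (bounded_integrable (k := k) (M := 1)) => //.
    by move=> L; rewrite indicE; case: (_ \in _); rewrite ?normr1 ?normr0.
  by move=> L kL; rewrite indicE memNset // => -[_ /(lt_trans kL)]; rewrite ltxx.
have iKU : nu.-integrable setT (EFin \o (fun L : BT => 2 * K * \1_U L)).
  by have := integrableZl measurableT (2 * K) iU.
apply: le_trans (carried_le mX nuX (cs_integrable lnu (cs_transversal v e k)) iKU _) _; last first.
  rewrite RintegralZl // -!mulrA ler_pM2l // ler_wpM2l //.
  have -> : \int[nu]_x \1_U x = fine (nu U) by rewrite /Rintegral integral_indic // setIT.
  by rewrite -lee_fin fineK // ge0_fin_numE // (le_lt_trans nuU) // ltry.
move=> L [[n nn ->] _]; rewrite /transversal mdot_self_reflection //.
rewrite indicE; case: (boolP (_ \in U)) => [/set_mem [cr lk]|/negP nU].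
  rewrite mulr1; apply: ler_pM; rewrite ?le_max ?lexx ?bump_ge0 //.
    by rewrite ge_max; apply/andP; split; [lra|have := sqr_ge0 (mdot n v); lra].
  have rn := normr_ge0 (reflection n).
    by apply/orP; right; rewrite /bump ge_max lerBlDr lerDl rn andbT; exact: le_trans rn (ltW lk).
rewrite mulr0; have [kl|lk] := leP k `|reflection n|.
  suff -> : bump k (reflection n) = 0 by rewrite mulr0.
  by apply/max_idPl; rewrite subr_le0.
suff -> : Num.max 0 (1 - 2 * mdot n v ^+ 2 + 1 - e) = 0 by rewrite mul0r.
apply/max_idPl; rewrite leNgt; apply/negP => h; apply: nU; apply/mem_set; split=> //=.
by rewrite mdot_self_reflection //; lra.
Qed.

End DoubledArcs.

(** * The mapping class group preserves the weights *)

Lemma sum_uniq_le (R : realType) (I : eqType) (s1 s2 : seq I) (F : I -> R) : (forall i, 0 <= F i) ->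
  uniq s1 -> {subset s1 <= s2} -> \sum_(i <- s1) F i <= \sum_(i <- s2) F i.
Proof.
move=> F0; elim: s1 s2 => [|x s1 IH] s2 /=; first by rewrite big_nil => _ _; exact: sumr_ge0.
move=> /andP[xs us] sub; have xs2 : x \in s2 by apply: sub; rewrite mem_head.
rewrite big_cons [leRHS](big_rem x) //= lerD2l; apply: IH => // y ys.
by apply: rem_mem; [apply: contraNneq xs => <-|apply: sub; rewrite inE ys orbT].
Qed.

Section Homeomorphisms.
Variables (R : realType) (O : orbifold R).
Implicit Types (f : 'cV[R]_3 -> 'cV[R]_3) (x y p : 'cV[R]_3) (w A B : 'M[R]_3).
Let X := cover O.
Notation bdry := (boundary_geodesic O).

Lemma polar (a b : R) : a ^+ 2 + b ^+ 2 = 1 -> exists t, cos t = a /\ sin t = b.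
Proof.
move=> ab; have a1 : -1 <= a <= 1 by rewrite -ler_norml -(@ler_pXn2r _ 2) ?nnegrE // expr1n real_normK ?num_real //; nra.
have ca : cos (acos a) = a by apply: acosK; rewrite in_itv.
have s2 : sin (acos a) ^+ 2 = b ^+ 2.
  by have := cos2Dsin2 (acos a); rewrite ca; lra.
move: s2 => /eqP; rewrite eqf_sqr => /orP[] /eqP e; first by exists (acos a).
by exists (- acos a); rewrite cosN sinN e opprK.
Qed.

Lemma sqr_lt (a b : R) : 0 <= b -> a ^+ 2 < b ^+ 2 -> - b < a /\ a < b.
Proof.
move=> b0 ab; suff : `|a| < b by rewrite ltr_norml => /andP[].
by rewrite -(@ltr_pXn2r _ 2) ?nnegrE // real_normK ?num_real.
Qed.

Lemma winding_surjective (phi : R -> R) : continuous phi ->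
  (forall t, phi (t + 2 * pi) = phi t + 2 * pi) -> forall s, exists t, phi t = s.
Proof.
move=> cphi; set P := 2 * pi => per s.
have perN n : phi (P *+ n) = phi 0 + P *+ n.
  by elim: n => [|n IH]; rewrite ?mulr0n ?addr0 // !mulrSr per IH addrA.
have perN' n : phi (- (P *+ n)) = phi 0 - P *+ n.
  elim: n => [|n IH]; first by rewrite mulr0n oppr0 addr0.
  have e : - (P *+ n.+1) + P = - (P *+ n) by rewrite mulrSr opprD subrK.
  by have := per (- (P *+ n.+1)); rewrite e IH mulrSr; lra.
have p0 : 0 < P by rewrite /P mulr_gt0 // pi_gt0.
pose n := (Num.truncn (`|s - phi 0| / (P))).+1.
have hn : `|s - phi 0| < P *+ n.
  by rewrite -mulr_natr -ltr_pdivrMl // mulrC truncnS_gt.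
have [h1 h2] : - (P *+ n) < s - phi 0 /\ s - phi 0 < P *+ n.
  by move: hn; rewrite ltr_norml => /andP[].
have n0 : 0 <= P *+ n :> R by rewrite mulrn_wge0 // ltW.
have [||t _ <-] := @IVT R phi (- (P *+ n)) (P *+ n) s _ (continuous_subspaceT cphi).
- by lra.
- rewrite perN perN' ge_min le_max; apply/andP; split; apply/orP; [left|right]; lra.
by exists t.
Qed.

(** If [f x] lay on a boundary geodesic with outward normal [u], the winding condition would give a
    point near [x] whose image is displaced from [f x], in the chart, in the direction
    [(u 0 0, u 1 0)]. Whatever the size of this displacement, the image would lie strictly beyond
    the geodesic, outside the cover. *)
Lemma homeo_inner f x : homeo O f -> inner X x -> inner X (f x).
Proof.
move=> [_ [f' _ ff'] _ _ op] ix; have Xx := inner_cover ix.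
have [Xfx _ _ _] := ff' _ Xx; apply: contrapT => nifx.
have [C [gC Cfx CX]] := cover_frontier Xfx nifx.
have bC : bdry C by split.
have [u [uu CE uX _]] := boundary_normal bC; rewrite CE in Cfx.
have [hfx ufx] := (points_reflection uu _).1 Cfx.
have [e [rho [phi [cphi rho0 per circ]]]] := filter_ex (op x ix).
pose r := Num.sqrt (u 0 0 ^+ 2 + u 1 0 ^+ 2).
have r2 : r ^+ 2 = u 0 0 ^+ 2 + u 1 0 ^+ 2 by rewrite sqr_sqrtr // addr_ge0 // sqr_ge0.
have r21 : r ^+ 2 = 1 + u ord_max 0 ^+ 2 by rewrite r2; move: uu; rewrite mdotE; lra.
have r0 : 0 < r.
  by rewrite lt_def sqrtr_ge0 andbT; apply/eqP => h; move: r21; rewrite h; have := sqr_ge0 (u ord_max 0); nra.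
have [th [cth sth]] : exists t, cos t = u 0 0 / r /\ sin t = u 1 0 / r.
  by apply: polar; rewrite !expr_div_n -mulrDl -r2 divff // gt_eqF // exprn_gt0.
have [t tE] := winding_surjective cphi per th.
have [Xy /pair_equal_spec[y1 y2]] := circ t.
have [Xfy _ _ _] := ff' _ Xy; have hfy := cover_hyp Xfy.
set y := f _ in y1 y2 Xfy hfy; set q := f x in ufx hfx y1 y2 Xfx.
have uy := uX _ Xfy; rewrite /= tE in y1 y2; have rt := rho0 t.
set rr := rho t in y1 y2 rt; set c := cos th in cth y1; set d := sin th in sth y2.
have cd : c ^+ 2 + d ^+ 2 = 1 by exact: cos2Dsin2.
have u1 : u 0 0 = r * c by rewrite cth mulrC divfK // gt_eqF.
have u2 : u 1 0 = r * d by rewrite sth mulrC divfK // gt_eqF.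
have [_ y0] := hfy; have [_ q0] := hfx.
have yy := hyp_sqr hfy; have qq := hyp_sqr hfx.
move: uy ufx; rewrite !mdotE u1 u2 y1 y2; rewrite y1 y2 in yy.
move: r21 yy qq; set y3 := y ord_max 0 in y0 *; set q3 := q ord_max 0 in q0 *.
set q1 := q 0 0; set q2 := q 1 0; set u3 := u ord_max 0 => r21 yy qq uy uq.
have e1 : r * rr <= u3 * (y3 - q3).
  have : r * rr * (c ^+ 2 + d ^+ 2) <= u3 * (y3 - q3) by nra.
  by rewrite cd mulr1.
pose k := c * q1 + d * q2.
have k2 : k ^+ 2 < q3 ^+ 2.
  have : k ^+ 2 + (c * q2 - d * q1) ^+ 2 = (c ^+ 2 + d ^+ 2) * (q1 ^+ 2 + q2 ^+ 2) by rewrite /k; ring.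
  by rewrite cd mul1r; have := sqr_ge0 (c * q2 - d * q1); lra.
have yk : y3 ^+ 2 = q3 ^+ 2 + 2 * rr * k + rr ^+ 2.
  have -> : rr ^+ 2 = rr ^+ 2 * (c ^+ 2 + d ^+ 2) by rewrite cd mulr1.
  rewrite yy qq /k; ring.
have kr2 : (k + rr) ^+ 2 < y3 ^+ 2 by rewrite yk; nra.
have [_ kq] := sqr_lt (ltW q0) k2; have [kr _] := sqr_lt (ltW y0) kr2.
have m1 : 0 < rr * (q3 - k) by rewrite mulr_gt0 // subr_gt0.
have m2 : 0 < rr * (y3 + (k + rr)) by rewrite mulr_gt0 //; lra.
(* The height on the hyperboloid is a 1-Lipschitz function of the chart. As [|u3| < r], the
   horizontal gain [r * rr] then exceeds the vertical term [u3 * (y3 - q3)], contrary to [e1]. *)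
have d1 : y3 - q3 <= rr.
  rewrite leNgt; apply/negP => h; have h' : q3 + rr < y3 by lra.
  have : (q3 + rr) ^+ 2 < y3 ^+ 2 by rewrite ltr_pXn2r // ?nnegrE; lra.
  by rewrite yk; lra.
have d2 : q3 - y3 <= rr.
  rewrite leNgt; apply/negP => h; have h' : y3 + rr < q3 by lra.
  have : (y3 + rr) ^+ 2 < q3 ^+ 2 by rewrite ltr_pXn2r // ?nnegrE; lra.
  by have -> : q3 ^+ 2 = y3 ^+ 2 - 2 * rr * k - rr ^+ 2 by [rewrite yk; ring]; lra.
have u3r : u3 ^+ 2 < r ^+ 2 by lra.
have [h1 h2] := sqr_lt (ltW r0) u3r.
have : u3 * (y3 - q3) < r * rr.
  have [u0|u0] := leP 0 u3.
    by apply: le_lt_trans (ler_wpM2l u0 d1) _; rewrite ltr_pM2r.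
  have := ler_wpM2l (_ : 0 <= - u3) d2; rewrite oppr_ge0 => /(_ (ltW u0)).
  have : - u3 * rr < r * rr by rewrite ltr_pM2r //; lra.
  lra.
by move/(le_lt_trans e1); rewrite ltxx.
Qed.

(** If the closed range were bounded above, its supremum would be attained. But an injective
    continuous function on the line has no maximum, since by the intermediate value theorem it would
    take a common value on both sides of it. *)
Lemma closed_range_unbounded (h : R -> R) : continuous h -> injective h -> closed (range h) ->
  forall r, exists t, r <= h t.
Proof.
move=> ch ih cl r; apply: contrapT => no.
have ub : ubound (range h) r.
  by move=> _ [t _ <-]; rewrite leNgt; apply/negP => rt; apply: no; exists t; exact: ltW.
have ne : range h !=set0 by exists (h 0), 0.
have [t0 _ hs] : range h (sup (range h)).
  apply: cl; apply: closure_sup => //; by exists r.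
have le t : h t <= h t0 by rewrite hs; apply: ub_le_sup; [exists r|exists t].
have lt t : t <> t0 -> h t < h t0.
  by move=> tt; rewrite lt_neqAle le andbT; apply/eqP => /ih.
have l1 : h (t0 - 1) < h t0 by apply: lt => e; lra.
have l2 : h (t0 + 1) < h t0 by apply: lt => e; lra.
have [ab|ba] := leP (h (t0 + 1)) (h (t0 - 1)).
  have [||c] := @IVT R h t0 (t0 + 1) (h (t0 - 1)) _ (continuous_subspaceT ch); first by lra.
    by rewrite ge_min le_max ab orbT (ltW l1).
  by rewrite in_itv /= => /andP[c1 c2] /ih cE; lra.
have [||c] := @IVT R h (t0 - 1) t0 (h (t0 + 1)) _ (continuous_subspaceT ch); first by lra.
  by rewrite ge_min le_max (ltW ba) (ltW l2) orbT.
by rewrite in_itv /= => /andP[c1 c2] /ih cE; lra.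
Qed.

Lemma closed_range_surjective (h : R -> R) : continuous h -> injective h -> closed (range h) ->
  forall r, exists t, h t = r.
Proof.
move=> ch ih cl r; have [t1 h1] := closed_range_unbounded ch ih cl r.
have chN : continuous (fun t => - h t) by move=> t; apply: cvgN; exact: ch.
have [||t2 h2] := closed_range_unbounded chN _ _ (- r).
- by move=> s t /oppr_inj /ih.
- have -> : range (fun t => - h t) = -%R @^-1` range h.
    apply/seteqP; split=> [_ [t _ <-]|s [t _ ht]]; first by exists t => //=; rewrite opprK.
    by exists t => //=; rewrite ht opprK.
  by apply: continuous_comp_closed => // t; exact: opp_continuous.
rewrite lerN2 in h2.
have [t12|t21] := leP t1 t2.
  have [|t _ <-] := @IVT R h t1 t2 r t12 (continuous_subspaceT ch); last by exists t.
  by rewrite ge_min le_max h1 h2 orbT.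
have [|t _ <-] := @IVT R h t2 t1 r (ltW t21) (continuous_subspaceT ch); last by exists t.
by rewrite ge_min le_max h1 h2 orbT.
Qed.

Lemma within_comp (Y : set 'cV[R]_3) f (g : R -> 'cV[R]_3) : {within Y, continuous f} ->
  continuous g -> (forall t, Y (g t)) -> continuous (f \o g).
Proof.
move=> /subspace_continuousP cf cg Yg t.
apply: cvg_trans (cf _ (Yg t)) => U hU.
have hU' : nbhs (g t) [set y | Y y -> U (f y)] := hU.
have hg : nbhs t [set s | Y (g s) -> U (f (g s))] := cg t _ hU'.
by apply: (filterS (F := nbhs t)) hg => s; apply.
Qed.

Lemma continuous_line p e : continuous (line p e : R -> 'cV[R]_3).
Proof.
move=> t; apply: (mx_cvg (F := nbhs t)) => i j; rewrite /line.
under eq_fun do rewrite !mxE; rewrite !mxE.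
apply: cvgD; last by apply: cvgM; [exact: cvg_id|exact: cvg_cst].
apply: cvgM; last exact: cvg_cst.
apply: cvg_sqrt; apply: cvgD; first exact: cvg_cst.
exact: exprn_continuous.
Qed.

Lemma closed_points A : geodesic A -> closed (points A).
Proof.
move=> [u uu ->]; have -> : points (reflection u) = @hyp R `&` (mdot u @^-1` [set 0]).
  by apply/seteqP; split=> x /(points_reflection uu).
apply: closedI; first exact: closed_hyp.
by apply: continuous_comp_closed; [exact: continuous_mdot|exact: closed_eq].
Qed.

Lemma boundary_parametrization A : bdry A -> exists p e, [/\ hyp p, mdot e e = 1, mdot e p = 0,
  forall t, points A (line p e t) & forall x, points A x -> x = line p e (mdot e x)].
Proof.
move=> [gA AX]; have [p [pA _]] := geodesic_foot gA; have [u uu uE] := gA.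
rewrite uE in pA AX *; have [hp up] := (points_reflection uu p).1 pA.
have [e [ee ep eu]] := tangent uu (proj1 hp) up.
exists p, e; split=> // [t|x /(points_reflection uu)[hx ux]]; last exact: (lineP uu).
apply/points_reflection => //; split; first exact: hyp_line.
by rewrite mdot_line up (mdotC u) eu !mulr0 addr0.
Qed.

Lemma mdot_line_tangent p e t : mdot e e = 1 -> mdot e p = 0 -> mdot e (line p e t) = t.
Proof. by move=> ee ep; rewrite mdot_line ep ee mulr0 mulr1 add0r. Qed.

(* The inverse homeomorphism maps B into the frontier of the cover, hence by
   connectedness into a single boundary geodesic, and its image in that line is
   both closed and the range of an injective continuous function. *)
Lemma homeo_boundary f B : homeo O f -> bdry B -> exists2 A, bdry A & f @` points A = points B.
Proof.
move=> hf bB; have hf' := hf; have [cf [f' cf' ff'] _ _ _] := hf'.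
have [p [e [hp ee ep xB Bx]]] := boundary_parametrization bB.
have XB x : points B x -> X x by case: bB => _ h /h[].
pose g := f' \o line p e.
have cg : continuous g by apply: within_comp cf' (@continuous_line p e) _ => t; exact/XB.
have fg t : f (g t) = line p e t by have [] := ff' _ (XB _ (xB t)).
have Xg t : X (g t) by have [] := ff' _ (XB _ (xB t)).
have ng t : ~ inner X (g t).
  move=> /(homeo_inner hf); rewrite fg => i; case: bB => _ h; by case: (h _ (xB t)).
have bg t : exists2 A, bdry A & points A (g t).
  by have [A [gA Ag AX]] := cover_frontier (Xg t) (ng t); exists A.
have [A bA Ag0] := bg 0; exists A => //.
pose S := [set t | points A (g t)].
have loc t : \forall t' \near t, forall A', bdry A' -> points A' (g t) -> points A' (g t').
  have hgt := cover_hyp (Xg t).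
  have [B0 nB0] := boundary_near O hgt.
  have B0E := nbhs_singleton nB0.
  have hg : nbhs t [set s | forall A', bdry A' -> points A' (g s) -> A' = B0] := cg t _ nB0.
  apply: (filterS (F := nbhs t)) hg => t' h A' bA' A't.
  have [A'' bA'' A''t'] := bg t'.
  by rewrite (B0E _ bA' A't) -(h _ bA'' A''t').
have ST : S = setT.
  have cT : connected ([set: R]) by apply/connected_intervalP.
  apply: cT; first by exists 0.
    exists S; last by rewrite setTI.
    rewrite openE => t St; rewrite /interior; apply: filterS (loc t) => t' h.
    exact: h.
  exists S; last by rewrite setTI.
  rewrite -[S]setCK; apply: open_closedC; rewrite openE => t nSt; rewrite /interior.
  have [A' bA' A't] := bg t; apply: filterS (loc t) => t' h St'.
  by apply: nSt; rewrite /S /= (boundary_disjoint bA bA' St' (h _ bA' A't)).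
have Ag t : points A (g t) by have : S t by rewrite ST.
have [q [d [hq dd dq yA Ay]]] := boundary_parametrization bA.
have XA y : points A y -> X y by case: bA => _ h /h[].
pose h t := mdot d (g t).
have gE t : g t = line q d (h t) by exact: Ay.
have ch : continuous h by move=> t; apply: (continuous_comp (cg t)); exact: continuous_mdot.
have ih : injective h.
  move=> s t e'; have : f (g s) = f (g t) by rewrite !gE e'.
  by rewrite !fg => /(congr1 (mdot e)); rewrite !mdot_line_tangent.
have cr : closed (range h).
  have -> : range h = (f \o line q d) @^-1` points B.
    apply/seteqP; split=> [_ [t _ <-]|r /= Br]; first by rewrite /= -gE fg.
    exists (mdot e (f (line q d r))) => //.
    have Xl := XA _ (yA r); have [_ _ f'f _] := ff' _ Xl.
    by rewrite /h /g /= -Bx // f'f mdot_line_tangent.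
  apply: continuous_comp_closed; last by apply: closed_points; case: bB.
  by apply: within_comp cf (@continuous_line q d) _ => t; exact/XA.
apply/seteqP; split=> [_ [y /Ay yE <-]|x Bx'].
  have [t tE] := closed_range_surjective ch ih cr (mdot d y).
  by rewrite yE -tE -gE fg.
by exists (g (mdot e x)) => //; rewrite fg -Bx.
Qed.

Lemma homeo_points_act f w w' A B : (forall x, X x -> f (w *m x) = w' *m f x) ->
  isometry w -> isometry w' -> bdry A -> f @` points A = points B ->
  f @` points (act w A) = points (act w' B).
Proof.
move=> fw iw iw' bA AB; have XA y : points A y -> X y by case: bA => _ h /h[].
apply/seteqP; split=> [_ [x /points_actV h <-]|x /points_actV h].
  have Ax := h iw; rewrite -(isometryKV x iw) fw; last exact: XA.
  by apply/points_act => //; rewrite -AB; exists (w^-1 *m x).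
have := h iw'; rewrite -AB => -[y Ay yE]; exists (w *m y); first exact/points_act.
by rewrite fw ?yE ?isometryKV //; exact: XA.
Qed.

Lemma arc_image_surjective f b : homeo O f -> arc O b -> exists2 a, arc O a & arc_image f a = b.
Proof.
move=> hf [[B1 B2] /= [bB1 bB2 B12 bE]].
have [A1 bA1 A1E] := homeo_boundary hf bB1; have [A2 bA2 A2E] := homeo_boundary hf bB2.
have [_ _ fG fG' _] := hf.
exists (arc_of O A1 A2).
  exists (A1, A2); split=> //= e; apply: B12; rewrite e A2E in A1E.
  by apply: points_inj; [case: bB1|case: bB2|rewrite A1E].
have key w w' : grp O w -> grp O w' -> (forall x, X x -> f (w *m x) = w' *m f x) ->
    [set f @` Y | Y in [set points (act w A1); points (act w A2)]] =
    [set points (act w' B1); points (act w' B2)].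
  move=> Gw Gw' fw; have iw := grp_isometry_of Gw; have iw' := grp_isometry_of Gw'.
  rewrite image_setU !image_set1.
  by rewrite (homeo_points_act fw iw iw' bA1 A1E) (homeo_points_act fw iw iw' bA2 A2E).
rewrite bE; apply/seteqP; split=> [_ [_ [w Gw <-] <-]|_ [w' Gw' <-]].
  by have [w' Gw' fw] := fG _ Gw; exists w' => //; rewrite (key w w').
have [w Gw fw] := fG' _ Gw'; exists [set points (act w A1); points (act w A2)].
  by exists w.
exact: key.
Qed.

(** The arcs of nonzero weight in [m] are images of distinct arcs of the same weight in [m0]. This
    inequality suffices for crossing bounds that are uniform along the orbit. *)
Lemma orbit_total_weight Gam m0 m : finite_index_subgroup O Gam -> multiarc O m0 ->
  multiarc_orbit O Gam m0 m -> total_weight m <= total_weight m0.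
Proof.
move=> [[Ghomeo _] _ _ _ _] [m00 m0arc m0fin _] [[m_0 marc mfin _] [f Gf fm]].
have hf := Ghomeo _ Gf.
have ex b : exists a, arc O b -> arc O a /\ arc_image f a = b.
  have [/(arc_image_surjective hf)[a aa ab]|nb] := pselect (arc O b); first by exists a.
  by exists b.
have [pre hpre] := choice ex.
rewrite /total_weight.
have -> : \sum_(b <- fset_set (weight_support m)) m b =
    \sum_(a <- map pre (fset_set (weight_support m))) m0 a.
  rewrite big_map big_seq [RHS]big_seq; apply: eq_bigr => b; rewrite in_fset_set // => /set_mem mb.
  by have [aa {1}<-] := hpre _ (marc _ mb); rewrite fm.
apply: sum_uniq_le => //.
- rewrite map_inj_in_uniq ?fset_uniq // => b b'; rewrite !in_fset_set // => /set_mem mb /set_mem mb' e.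
  by have [_ <-] := hpre _ (marc _ mb); have [_ <-] := hpre _ (marc _ mb'); rewrite e.
- move=> _ /mapP[b mb ->]; rewrite in_fset_set //; apply/mem_set.
  move: mb; rewrite in_fset_set // => /set_mem mb; have [aa ab] := hpre _ (marc _ mb).
  by rewrite /weight_support /= -(fm _ aa) ab.
Qed.

End Homeomorphisms.

(** * From weak convergence to counting *)

Section HomogeneousSqueeze.
Variable R : realType.

Lemma exprz_near1 (d : int) (x y : R) : x < y -> exists2 t : R, 1 < t & t ^ d * x < y.
Proof.
move=> xy.
have c : t ^ d @[t --> (1 : R)] --> (1 : R).
  case: d => n; first by rewrite -[X in _ --> X](expr1n _ n); exact: exprn_continuous.
  rewrite NegzE; under eq_fun do rewrite -exprnN.
  have h : (t ^+ n.+1)^-1 @[t --> (1 : R)] --> ((1 : R) ^+ n.+1)^-1.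
    by apply: cvgV; [rewrite expr1n oner_neq0|exact: exprn_continuous].
  by rewrite expr1n invr1 in h.
have c' : t ^ d * x @[t --> (1 : R)^'+] --> x.
  by rewrite -[X in _ --> X]mul1r; apply: cvgMl; exact: cvg_at_right_filter.
near ((1 : R)^'+) => t; exists t; first by near: t; exact: nbhs_right_gt.
by near: t; exact: cvgr_lt c' _ xy.
Unshelve. all: by end_near. Qed.

Lemma near_pinfty_mul (P : R -> Prop) (t : R) : 0 < t -> (\forall L \near +oo, P L) -> \forall L \near +oo, P (t * L).
Proof.
move=> t0 h; have c := gt0_cvgMry t0 (@cvg_id _ (+oo : set_system R)).
exact: (c _ _ h).
Qed.

(** Exact scaling gives [n L 2 = t ^ d * n (t * L) (2 / t)]. For [t] slightly above 1, the level
    [2 / t] is below 2 and is controlled by the first comparison, at the price of a factor [t ^ d]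
    close to 1; dually, the level [2 * t] gives the lower bound. The value [V] is allowed to be
    infinite. *)
Lemma homogeneous_squeeze (n : R -> R -> \bar R) (V : \bar R) (d : int) :
  (0 <= V)%E ->
  (forall L s t, 0 < t -> 0 < L -> n L (t * s) = ((t ^ d)%:E * n (t * L)%R s)%E) ->
  (forall s, 0 < s < 2 -> exists (J : R -> \bar R) j,
    [/\ forall L, 1 <= L -> (n L s <= J L)%E, J L @[L --> +oo] --> j & (j <= V)%E]) ->
  (forall s, 2 < s -> exists (J : R -> \bar R) j,
    [/\ forall L, 1 <= L -> (J L <= n L s)%E, J L @[L --> +oo] --> j & (V <= j)%E]) ->
  n L 2 @[L --> +oo] --> V.
Proof.
move=> V0 nM up low.
have ge1 (t : R) : 0 < t -> \forall L \near +oo, 1 <= t * L.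
  by move=> t0; apply: (@near_pinfty_mul (fun x => 1 <= x) t t0); exact: nbhs_pinfty_ge (num_real _).
have pos : \forall L \near +oo, 0 < L :> R by exact: nbhs_pinfty_gt (num_real _).
have upper (y : R) : (V < y%:E)%E -> \forall L \near +oo, (n L 2%R < y%:E)%E.
  case: V V0 up {low} => // r _ up; rewrite lte_fin => ry.
  have [t t1 ht] := exprz_near1 d ry; have t0 : 0 < t by lra.
  have td : 0 < t ^ d by exact: exprz_gt0.
  have [|J [j [nJ Jj jr]]] := up (2 / t).
    by rewrite divr_gt0 //= ltr_pdivrMr //; lra.
  have jz : (j < (y / t ^ d)%:E)%E.
    by apply: le_lt_trans jr _; rewrite lte_fin ltr_pdivlMr // mulrC.
  have nJz : \forall L \near +oo, (J L < (y / t ^ d)%:E)%E.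
    have nb : nbhs j [set z | (z < (y / t ^ d)%:E)%E].
      by apply: open_nbhs_nbhs; split=> //; exact: open_ereal_lt_ereal.
    exact: (Jj _ nb).
  near=> L; have L0 : 0 < L by near: L.
  have -> : (2 : R) = t * (2 / t) by rewrite mulrCA divff ?mulr1 // gt_eqF.
  rewrite nM // -lte_pdivlMl // -EFinM [X in X%:E]mulrC; apply: le_lt_trans (nJ _ _) _.
    by near: L; exact: ge1.
  by near: L; exact: (near_pinfty_mul _ nJz).
have lower (y : R) : (y%:E < V)%E -> \forall L \near +oo, (y%:E < n L 2%R)%E.
  move=> yV; have [t t1 ht] : exists2 t : R, 1 < t & ((t ^ d * y)%:E < V)%E.
    case: V yV {V0 up low upper} => // [r|_]; last by exists 2; rewrite ?ltry //; lra.
    by rewrite lte_fin => /(exprz_near1 d)[t t1 h]; exists t.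
  have t0 : 0 < t by lra.
  have td : 0 < t ^ d by exact: exprz_gt0.
  have [|J [j [nJ Jj jr]]] := low (t * 2); first by lra.
  have nJz : \forall L \near +oo, ((t ^ d * y)%:E < J L)%E.
    have nb : nbhs j [set z | ((t ^ d * y)%:E < z)%E].
      apply: open_nbhs_nbhs; split; first exact: open_ereal_gt_ereal.
      exact: lt_le_trans jr.
    exact: (Jj _ nb).
  have ti : 0 < t^-1 by rewrite invr_gt0.
  near=> L; have L0 : 0 < L by near: L.
  have LE : L = t * (t^-1 * L) by rewrite mulrA divff ?mul1r // gt_eqF.
  suff h : ((t ^ d)%:E * y%:E < (t ^ d)%:E * n (t * (t^-1 * L))%R 2%R)%E.
    by move: h; rewrite -LE lte_pmul2l.
  rewrite -nM ?mulr_gt0 // -EFinM.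
  apply: lt_le_trans (nJ _ _); last by near: L; exact: ge1.
  by near: L; exact: (near_pinfty_mul _ nJz).
case: V V0 {up low} upper lower => // [r _|_] upper lower.
  apply/fine_cvgP; split.
    near=> L; rewrite fin_numE; apply/andP; split.
      rewrite gt_eqF //; apply: (@lt_trans _ _ (r - 1)%:E); first exact: ltNyr.
      by near: L; apply: lower; rewrite lte_fin; lra.
    rewrite lt_eqF //; apply: (@lt_trans _ _ (r + 1)%:E); last exact: ltry.
    by near: L; apply: upper; rewrite lte_fin; lra.
  apply/cvgrPdist_lt => e e0; near=> L.
  have h1 : ((r - e)%:E < n L 2%R)%E by near: L; apply: lower; rewrite lte_fin; lra.
  have h2 : (n L 2%R < (r + e)%:E)%E by near: L; apply: upper; rewrite lte_fin; lra.
  rewrite /=; move: h1 h2; case: (n L 2%R) => //= x; rewrite !lte_fin => h1 h2.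
  by rewrite ltr_norml; apply/andP; split; lra.
by apply/cvgeyPgt => A; apply: lower; exact: ltry.
Unshelve. all: by end_near. Qed.

End HomogeneousSqueeze.

(** * Coercivity of [Fbar] *)

Section Coercivity.
Variables (R : realType) (O : orbifold R).
Implicit Types (w A B : 'M[R]_3) (u v : 'cV[R]_3).
Let X := cover O.
Notation T := 'M[R]_3.
Notation BT := (borel T).
Notation cs := (@compactly_supported R T).
Notation bdry := (boundary_geodesic O).
Notation W := (reflection_group O).
Notation D := (dgrp O).
Hypothesis Wfin : forall c, finite_set [set w | W w /\ w ord_max ord_max <= c].
Hypothesis hatE : forall (mu : currents O) E, measurable E ->
  mval (hat O (mval mu)) E = (iplus O (mval mu) E + iminus O (mval mu) E)%E.

Lemma compact_seq_cluster (S : topologicalType) (K : set S) (x : nat -> S) : compact K ->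
  (forall n, K (x n)) -> exists2 p, K p &
    forall C, closed C -> (\forall n \near \oo, C (x n)) -> C p.
Proof.
move=> cK Kx; have FK : \forall n \near \oo, K (x n) by exact: nearW.
have [p [Kp clp]] := cK (x @ \oo) _ FK.
exists p => // C cC Cx; apply: cC => B nB.
exact: (clp C B Cx nB).
Qed.

Lemma hat_invariant (mu : currents O) w f : W w -> cs f ->
  \int[mval (hat O (mval mu))]_A f (act w A) = \int[mval (hat O (mval mu))]_A f A.
Proof.
move=> Ww csf; have iw := refl_isometry Ww; have lf := current_lf (hat O (mval mu)).
have uw := isometry_unit iw; have [_ _ inv] := currentP mu.
apply: invariant_Rintegral => //.
- move=> E mE; have mE' := measurable_act w mE.
  rewrite !hat_coset_sum //.
  rewrite -[RHS](@esum_lcosets_reindex R (grp O) W _ _ _ _ (fun x : T => w * x) (fun x : T => w^-1 * x)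
    (fun x => mval mu (act x @^-1` E))) //.
  + apply: eq_esum => c cW; have ir := tile_isometry cW; congr (mval mu _).
    by apply/seteqP; split=> A; rewrite /= actM.
  + exact: grp_subgroup.
  + exact: grp_isometry_of.
  + exact: refl_isometry.
  + exact: refl_grp.
  + move=> x k Wx Gk; have ix := refl_isometry Wx; have ik := grp_isometry_of Gk.
    rewrite -(inv k _ Gk (measurable_act x mE)); congr (mval mu _).
    by apply/seteqP; split=> A; rewrite /= actM.
  + by move=> x; exact: reflM.
  + by move=> x; apply: reflM; exact: reflV.
  + by move=> x _; rewrite mulrA mulVr ?mul1r.
  + by move=> x _; rewrite mulrA mulrV ?mul1r.
  + by move=> x k _ Gk; exists k => //; rewrite mulrA.
  + by move=> x k _ Gk; exists k => //; rewrite mulrA.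
- by apply: continuous_measurable_borel; case: csf.
- by apply: cs_integrable => //; exact: cs_act.
Qed.

(** A wall crossing [A] would meet it at a point that is not interior to the cover, and the boundary
    geodesic through that point would have to coincide both with [A] and with the wall. *)
Lemma cover_uncrossed A : geodesics_in X A -> uncrossed O A.
Proof.
move=> [gA AX]; split=> // v vv wv; rewrite leNgt; apply/negP => h.
have [n nn nE] := gA; rewrite nE in gA AX h.
have nv : mdot n v ^+ 2 < 1 by move: h; rewrite mdot_self_reflection //; lra.
have [y [hy ny vy]] := crossing_point nn vv nv.
have Ay : points (reflection n) y by apply/points_reflection.
have Vy : points (reflection v) y by apply/points_reflection.
have niy := wall_inner wv Vy.
have [C [gC Cy CX]] := cover_frontier (AX _ Ay) niy.
have bC : bdry C by split.
have e1 : reflection n = C by exact: (boundary_tangent gA AX bC Ay Cy).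
have e2 : reflection v = C by exact: (wall_boundary wv bC Vy Cy).
have := reflection_inj nn vv (etrans e1 (esym e2)).
by case=> e; move: nv; rewrite e ?mdotNl vv ?sqrrN expr1n ltxx.
Qed.

Lemma transversal_uncrossed v (e k : R) A : mdot v v = 1 -> wall O (reflection v) -> 0 < e ->
  uncrossed O A -> transversal v e k A = 0.
Proof.
move=> vv wv e0 [_ h]; have h' := h v vv wv; rewrite /transversal.
suff -> : Num.max 0 (mdot v (A *m v) + 1 - e) = 0 by rewrite mul0r.
by apply/max_idPl; lra.
Qed.

Lemma hat_transversal (mu : currents O) v (e k : R) : mdot v v = 1 -> wall O (reflection v) -> 0 < e ->
  \int[mval (hat O (mval mu))]_A transversal v e k A = 0.
Proof.
move=> vv wv e0; have cst := cs_transversal v e k; have [_ [j hj]] := (csP _).1 cst.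
rewrite (hat_integral Wfin hatE mu cst hj) big_seq big1 // => c.
rewrite in_fset_set; last exact: finite_tiles.
move=> /set_mem[cW _]; have Wc := tile_reprW cW; have [_ mu0 _] := currentP mu.
have csc := cs_act (refl_isometry Wc) cst.
have mX : measurable (geodesics_in X : set BT) by apply: measurable_geodesics_in; exact: cover_closed.
rewrite (carried_Rintegral mX mu0 (cs_integrable (current_lf mu) csc)) /Rintegral integral0_eq // => A AX.
rewrite /= transversal_uncrossed //; apply: uncrossed_act => //; exact: cover_uncrossed.
Qed.

Variable c0 : R.
Hypothesis Dc0 : forall x, @hyp R x -> exists2 w, D w & (w *m x) ord_max 0 <= c0.
Notation len := (@length R D (@hyp R) c0).

Lemma length_point : len point = 0.
Proof. by rewrite /length /mval /= /Rintegral integral_measure_zero. Qed.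

Lemma length_eq0 nu : len nu = 0 -> nu = point.
Proof.
move=> l0; apply: current_ext_tests => f csf _.
have [b b0 hb] := length_bound (@dgrp_isometry R O) (@closed_hyp R) Dc0 csf.
have := hb nu; rewrite l0 mulr0 normr_le0 => /eqP ->.
by rewrite /mval /= /Rintegral integral_measure_zero.
Qed.

Variable Fbar : dcurrents O -> R.
Hypothesis Fcont : continuous Fbar.
Hypothesis Fhom : forall t nu, 0 < t -> Fbar (scale t nu) = t * Fbar nu.
Hypothesis Fpos : positive_extension Fbar.

(** With [bound] as a parameter, coercivity applies at once to the doubled multiarcs of an orbit,
    whose bound comes from [transversal_bound], and to the doubles of currents of [O], whose
    crossing integrals vanish. *)
Definition admissible (bound : 'cV[R]_3 -> R -> R -> R) (nu : dcurrents O) :=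
  (forall w f, W w -> cs f -> \int[mval nu]_A f (act w A) = \int[mval nu]_A f A) /\
  (forall v e k, mdot v v = 1 -> wall O (reflection v) -> 0 < e ->
     \int[mval nu]_A transversal v e k A <= bound v e k).

(* Otherwise, rescaled to length one, a sequence of violating currents would
   accumulate at the double of a nonzero current on which Fbar is not positive. *)
Lemma coercive bound : exists e L0 : R, [/\ 0 < e, 0 < L0 &
  forall nu, admissible bound nu -> L0 <= len nu -> e * len nu <= Fbar nu].
Proof.
apply: contrapT => no.
have ex (n : nat) : exists nu, [/\ admissible bound nu, n.+1%:R <= len nu & Fbar nu < n.+1%:R^-1 * len nu].
  apply: contrapT => no'; apply: no; exists n.+1%:R^-1, n.+1%:R; split; rewrite ?invr_gt0 //.
  move=> nu anu lnu; rewrite leNgt; apply/negP => h; apply: no'; exists nu; split=> //.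
have [nu hnu] := choice ex.
have l0 n : 0 < len (nu n) by have [_ h _] := hnu n; apply: lt_le_trans h; rewrite ltr0n.
pose x n := scale (len (nu n))^-1 (nu n).
have li n : 0 < (len (nu n))^-1 by rewrite invr_gt0.
have lx n : len (x n) = 1.
  by rewrite /x (scale_length (@closed_hyp R)) ?ltW // mulVf // gt_eqF.
have cK := @compact_length R D (@hyp R) (@dgrp_isometry R O) (@closed_hyp R) c0 Dc0 1.
have [|p _ hp] := compact_seq_cluster (x := x) cK; first by move=> n; rewrite /= lx.
have clos (h : dcurrents O -> R) (r : R) : continuous h -> (\forall n \near \oo, h (x n) <= r) -> h p <= r.
  move=> ch hr; apply: (hp [set q | h q <= r]) => //.
  by apply: (continuous_comp_closed (D := [set y : R | y <= r])) => //; exact: closed_le.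
have cpair f : cs f -> continuous (fun q : dcurrents O => \int[mval q]_A f A).
  by move=> csf; exact: continuous_pairing.
have xpair n f : cs f -> \int[mval (x n)]_A f A = (len (nu n))^-1 * \int[mval (nu n)]_A f A.
  by move=> csf; rewrite (scale_pairing (@closed_hyp R)) // ltW.
have lp : len p = 1.
  have cl := @continuous_length R D (@hyp R) c0.
  apply: le_anti; apply/andP; split; first by apply: clos => //; apply: nearW => n; rewrite lx.
  rewrite -lerN2 -sub0r; apply: (clos (fun q => 0 - len q)).
    by apply: continuousBR => //; exact: continuous_cstR.
  by apply: nearW => n; rewrite lx sub0r.
have inv n w f : W w -> cs f -> \int[mval (x n)]_A f (act w A) = \int[mval (x n)]_A f A.
  move=> Ww csf; rewrite !xpair //; last exact: cs_act (refl_isometry Ww) csf.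
  by have [[h _] _ _] := hnu n; rewrite h.
have pinv w f : W w -> cs f -> \int[mval p]_A f (act w A) = \int[mval p]_A f A.
  move=> Ww csf; have csw := cs_act (refl_isometry Ww) csf.
  apply: le_anti; apply/andP; split; rewrite -subr_le0.
    apply: (clos (fun q => \int[mval q]_A f (act w A) - \int[mval q]_A f A)).
      by apply: continuousBR; [exact: cpair csw|exact: cpair].
    by apply: nearW => n; rewrite inv // subrr.
  apply: (clos (fun q => \int[mval q]_A f A - \int[mval q]_A f (act w A))).
    by apply: continuousBR; [exact: cpair|exact: cpair csw].
  by apply: nearW => n; rewrite inv // subrr.
have small (h : dcurrents O -> R) (b : R) : continuous h -> (forall n, h (x n) <= n.+1%:R^-1 * b) -> h p <= 0.
  move=> ch hb; apply/ler_addgt0Pl => e e0; rewrite addr0; apply: clos => //.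
  near=> n; apply: le_trans (hb n) _.
  have b0 : b <= `|b| by exact: ler_norm.
  apply: (@le_trans _ _ (n.+1%:R^-1 * `|b|)); first by apply: ler_wpM2l.
  rewrite ler_pdivrMl ?ltr0n //.
  have : `|b| / e <= n.+1%:R by apply: (@le_trans _ _ n%:R); [near: n; exact: nbhs_infty_ger|rewrite ler_nat].
  by rewrite ler_pdivrMr.
have ptr v e k : mdot v v = 1 -> wall O (reflection v) -> 0 < e ->
    \int[mval p]_A transversal v e k A = 0.
  move=> vv wv e0; have cst := cs_transversal v e k; apply: le_anti; apply/andP; split; last first.
    by apply: Rintegral_ge0 => A _; exact: transversal_ge0.
  apply: (small (fun q => \int[mval q]_A transversal v e k A) `|bound v e k|).
    exact: cpair.
  move=> n; rewrite xpair //; have [[_ h] ln _] := hnu n.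
  apply: (@le_trans _ _ ((len (nu n))^-1 * `|bound v e k|)).
    apply: ler_wpM2l; first exact: ltW.
    by apply: le_trans (h _ _ _ vv wv e0) _; exact: ler_norm.
  by apply: ler_wpM2r => //; rewrite lef_pV2 ?posrE ?ltr0n.
have pF : Fbar p <= 0.
  apply: (small Fbar 1) => // n; rewrite mulr1 /x Fhom //.
  have [_ _ h] := hnu n; rewrite ler_pdivrMl // mulrC; exact: ltW.
have [mu pE] := hat_surjective Wfin hatE pinv ptr.
have mu0 : mu <> point.
  move=> E; move: lp; rewrite pE; suff -> : hat O (mval mu) = point by rewrite length_point; lra.
  apply: current_ext => E' mE'; rewrite hatE // E /iplus /iminus /translates /mval /= /mzero.
  by rewrite !esum1 // adde0.
have := Fpos mu0; rewrite /on_currents -pE; lra.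
Unshelve. all: by end_near. Qed.

End Coercivity.

Lemma continuous_comp2 (S1 S2 S3 : topologicalType) (f : S1 -> S2) (g : S2 -> S3) :
  continuous f -> continuous g -> continuous (fun x => g (f x)).
Proof. by move=> cf cg x; exact: (continuous_comp (cf x) (cg _)). Qed.

Section MeasureBounds.
Variable R : realType.

Lemma counting_esum (I : choiceType) (A : set I) : counting A = (\esum_(a in A) 1 : \bar R)%E.
Proof.
rewrite /counting; case: ifPn => /asboolP finA.
  rewrite esum_fset // fsbig_finite //= sumEFin big_const_seq count_predT iter_addr_0.
  by [].
apply/esym/eqP; rewrite -leye_eq leNgt; apply/negP => h; apply: finA.
exact: (esum_finite_set (A := A) (S := A) (a := fun=> 1%E)) h.
Qed.

Lemma as_measureE (T : ptopologicalType) (m : set (borel T) -> \bar R) (nu : borel_measure R T) :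
  (forall E, measurable E -> nu E = m E) -> forall E, measurable E -> as_measure m E = m E.
Proof. by move=> h; rewrite /as_measure; case: xgetP => [mu _ //|/(_ nu)]. Qed.

Lemma integral_bounds (T : ptopologicalType) (mu : borel_measure R T) (f : T -> R) (E E' : set (borel T)) :
  continuous f -> measurable E -> measurable E' -> (forall x, 0 <= f x <= 1) ->
  (forall x, E x -> f x = 1) -> (forall x, ~ E' x -> f x = 0) ->
  (mu E <= \int[mu]_x (f x)%:E <= mu E')%E.
Proof.
move=> cf mE mE' f01 fE fE'.
have mf : measurable_fun setT (fun x : borel T => (f x)%:E).
  by apply/measurable_EFinP; exact: continuous_measurable_borel.
have mi (F : set (borel T)) : measurable F -> measurable_fun setT (fun x : borel T => (\1_F x)%:E : \bar R).
  by move=> mF; apply/measurable_EFinP; exact: measurable_indic.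
have ii (F : set (borel T)) : measurable F -> mu F = (\int[mu]_x (\1_F x)%:E)%E.
  by move=> mF; rewrite integral_indic // setIT.
apply/andP; split.
  rewrite (ii E mE); apply: ge0_le_integral => //; try exact: mi.
  move=> x _; rewrite lee_fin indicE; case: (boolP (x \in E)) => [/set_mem/fE -> //|_].
  by case/andP: (f01 x).
rewrite (ii E' mE'); apply: ge0_le_integral => //; try exact: mi.
- by move=> x _; rewrite lee_fin; case/andP: (f01 x).
move=> x _; rewrite lee_fin indicE; case: (boolP (x \in E')) => [_|/negP nE].
  by case/andP: (f01 x).
by rewrite fE' // => h; apply: nE; exact/mem_set.
Qed.

Definition cutoff (a b y : R) : R := Num.min 1 (Num.max 0 ((b - y) / (b - a))).

Lemma cutoff01 a b y : 0 <= cutoff a b y <= 1.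
Proof. by rewrite /cutoff le_min ler01 le_max lexx ge_min lexx. Qed.

Lemma cutoff1 a b y : a < b -> y <= a -> cutoff a b y = 1.
Proof.
move=> ab ya; apply/min_idPl; rewrite le_max; apply/orP; right.
by rewrite ler_pdivlMr ?subr_gt0 // mul1r lerD2l lerN2.
Qed.

Lemma cutoff0 a b y : a < b -> b <= y -> cutoff a b y = 0.
Proof.
move=> ab yb; rewrite /cutoff (max_idPl _) ?(min_idPr _) //.
by rewrite ler_pdivrMr ?subr_gt0 // mul0r subr_le0.
Qed.

Lemma continuous_cutoff (S : topologicalType) (f : S -> R) a b : continuous f ->
  continuous (fun x => cutoff a b (f x)).
Proof.
move=> cf; apply: continuous_minR; first exact: continuous_cstR.
apply: continuous_maxR; first exact: continuous_cstR.
apply: continuousMR; last exact: continuous_cstR.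
by apply: continuousBR => //; exact: continuous_cstR.
Qed.

End MeasureBounds.

(** * The counting asymptotics *)

Section Counting.
Variables (R : realType) (O S : orbifold R).
Notation T := 'M[R]_3.
Notation BT := (borel T).
Notation cs := (@compactly_supported R T).
Notation bdry := (boundary_geodesic O).
Notation W := (reflection_group O).
Notation D := (dgrp O).
Variables (Gam : set ('cV[R]_3 -> 'cV[R]_3)) (Gam_index : finite_index_subgroup O Gam).
Variables (a0 : weights R) (a0_multiarc : multiarc O a0).
Variables (F : weights R -> R) (Fbar : dcurrents O -> R).
Hypotheses (F_extends : extends F Fbar) (F_positive : positive_extension Fbar).
Hypothesis O_boundary : bdry !=set0.
Notation orb := (multiarc_orbit O Gam a0).

Let Fcont : continuous Fbar. Proof. by case: F_extends. Qed.
Let Fhom t nu : 0 < t -> Fbar (scale t nu) = t * Fbar nu. Proof. by case: F_extends => _ h _; exact: h. Qed.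
Let Wfin c : finite_set [set w | W w /\ w ord_max ord_max <= c].
Proof. by have [B bB] := O_boundary; exact: (refl_finite Fhom F_positive bB). Qed.
Let hatE' (mu : currents O) E : measurable E ->
  mval (hat O (mval mu)) E = (iplus O (mval mu) E + iminus O (mval mu) E)%E.
Proof. exact: (hatE Fhom F_positive). Qed.

Lemma length_control : exists (len : dcurrents O -> R) (e L0 : R), [/\ 0 < e, 0 < L0, continuous len,
  forall c, compact [set nu | len nu <= c] &
  [/\ forall t nu, 0 <= t -> len (scale t nu) = t * len nu,
      forall a, orb a -> L0 <= len (hat_multiarc O a) -> e * len (hat_multiarc O a) <= Fbar (hat_multiarc O a) &
      forall mu : currents O, e * len (hat O (mval mu)) <= Fbar (hat O (mval mu))]].
Proof.
have [c0 Dc0] := dgrp_height Wfin O_boundary.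
have ex (p : 'cV[R]_3 * R * R) : exists b : R, 0 <= b /\ (mdot p.1.1 p.1.1 = 1 -> wall O (reflection p.1.1) ->
    0 < p.1.2 -> forall a, orb a -> \int[mval (hat_multiarc O a)]_A transversal p.1.1 p.1.2 p.2 A <= b).
  case: p => -[v e] k /=; have [[vv [wv e0]]|no] := pselect (mdot v v = 1 /\ wall O (reflection v) /\ 0 < e).
    have [C C0 hC] := transversal_bound Wfin k vv wv e0.
    have t0 : 0 <= total_weight a0 by apply: sumr_ge0 => a _; case: a0_multiarc.
    exists (C * total_weight a0); split; first exact: mulr_ge0.
    move=> _ _ _ a oa; apply: le_trans (hC a _) _; first by case: oa.
    by apply: ler_wpM2l => //; exact: orbit_total_weight oa.
  by exists 0; split=> // vv wv e0; case: no.
have [b hb] := choice ex.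
pose bound v e k := b (v, e, k).
have [e [L0 [e0 L00 coer]]] := coercive Wfin hatE' Dc0 Fcont Fhom F_positive bound.
pose len := @length R D (@hyp R) c0.
have {}coer nu : admissible bound nu -> L0 <= len nu -> e * len nu <= Fbar nu := @coer nu.
have lscale t nu : 0 <= t -> len (scale t nu) = t * len nu by move=> t0; rewrite /len (scale_length (@closed_hyp R)).
exists len, e, L0; split=> //.
- exact: continuous_length.
- by move=> c; exact: compact_length (@dgrp_isometry R O) (@closed_hyp R) _ Dc0 c.
split=> // [a oa|mu].
  apply: coer; split=> [w f Ww csf|v e' k vv wv e'0]; first by apply: hat_multiarc_invariant => //; case: oa.
  by have [_ h] := hb (v, e', k); exact: h.
set nu := hat O (mval mu); have l0 : 0 <= len nu by exact: length_ge0.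
have [lz|lnz] := eqVneq (len nu) 0.
  by rewrite lz mulr0 (length_eq0 Dc0 lz) (Fbar0 Fhom).
have lp : 0 < len nu by rewrite lt_def lnz.
(* For the double of a current of [O], admissibility is stable under scaling and both sides of the
   inequality are homogeneous; rescaling to length [L0] removes the length threshold. *)
have t0 : 0 < L0 / len nu by rewrite divr_gt0.
have pair f : cs f -> \int[mval (scale (L0 / len nu) nu)]_A f A = L0 / len nu * \int[mval nu]_A f A.
  by move=> csf; rewrite (scale_pairing (@closed_hyp R)) // ltW.
have := coer (scale (L0 / len nu) nu); rewrite lscale; last exact: ltW.
rewrite divfK // lexx => /(_ _ isT).
rewrite Fhom // => h; have : e * L0 <= L0 / len nu * Fbar nu.
  apply: h; split=> [w f Ww csf|v e' k vv wv e'0].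
    rewrite !pair //; last exact: cs_act (refl_isometry Ww) csf.
    by rewrite (hat_invariant hatE').
  rewrite pair; last exact: cs_transversal.
  rewrite (hat_transversal Wfin hatE') // mulr0; by have [] := hb (v, e', k).
rewrite -mulrA (mulrC e) ler_pM2l // mulrC ler_pdivlMr //.
Qed.

Section Limit.
Variables (m : {measure set (borel (ML S)) -> \bar R}) (Phi : ML S -> ML O) (d : int) (c : R).
Hypotheses (Phi_continuous : continuous Phi) (c_constant : counting_constant m Phi Gam a0 d c).

Definition ML_current (lam : ML O) : currents O :=
  exist _ (mval lam) (let: And3 h _ _ := svalP lam in h).

Lemma ML_hat_continuous : continuous (fun lam : ML O => hat O (mval lam)).
Proof.
have ci : continuous ML_current.
  by apply: continuous_to_mspace => f csf; exact: continuous_pairing.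
have ch : continuous (fun mu : currents O => hat O (mval mu)) by exact: (hat_continuous Wfin hatE').
exact: (continuous_comp2 ci ch).
Qed.

Definition ratio L s : \bar R := counting_measure orb (fun L a => scale L^-1 (hat_multiarc O a)) d L
  [set nu : borel (dcurrents O) | Fbar nu <= s].

Definition limit_volume s : \bar R := (c%:E * hat_thurston m Phi [set nu : borel (dcurrents O) | (Fbar nu <= s)%R])%E.

Lemma measurable_sublevel (len : dcurrents O -> R) s : continuous len ->
  measurable ([set nu | len nu <= s] : set (borel (dcurrents O))).
Proof.
move=> cl; apply: closed_measurable_borel.
by apply: (continuous_comp_closed (D := [set y : R | y <= s])) => //; exact: closed_le.
Qed.

Lemma counting_measure_sum L E : counting_measure orb (fun L a => scale L^-1 (hat_multiarc O a)) d L E =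
  (((L ^ d)^-1)%:E * \esum_(a in orb) (\d_(scale L^-1 (hat_multiarc O a) : borel (dcurrents O)) E))%E.
Proof. by []. Qed.

(** The length cutoff makes [f] compactly supported. By coercivity it equals 1 at every point with
    [Fbar] at most [s] that the measures in question charge, so that the integrals of [f] compare
    with the levels [s] and [s'] alone. *)
Lemma squeeze s s' : 0 < s -> s < s' -> exists (J : R -> \bar R) j,
  [/\ J L @[L --> +oo] --> j,
      forall L, 1 <= L -> (ratio L s <= J L)%E /\ (J L <= ratio L s')%E &
      (limit_volume s <= j)%E /\ (j <= limit_volume s')%E].
Proof.
move=> s0 ss'; have [len [e [L0 [e0 L00 clen cK [lscale lorb lhat]]]]] := length_control.
(* Take a double scaled by [L^-1] with [L >= 1] and with [Fbar] at most [s]. If the length before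
   scaling is at least [L0], coercivity bounds the scaled length by [s / e]; otherwise the scaled
   length is below [L0] as well. *)
pose C := Num.max L0 (s / e).
pose f nu := cutoff s s' (Fbar nu) * cutoff C (C + 1) (len nu).
have CC : C < C + 1 by lra.
have cf : continuous f by apply: continuousMR; exact: continuous_cutoff.
have f01 nu : 0 <= f nu <= 1.
  have /andP[h1 h2] := cutoff01 s s' (Fbar nu); have /andP[h3 h4] := cutoff01 C (C + 1) (len nu).
  by rewrite mulr_ge0 //= mulr_ile1.
have csf : compactly_supported f.
  split=> //; exists [set nu | len nu <= C + 1]; first exact: cK.
  move=> nu; apply: contraNP => /negP; rewrite -ltNge => h.
  by rewrite /f (cutoff0 CC (ltW h)) mulr0.
pose E : set (borel (dcurrents O)) := [set nu | Fbar nu <= s] `&` [set nu | len nu <= C].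
pose E' : set (borel (dcurrents O)) := [set nu | Fbar nu <= s'].
have mE : measurable E by apply: measurableI; exact: measurable_sublevel.
have mE' : measurable E' by exact: measurable_sublevel.
have fE nu : E nu -> f nu = 1.
  by move=> [h1 h2]; rewrite /f cutoff1 // cutoff1 // mulr1.
have fE' nu : ~ E' nu -> f nu = 0.
  move=> /negP; rewrite /= -ltNge => h; by rewrite /f (cutoff0 ss' (ltW h)) mul0r.
have [c_ge0 cvg] := c_constant.
set mL := counting_measure orb _ d in cvg.
set mO := (fun E => _) in cvg.
(* In both cases [as_measure] avoids its default: the limit is a multiple of the image of [m] under
   a continuous map, and the counting measures are multiples of sums of Dirac masses. *)
have asO F' : measurable F' -> as_measure mO F' = mO F'.
  have [nu [nuE _]] := image_measure m (continuous_comp2 Phi_continuous ML_hat_continuous).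
  apply: (as_measureE (nu := mscale (NngNum c_ge0) nu)) => F'' mF''.
  by rewrite /mscale; congr (_ * _)%E; exact: nuE.
have asL L F' : 0 < L -> measurable F' -> as_measure (mL L) F' = mL L F'.
  move=> L1.
  have [nu nuE] := esum_measure orb (fun a => \d_(scale L^-1 (hat_multiarc O a) : borel (dcurrents O)) : {measure set _ -> \bar R}).
  have Ld : 0 <= (L ^ d)^-1 by rewrite invr_ge0 ltW // exprz_gt0.
  apply: (as_measureE (nu := mscale (NngNum Ld) nu)) => F'' mF''.
  by rewrite /mscale; congr (_ * _)%E; exact: nuE.
exists (fun L => (\int[as_measure (mL L)]_nu (f nu)%:E)%E), (\int[as_measure mO]_nu (f nu)%:E)%E.
split; first exact: cvg.
- move=> L L1; have L0' : 0 < L by lra.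
  have /andP[h1 h2] := integral_bounds (as_measure (mL L)) cf mE mE' f01 fE fE'.
  rewrite !asL // in h1 h2; split=> //; apply: le_trans h1.
  rewrite /ratio -/mL /mL !counting_measure_sum le_eqVlt; apply/orP; left; apply/eqP; congr (_ * _)%E.
  apply: eq_esum => a oa; rewrite !diracE; congr (_%:R%:E); congr nat_of_bool.
  apply/idP/idP => /set_mem h; apply/mem_set; last by case: h.
  split=> //; rewrite /= lscale; last by rewrite invr_ge0 ltW.
  move: h; rewrite /= Fhom ?invr_gt0 // ler_pdivrMl // => h.
  rewrite ler_pdivrMl // /C; have [h1'|h1'] := leP L0 (len (hat_multiarc O a)).
    have := lorb _ oa h1' => h2'; apply: (@le_trans _ _ (L * (s / e))).
      by rewrite mulrA ler_pdivlMr // mulrC; exact: le_trans h2' h.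
    by rewrite ler_pM2l // le_max lexx orbT.
  apply: (@le_trans _ _ (1 * L0)); first by rewrite mul1r ltW.
  by apply: ler_pM => //; [exact: ltW|rewrite le_max lexx].
have /andP[h1 h2] := integral_bounds (as_measure mO) cf mE mE' f01 fE fE'.
rewrite !asO // in h1 h2; split=> //; apply: le_trans h1.
rewrite le_eqVlt; apply/orP; left; apply/eqP; rewrite /limit_volume /mO; congr (_ * _)%E.
rewrite /hat_thurston /thurston_orbifold /pushforward; congr (m _).
apply/seteqP; split=> lam /=; last by case.
move=> h; split=> //=; rewrite /C le_max; apply/orP; right; rewrite ler_pdivlMr // mulrC.
exact: le_trans (lhat (ML_current (Phi lam))) h.
Qed.

Lemma ratioE L s : 0 < L -> ratio L s =
  (((L ^ d)^-1)%:E * \esum_(a in orb) (if (Fbar (hat_multiarc O a) <= L * s)%R then 1 else 0))%E.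
Proof.
move=> L0; rewrite /ratio counting_measure_sum; congr (_ * _)%E; apply: eq_esum => a _.
have iff : (Fbar (scale L^-1 (hat_multiarc O a)) <= s) = (Fbar (hat_multiarc O a) <= L * s).
  by rewrite Fhom ?invr_gt0 // ler_pdivrMl.
rewrite diracE -iff; case: ifPn => h; first by rewrite mem_set.
by rewrite memNset //=; exact/negP.
Qed.

Lemma ratio_scaling L s t : 0 < t -> 0 < L -> ratio L (t * s) = ((t ^ d)%:E * ratio (t * L)%R s)%E.
Proof.
move=> t0 L0; have tL0 : 0 < t * L by rewrite mulr_gt0.
rewrite !ratioE // muleA -EFinM expfzMl invfM.
rewrite (mulrA (t ^ d)) divff ?mul1r; last by rewrite gt_eqF // exprz_gt0.
congr (_ * _)%E; apply: eq_esum => a _.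
by rewrite mulrCA mulrA.
Qed.

(** The level 2 reflects the normalisation of the extension, by which [Fbar] of a doubled multiarc
    is twice the value of [F]. *)
Lemma orbit_count L : 0 < L -> (((L ^ d)^-1)%:E * counting [set a | orb a /\ (F a <= L)%R])%E = ratio L 2.
Proof.
move=> L0; rewrite ratioE //; congr (_ * _)%E; rewrite counting_esum.
rewrite [RHS](esumID [set a | F a <= L]); last by move=> a _; case: ifP.
rewrite [X in (_ + X)%E]esum1 ?adde0.
  apply: eq_esum => a [[ma oa] Fa]; case: F_extends => _ _ -> //.
  by rewrite mulrC ler_pM2r // Fa.
move=> a [[ma oa] /negP Fa]; case: F_extends => _ _ -> //.
by rewrite mulrC ler_pM2r // (negbTE Fa).
Qed.

Lemma orbit_count_cvg : (((L ^ d)^-1)%:E * counting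
     [set a | orb a /\ (F a <= L)%R])%E @[L --> +oo] -->
  (c%:E * thurston_orbifold m Phi [set lam : ML O | (on_currents Fbar (mval lam) <= 1)%R])%E.
Proof.
have -> : (c%:E * thurston_orbifold m Phi [set lam : ML O | (on_currents Fbar (mval lam) <= 1)%R])%E =
    limit_volume 2.
  rewrite /limit_volume /hat_thurston /thurston_orbifold /pushforward; congr (_ * m _)%E.
  by apply/seteqP; split=> lam /=; rewrite /on_currents ler_pdivrMr // mul1r.
have [c0 _] := c_constant.
have h : ratio L 2 @[L --> +oo] --> limit_volume 2.
  apply: (@homogeneous_squeeze R ratio (limit_volume 2) d).
  - by apply: mule_ge0; rewrite ?lee_fin // /hat_thurston /thurston_orbifold /pushforward.
  - by move=> L s t; exact: ratio_scaling.
  - move=> s /andP[s0 s2]; have [J [j [Jj JL [_ jV]]]] := squeeze s0 s2.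
    by exists J, j; split=> // L /JL[].
  - move=> s s2; have [J [j [Jj JL [jV _]]]] := squeeze (ltr0n _ 2) s2.
    by exists J, j; split=> // L /JL[].
apply: cvg_trans h; apply: near_eq_cvg; near=> L; apply/esym/orbit_count.
by near: L; exact: nbhs_pinfty_gt (num_real _).
Unshelve. all: by end_near. Qed.

End Limit.
End Counting.

Theorem corollary5p6 (R : realType) (O : orbifold R) (g r : nat)
  (O_boundary : boundary_geodesic O !=set0)
  (O_genus : genus O g) (O_number : boundary_and_cone_number O r)
  (gr03 : (g, r) <> (0%N, 3%N))
  (S : orbifold R) (J : 'cV[R]_3 -> 'cV[R]_3) (rho : 'M[R]_3 -> 'M[R]_3)
  (delta : R) (S_surface : surface_of O S J rho delta)
  (m : {measure set (borel (ML S)) -> \bar R})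
  (m_thurston : thurston_measure (growth g r) m)
  (Phi : ML S -> ML O) (Phi_natural : natural_map rho Phi)
  (Gam : set ('cV[R]_3 -> 'cV[R]_3)) (Gam_index : finite_index_subgroup O Gam)
  (a0 : weights R) (a0_multiarc : multiarc O a0)
  (c : R) (c_constant : counting_constant m Phi Gam a0 (growth g r) c)
  (F : weights R -> R) (Fbar : dcurrents O -> R)
  (F_extends : extends F Fbar) (F_positive : positive_extension Fbar) :
  (((L ^ growth g r)^-1)%:E * counting
     [set a | multiarc_orbit O Gam a0 a /\ (F a <= L)%R])%E @[L --> +oo] -->
  (c%:E * thurston_orbifold m Phi
    [set lam : ML O | (on_currents Fbar (mval lam) <= 1)%R])%E.
Proof.
have [cPhi _ _] := Phi_natural.
exact: (orbit_count_cvg Gam_index a0_multiarc F_extends F_positive O_boundary cPhi c_constant).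
Qed.
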